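(* Let $X=Spin(2n)/P_n$ $(n\ge4)$ be a spinor variety, $t=\lfloor n/2\rfloor$, and let $\lambda_1,\dots,\lambda_n$ be the fundamental dominant weights of $Spin(2n)$. For every integer $r\ge0$ the irreducible decomposition of $\mathrm{Sym}^rT_X$ is $$\mathrm{Sym}^rT_X=\begin{cases}\displaystyle\bigoplus_{\substack{i_1+2i_2+\dots+ti_t=r\\ i_1,\dots,i_t\ge0}}E_{i_1\lambda_2+i_2\lambda_4+\dots+i_{t-1}\lambda_{2t-2}+i_t(\lambda_{n-1}+\lambda_n)}, & n\text{ odd},\\[6mm] \displaystyle\bigoplus_{\substack{i_1+2i_2+\dots+ti_t=r\\ i_1,\dots,i_t\ge0}}E_{i_1\lambda_2+i_2\lambda_4+\dots+i_{t-1}\lambda_{2t-2}+i_t(2\lambda_n)}, & n\text{ even}.\end{cases}$$ Hence if $n$ is odd, the fundamental highest weights of $T_X^*$ are $\lambda_2,\lambda_4,\dots,\lambda_{2t-2},\lambda_{n-1}+\lambda_n$, of degrees $1,2,\dots,t$ respectively; if $n$ is even, they are $\lambda_2,\lambda_4,\dots,\lambda_{2t-2},2\lambda_n$, of degrees $1,2,\dots,t$ respectively.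
   Context: Everything is over $\mathbb{C}$. $G=Spin(2n)$ is of type $D_n$, simple roots $\alpha_i$ and fundamental weights $\lambda_i$ in Bourbaki order; $P_n$ is the maximal parabolic subgroup attached to $\alpha_n$, with the convention that its Lie algebra $\mathfrak p_n$ contains all negative root spaces, so that the weights of $\mathfrak g/\mathfrak p_n$ are the positive roots involving $\alpha_n$. Homogeneous vector bundles on $G/P_n$ are identified with $P_n$-modules, $T_X$ corresponding to $\mathfrak g/\mathfrak p_n$. $E_\lambda$ denotes the irreducible homogeneous vector bundle (irreducible $P_n$-module) with highest weight $\lambda$ with respect to the Levi part $R$ of $P_n$. Fundamental highest weights: for an $R$-module $V$ such that every irreducible $R$-module occurs at most once in the algebra of polynomials $\mathcal P(V)=\bigoplus_{i\ge0}\mathrm{Sym}^i(V^* )$, let $\Lambda$ be the set of highest weights occurring in $\mathcal P(V)$ and $h_\lambda$ the (unique up to scalar, homogeneous) highest weight vector of weight $\lambda\in\Lambda$. The fundamental highest weights of $V$ are the $\lambda\in\Lambda$ with $h_\lambda$ an irreducible polynomial; the degree of a fundamental highest weight $\omega$ is $\deg h_\omega$. Those of $T_X^*$ are the ones for $V=(\mathfrak g/\mathfrak p_n)^*$, so $\mathcal P(V)=\bigoplus_r\mathrm{Sym}^r(\mathfrak g/\mathfrak p_n)$. *)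

(* Defs.v *)
From HB Require Import structures.
From mathcomp Require Import all_boot all_order all_algebra.
From mathcomp Require Import mpoly ring zify.

Set Implicit Arguments.
Unset Strict Implicit.
Unset Printing Implicit Defensive.

Import Order.TTheory GRing.Theory Num.Theory.
Local Open Scope ring_scope.

(* All indices k of e_k, f_k, alpha_k, lambda_k below are natural numbers     *)
(* 1, ..., n in Bourbaki's order.                                             *)

(* -------------------------------------------------------------------------- *)
(* The Clifford algebra of V = F^2n with basis e_1 .. e_n, f_1 .. f_n and     *)
(* quadratic form q = sum_k v_k v_(n+k) is realized as the algebra of all     *)
(* matrices of size 2^n (Jordan-Wigner), with e_i f_j + f_j e_i = delta_ij;   *)
(* see gamma_sqr.                                                             *)

Fixpoint spinor_dim (n : nat) : nat :=
  if n is n'.+1 then (spinor_dim n' + spinor_dim n')%N else 1%N.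

Fixpoint e_op (F : numFieldType) (n k : nat) : 'M[F]_(spinor_dim n) :=
  match n return 'M[F]_(spinor_dim n) with
  | 0 => 0
  | n'.+1 => match k with
             | 0 => 0
             | 1 => block_mx 0 1%:M 0 0
             | k'.+1 => block_mx (e_op F n' k') 0 0 (- e_op F n' k')
             end
  end.

Definition f_op (F : numFieldType) (n k : nat) : 'M[F]_(spinor_dim n) :=
  (e_op F n k)^T.

Definition quad (F : numFieldType) (n : nat) (v : 'cV[F]_(n + n)) : F :=
  \sum_(k < n) v (lshift n k) 0 * v (rshift n k) 0.

Definition gamma (F : numFieldType) (n : nat) (v : 'cV[F]_(n + n)) :
    'M[F]_(spinor_dim n) :=
  \sum_(k < n) (v (lshift n k) 0 *: e_op F n k.+1
                + v (rshift n k) 0 *: f_op F n k.+1).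

(* Spin(2n): products of an even number of vectors v with q(v) = 1.           *)
Definition spin (F : numFieldType) (n : nat) (g : 'M[F]_(spinor_dim n)) : Prop :=
  exists vs : seq 'cV[F]_(n + n),
    [/\ ~~ odd (size vs), all (fun v => quad v == 1) vs
      & g = \big[mulmx/1%:M]_(v <- vs) gamma v].

Definition hyp_mx (F : numFieldType) (n : nat) : 'M[F]_(n + n) :=
  block_mx 0 1%:M 1%:M 0.

(* The vector representation Spin(2n) -> SO(2n), v |-> g v g^-1; the          *)
(* coordinates of x = gamma w are recovered by the trace form; see vect_repE. *)
Definition vect_rep (F : numFieldType) (n : nat) (g : 'M[F]_(spinor_dim n)) :
    'M[F]_(n + n) :=
  \matrix_(i, j) (2%:R / (spinor_dim n)%:R
    * \tr (gamma (hyp_mx F n *m delta_mx i 0)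
           *m (g *m gamma (delta_mx j 0) *m invmx g))).

(* -------------------------------------------------------------------------- *)
(* The Lie algebra of Spin(2n), identified with so(2n) through vect_rep, so   *)
(* that the adjoint action of g is conjugation by vect_rep g.                 *)

Definition so_mx (F : numFieldType) (n : nat) (X : 'M[F]_(n + n)) : Prop :=
  X^T *m hyp_mx F n + hyp_mx F n *m X = 0.

Definition Ad (F : numFieldType) (n : nat) (A X : 'M[F]_(n + n)) :
    'M[F]_(n + n) :=
  A *m X *m invmx A.

Definition cartan (F : numFieldType) (n : nat) (H : 'rV[F]_n) : 'M[F]_(n + n) :=
  block_mx (diag_mx H) 0 0 (- diag_mx H).

Definition eps (n k : nat) : 'rV[int]_n := \row_(j < n) (j.+1 == k)%:R.

Definition simple_root (n k : nat) : 'rV[int]_n :=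
  if (k < n)%N then eps n k - eps n k.+1 else eps n n.-1 + eps n n.

Definition lin_form (F : numFieldType) (n : nat) (b : 'rV[int]_n)
    (H : 'rV[F]_n) : F :=
  \sum_(j < n) (b 0 j)%:~R * H 0 j.

(* The eigenspace of the Cartan subalgebra for sum_k c_k alpha_k: a root      *)
(* space, the Cartan subalgebra (c = 0), or zero.                             *)
Definition root_space (F : numFieldType) (n : nat) (c : nat -> int)
    (X : 'M[F]_(n + n)) : Prop :=
  so_mx X /\ forall H : 'rV[F]_n,
    cartan H *m X - X *m cartan H
      = lin_form (\sum_(1 <= k < n.+1) c k *: simple_root n k) H *: X.

(* The sum of the spaces above whose coefficient on alpha_n satisfies D.      *)
Definition graded_part (F : numFieldType) (n : nat) (D : int -> bool)
    (X : 'M[F]_(n + n)) : Prop :=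
  exists (m : nat) (c : 'I_m -> nat -> int) (Y : 'I_m -> 'M[F]_(n + n)),
    (forall i, D (c i n) /\ root_space (c i) (Y i)) /\ X = \sum_i Y i.

(* p_n contains the Cartan subalgebra, the negative root spaces and the       *)
(* positive root spaces not involving alpha_n.                                *)
Definition lie_pn (F : numFieldType) (n : nat) : 'M[F]_(n + n) -> Prop :=
  graded_part (fun z => z <= 0).

Definition lie_pn_opp (F : numFieldType) (n : nat) : 'M[F]_(n + n) -> Prop :=
  graded_part (fun z => 0 <= z).

(* A parabolic subgroup is the normalizer of its Lie algebra.                 *)
Definition parabolic (F : numFieldType) (n : nat) (g : 'M[F]_(spinor_dim n)) :
    Prop :=
  spin g /\ forall X, lie_pn X -> lie_pn (Ad (vect_rep g) X).

Definition parabolic_opp (F : numFieldType) (n : nat)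
    (g : 'M[F]_(spinor_dim n)) : Prop :=
  spin g /\ forall X, lie_pn_opp X -> lie_pn_opp (Ad (vect_rep g) X).

Definition levi (F : numFieldType) (n : nat) (g : 'M[F]_(spinor_dim n)) : Prop :=
  parabolic g /\ parabolic_opp g.

(* -------------------------------------------------------------------------- *)
(* Maximal torus and weights.  torus_elt k z scales e_k by z and f_k by z^-1. *)

Definition torus_elt (F : numFieldType) (n k : nat) (z : F) :
    'M[F]_(spinor_dim n) :=
  z *: (e_op F n k *m f_op F n k) + f_op F n k *m e_op F n k.

(* The simple coroots, as cocharacters of Spin(2n).                           *)
Definition coroot (F : numFieldType) (n k : nat) (z : F) :
    'M[F]_(spinor_dim n) :=
  if (k < n)%N then torus_elt n k z *m torus_elt n k.+1 z^-1
  else z^-1 *: (torus_elt n n.-1 z *m torus_elt n n z).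

(* As Spin(2n) is simply connected, its maximal torus is the product of the   *)
(* images of the simple coroots, and the fundamental weights are the basis of *)
(* the weight lattice dual to the simple coroots.  A weight is represented by *)
(* its coordinates on this basis (not on the eps_k).                          *)
Definition fund_weight (n k : nat) : 'rV[int]_n := \row_(j < n) (j.+1 == k)%:R.

(* The root subgroup of Spin(2n) for the root eps_i - eps_j.                  *)
Definition root_elt (F : numFieldType) (n i j : nat) (z : F) :
    'M[F]_(spinor_dim n) :=
  1%:M + z *: (e_op F n i *m f_op F n j).

(* -------------------------------------------------------------------------- *)
(* g / p_n has as basis the classes of the root vectors of the roots          *)
(* eps_i + eps_j (i < j); they fill the upper right block of so(2n), and p_n  *)
(* is the kernel of ursubmx on so(2n), see lie_pnE.                           *)

Definition tangent_idx (n : nat) := {p : 'I_n * 'I_n | (p.1 < p.2)%N}.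

Definition tangent_dim (n : nat) : nat := #|{: tangent_idx n}|.

Definition tangent_vec (F : numFieldType) (n : nat) (a : tangent_idx n) :
    'M[F]_(n + n) :=
  block_mx 0 (delta_mx (val a).1 (val a).2 - delta_mx (val a).2 (val a).1) 0 0.

(* Sym(g / p_n), that is, P(V) for V = (g / p_n)^*.                           *)
Notation sym_tangent F n := {mpoly F[tangent_dim n]}.

Definition tangent_act (F : numFieldType) (n : nat) (g : 'M[F]_(spinor_dim n))
    (a : tangent_idx n) : sym_tangent F n :=
  \sum_(b : tangent_idx n)
    ursubmx (Ad (vect_rep g) (tangent_vec F a)) (val b).1 (val b).2
      *: 'X_(enum_rank b).

Definition sym_act (F : numFieldType) (n : nat) (g : 'M[F]_(spinor_dim n))
    (p : sym_tangent F n) : sym_tangent F n :=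
  p \mPo [tuple tangent_act g (enum_val i) | i < tangent_dim n].

(* -------------------------------------------------------------------------- *)
(* Submodules of Sym(g / p_n) for a subgroup G of Spin(2n).                   *)

Definition submodule (F : numFieldType) (n : nat)
    (G : 'M[F]_(spinor_dim n) -> Prop) (U : sym_tangent F n -> Prop) : Prop :=
  [/\ U 0, (forall a p p', U p -> U p' -> U (a *: p + p'))
    & forall g p, G g -> U p -> U (sym_act g p)].

Definition irreducible_module (F : numFieldType) (n : nat)
    (G : 'M[F]_(spinor_dim n) -> Prop) (U : sym_tangent F n -> Prop) : Prop :=
  [/\ submodule G U, (exists p, U p /\ p <> 0)
    & forall U' : sym_tangent F n -> Prop, submodule G U' ->
        (forall p, U' p -> U p) -> (exists p, U' p /\ p <> 0) ->
        forall p, U p -> U' p].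

Definition module_iso (F : numFieldType) (n : nat)
    (G : 'M[F]_(spinor_dim n) -> Prop) (U W : sym_tangent F n -> Prop) : Prop :=
  exists phi : sym_tangent F n -> sym_tangent F n,
    [/\ forall a p p', U p -> U p' -> phi (a *: p + p') = a *: phi p + phi p',
        forall p, U p -> W (phi p),
        forall p p', U p -> U p' -> phi p = phi p' -> p = p',
        forall w, W w -> exists p, U p /\ phi p = w
      & forall g p, G g -> U p -> phi (sym_act g p) = sym_act g (phi p)].

Definition has_weight (F : numFieldType) (n : nat) (w : 'rV[int]_n)
    (p : sym_tangent F n) : Prop :=
  forall (k : 'I_n) (z : F), z != 0 ->
    sym_act (coroot n k.+1 z) p = z ^ (w 0 k) *: p.

(* Highest weight vectors for the Levi part, whose positive roots are the     *)
(* eps_i - eps_j with i < j.                                                  *)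
Definition highest_weight_vector (F : numFieldType) (n : nat) (w : 'rV[int]_n)
    (p : sym_tangent F n) : Prop :=
  [/\ p <> 0, has_weight w p
    & forall (i j : 'I_n) (z : F), (i < j)%N ->
        sym_act (root_elt n i.+1 j.+1 z) p = p].

(* U is isomorphic to E_w.                                                    *)
Definition is_irr_hw (F : numFieldType) (n : nat) (w : 'rV[int]_n)
    (U : sym_tangent F n -> Prop) : Prop :=
  irreducible_module (@parabolic F n) U
  /\ exists p, U p /\ highest_weight_vector w p.

Definition direct_sum (F : numFieldType) (n : nat) (I : finType)
    (W : I -> sym_tangent F n -> Prop) (S : sym_tangent F n -> Prop) : Prop :=
  (forall i p, W i p -> S p)
  /\ forall p, S p ->
       exists! x : {ffun I -> sym_tangent F n},
         (forall i, W i (x i)) /\ p = \sum_i x i.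

(* -------------------------------------------------------------------------- *)
(* Fundamental highest weights of T_X^*.                                      *)

Definition multiplicity_free (F : numFieldType) (n : nat) : Prop :=
  forall U W : sym_tangent F n -> Prop,
    irreducible_module (@levi F n) U -> irreducible_module (@levi F n) W ->
    module_iso (@levi F n) U W -> forall p, U p <-> W p.

Definition irreducible_mpoly (F : numFieldType) (m : nat) (p : {mpoly F[m]}) :
    Prop :=
  [/\ p != 0, p \isn't a GRing.unit
    & forall a b, p = a * b -> a \is a GRing.unit \/ b \is a GRing.unit].

(* msize p is one more than the degree of p.                                  *)
Definition fundamental_hw (F : numFieldType) (n : nat) (w : 'rV[int]_n)
    (d : nat) : Prop :=
  exists h : sym_tangent F n,
    [/\ highest_weight_vector w h, irreducible_mpoly h & (msize h).-1 = d].

(* -------------------------------------------------------------------------- *)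
(* gen_weight n k is the k-th weight of the list lambda_2, lambda_4, ...,     *)
(* lambda_(2t-2), lambda_(n-1) + lambda_n (n odd) or 2 lambda_n (n even).     *)
Definition gen_weight (n k : nat) : 'rV[int]_n :=
  if (k < n./2)%N then fund_weight n k.*2
  else if odd n then fund_weight n n.-1 + fund_weight n n
  else fund_weight n n *+ 2.

(* The tuples (i_1, ..., i_t) with i_1 + 2 i_2 + ... + t i_t = r; each i_k is *)
(* then at most r.  The component at k : 'I_t is i_(k+1).                     *)
Definition exponents (t r : nat) :=
  {i : {ffun 'I_t -> 'I_r.+1} | (\sum_(k < t) k.+1 * i k == r)%N}.

Definition exp_weight (n r : nat) (i : exponents n./2 r) : 'rV[int]_n :=
  \sum_(k < n./2) gen_weight n k.+1 *+ val i k.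

(* -------------------------------------------------------------------------- *)
(* The facts referred to above: gamma_sqr, vect_repE, lie_pnE.                *)

Lemma e_op_anti (F : numFieldType) (n i j : nat) :
  e_op F n i *m e_op F n j + e_op F n j *m e_op F n i = 0.
Proof.
elim: n i j => [|n IHn] [|[|i]] [|[|j]]; rewrite /= ?mulmx0 ?mul0mx ?addr0 //.
- by rewrite mulmx_block !(mul0mx, mulmx0, addr0, add0r) block_mx0 addr0.
- rewrite !mulmx_block add_block_mx -[RHS]block_mx0.
  by rewrite !(mul0mx, mulmx0, addr0, add0r, mul1mx, mulmx1) addNr.
- rewrite !mulmx_block add_block_mx -[RHS]block_mx0.
  by rewrite !(mul0mx, mulmx0, addr0, add0r, mul1mx, mulmx1) addrN.
- rewrite !mulmx_block add_block_mx -[RHS]block_mx0.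
  by rewrite !(mul0mx, mulmx0, addr0, add0r, mulmxN, mulNmx, opprK) IHn.
Qed.

Lemma f_op_anti (F : numFieldType) (n i j : nat) :
  f_op F n i *m f_op F n j + f_op F n j *m f_op F n i = 0.
Proof.
by rewrite -!trmx_mul -linearD e_op_anti linear0.
Qed.

Lemma ef_op_anti (F : numFieldType) (n i j : nat) :
  e_op F n i *m f_op F n j + f_op F n j *m e_op F n i
    = ((i == j) && (0 < i <= n)%N)%:R%:M.
Proof.
elim: n i j => [|n IHn] [|[|i]] [|[|j]];
  rewrite /f_op /= ?trmx0 ?mulmx0 ?mul0mx ?addr0 ?andbF ?raddf0 //.
- rewrite tr_block_mx !trmx0 trmx1 !mulmx_block add_block_mx.
  by rewrite !(mul0mx, mulmx0, addr0, add0r, mul1mx, mulmx1) -scalar_mx_block.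
- rewrite tr_block_mx !trmx0 linearN !mulmx_block add_block_mx /=.
  by rewrite !(mul0mx, mulmx0, addr0, add0r, mul1mx, mulmx1) addNr block_mx0.
- rewrite tr_block_mx !trmx0 trmx1 !mulmx_block add_block_mx /=.
  by rewrite !(mul0mx, mulmx0, addr0, add0r, mul1mx, mulmx1) addNr block_mx0.
- rewrite tr_block_mx !trmx0 linearN !mulmx_block add_block_mx /=.
  rewrite !(mul0mx, mulmx0, addr0, add0r, mulmxN, mulNmx, opprK).
  by have := IHn i.+1 j.+1; rewrite /f_op => ->; rewrite -scalar_mx_block eqSS.
Qed.

Definition polar (F : numFieldType) (n : nat) (v w : 'cV[F]_(n + n)) : F :=
  \sum_(k < n) (v (lshift n k) 0 * w (rshift n k) 0
                + v (rshift n k) 0 * w (lshift n k) 0).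

Lemma gamma_polar (F : numFieldType) (n : nat) (v w : 'cV[F]_(n + n)) :
  gamma v *m gamma w + gamma w *m gamma v = (polar v w)%:M.
Proof.
have E : forall v w : 'cV[F]_(n + n), gamma v *m gamma w = \sum_(k < n) \sum_(l < n)
  (v (lshift n k) 0 *: e_op F n k.+1 + v (rshift n k) 0 *: f_op F n k.+1) *m
  (w (lshift n l) 0 *: e_op F n l.+1 + w (rshift n l) 0 *: f_op F n l.+1).
  move=> v' w'; rewrite /gamma mulmx_suml; apply: eq_bigr => k _.
  by rewrite mulmx_sumr.
rewrite !E [X in _ + X]exchange_big -big_split /polar raddf_sum /=.
apply: eq_bigr => k _; rewrite -big_split /= (bigD1 k) //= big1 ?addr0 => [|l /negbTE lk].
- set a := v _ _; set b := v _ _; set c := w _ _; set d := w _ _.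
  set e := e_op _ _ _; set f := f_op _ _ _.
  have -> : (a *: e + b *: f) *m (c *: e + d *: f)
            + (c *: e + d *: f) *m (a *: e + b *: f)
          = (a * c) *: (e *m e + e *m e) + (b * d) *: (f *m f + f *m f)
            + (a * d + b * c) *: (e *m f + f *m e).
    rewrite !mulmxDl !mulmxDr -!scalemxAl -!scalemxAr !scalerA.
    by apply/matrixP => p q; rewrite !mxE; ring.
  rewrite e_op_anti f_op_anti ef_op_anti eqxx ltnS ltn_ord !scaler0 !add0r.
  by rewrite scale_scalar_mx mulr1.
set a := v _ _; set b := v _ _; set c := w _ _; set d := w _ _.
set e := e_op _ _ _; set f := f_op _ _ _.
set e' := e_op _ _ _; set f' := f_op _ _ _.
have -> : (a *: e + b *: f) *m (c *: e' + d *: f')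
          + (c *: e' + d *: f') *m (a *: e + b *: f)
        = (a * c) *: (e *m e' + e' *m e) + (b * d) *: (f *m f' + f' *m f)
          + (a * d) *: (e *m f' + f' *m e) + (b * c) *: (e' *m f + f *m e').
  rewrite !mulmxDl !mulmxDr -!scalemxAl -!scalemxAr !scalerA.
  by apply/matrixP => p q; rewrite !mxE; ring.
have lk' : (nat_of_ord l == k) = false by [].
rewrite e_op_anti f_op_anti !ef_op_anti !scaler0 addr0 !eqSS (eq_sym (nat_of_ord k)) lk' /=.
by rewrite add0r !scale_scalar_mx !mulr0 raddf0 !addr0.
Qed.

Lemma gamma_sqr (F : numFieldType) (n : nat) (v : 'cV[F]_(n + n)) :
  gamma v *m gamma v = (quad v)%:M.
Proof.
have := gamma_polar v v.
have -> : polar v v = quad v *+ 2.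
  rewrite /polar /quad -sumrMnl; apply: eq_bigr => k _.
  by rewrite mulr2n [X in _ + X]mulrC.
rewrite -mulr2n raddfMn /= => /eqP.
rewrite -subr_eq0 -mulrnBl -scaler_nat scaler_eq0 pnatr_eq0 /= subr_eq0.
by move/eqP.
Qed.

Lemma gamma_linear (F : numFieldType) (n : nat) a (v w : 'cV[F]_(n + n)) :
  gamma (a *: v + w) = a *: gamma v + gamma w.
Proof.
rewrite /gamma scaler_sumr -big_split; apply: eq_bigr => k _ /=.
by apply/matrixP => p q; rewrite !mxE; ring.
Qed.

Lemma spin_unit (F : numFieldType) (n : nat) (g : 'M[F]_(spinor_dim n)) :
  spin g -> g \in unitmx.
Proof.
move=> [vs [_ /allP q1 ->]].
elim: vs q1 => [|v vs IHvs] q1; first by rewrite big_nil unitmx1.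
rewrite big_cons unitmx_mul IHvs ?andbT => [|w ws]; last by rewrite q1 // inE ws orbT.
have /eqP qv : quad v == 1 by rewrite q1 // mem_head.
by have := gamma_sqr v; rewrite qv => /mulmx1_unit [].
Qed.

Lemma spin_conj (F : numFieldType) (n : nat) (g : 'M[F]_(spinor_dim n))
    (v : 'cV[F]_(n + n)) :
  spin g -> exists w, g *m gamma v = gamma w *m g.
Proof.
move=> [vs [/negbTE ev /allP q1 ->]].
suff [w [W _]] : exists w : 'cV[F]_(n + n),
    (\big[mulmx/1%:M]_(x <- vs) gamma x) *m gamma v
      = (-1) ^+ odd (size vs) *: (gamma w *m \big[mulmx/1%:M]_(x <- vs) gamma x)
    /\ True.
  by exists w; rewrite W ev expr0 scale1r.
elim: vs q1 {ev} => [|u vs IHvs] q1.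
  by exists v; rewrite big_nil mul1mx mulmx1 expr0 scale1r.
have {IHvs} [x /= xs|w [W _]] := IHvs; first by rewrite q1 // inE xs orbT.
have /eqP qu : quad u == 1 by rewrite q1 // mem_head.
exists (w - polar u w *: u); split => //=; rewrite big_cons -mulmxA W.
have -> : gamma (w - polar u w *: u) = - (gamma u *m gamma w *m gamma u).
  have -> : gamma u *m gamma w = (polar u w)%:M - gamma w *m gamma u.
    by rewrite -gamma_polar addrK.
  rewrite mulmxBl -mulmxA gamma_sqr qu mulmx1 mul_scalar_mx addrC -scaleNr.
  by rewrite gamma_linear scaleNr opprB addrC.
rewrite signrN scaleNr mulNmx scalerN opprK -!scalemxAr.
by rewrite -!mulmxA [gamma u *m (gamma u *m _)]mulmxA gamma_sqr qu mul1mx.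
Qed.

Lemma mxtrace_gamma (F : numFieldType) (n : nat) (v w : 'cV[F]_(n + n)) :
  2%:R * \tr (gamma v *m gamma w) = (spinor_dim n)%:R * polar v w.
Proof.
have /(congr1 mxtrace) := gamma_polar v w.
rewrite linearD /= mxtrace_scalar [\tr (gamma w *m _)]mxtrace_mulC => H.
by rewrite mulr_natl mulr_natl -H mulr2n.
Qed.

Lemma spinor_dim_neq0 (F : numFieldType) (n : nat) : (spinor_dim n)%:R != 0 :> F.
Proof.
by rewrite pnatr_eq0 -lt0n; elim: n => //= n IHn; rewrite addn_gt0 IHn.
Qed.

Lemma polar_hyp (F : numFieldType) (n : nat) (i : 'I_(n + n)) (w : 'cV[F]_(n + n)) :
  polar (hyp_mx F n *m delta_mx i 0) w = w i 0.
Proof.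
have -> : polar (hyp_mx F n *m delta_mx i 0) w = \sum_k (k == i)%:R * w k 0.
  rewrite big_split_ord /= -big_split /polar; apply: eq_bigr => k _ /=.
  rewrite -colE addrC; congr (_ * _ + _ * _).
    rewrite mxE; case: (split_ordP i) => j ->; rewrite /hyp_mx.
      by rewrite block_mxEul mxE eq_rlshift.
    by rewrite block_mxEur mxE (inj_eq (@rshift_inj _ _)).
  rewrite mxE; case: (split_ordP i) => j ->; rewrite /hyp_mx.
    by rewrite block_mxEdl mxE (inj_eq (@lshift_inj _ _)).
  by rewrite block_mxEdr mxE eq_lrshift.
rewrite (bigD1 i) //= eqxx mul1r big1 ?addr0 // => k /negbTE ->.
by rewrite mul0r.
Qed.

Lemma vect_repE (F : numFieldType) (n : nat) (g : 'M[F]_(spinor_dim n))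
    (v : 'cV[F]_(n + n)) :
  spin g -> gamma (vect_rep g *m v) = g *m gamma v *m invmx g.
Proof.
move=> sg; have ug := spin_unit sg.
have D (x : 'cV[F]_(n + n)) : exists w, g *m gamma x *m invmx g = gamma w.
  by have [w W] := spin_conj x sg; exists w; rewrite W mulmxK.
have [w W] := D v; rewrite W; congr gamma.
apply/colP => i; rewrite mxE.
have -> : w i 0 = 2%:R / (spinor_dim n)%:R
    * \tr (gamma (hyp_mx F n *m delta_mx i 0) *m (g *m gamma v *m invmx g)).
  rewrite mulrAC W mxtrace_gamma polar_hyp mulrC mulKf //.
  exact: spinor_dim_neq0.
have gam0 : gamma (0 : 'cV[F]_(n+n)) = 0.
  by have := gamma_linear (-1) 0 (0 : 'cV[F]_(n+n)); rewrite scaleN1r addNr scaleN1r addNr.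
have -> : gamma v = \sum_j v j 0 *: gamma (delta_mx j 0 : 'cV[F]_(n + n)).
  rewrite {1}[v]matrix_sum_delta.
  transitivity (gamma (\sum_j v j 0 *: (delta_mx j 0 : 'cV[F]_(n + n)))).
    by congr gamma; apply: eq_bigr => j _; rewrite big_ord1.
  elim/big_ind2: _ => // [x x' y y' <- <-|j _].
    by have := gamma_linear 1 x' y'; rewrite !scale1r.
  by have := gamma_linear (v j 0) (delta_mx j 0) 0; rewrite gam0 !addr0.
rewrite mulmx_sumr mulmx_suml mulmx_sumr raddf_sum mulr_sumr /=.
apply: eq_bigr => j _; rewrite mxE mulrC -!(scalemxAr, scalemxAl) linearZ /=.
by rewrite mulrCA.
Qed.

Definition root_sum (n : nat) (c : nat -> int) : 'rV[int]_n :=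
  \sum_(1 <= k < n.+1) c k *: simple_root n k.

Lemma eps_sum (n k : nat) : (0 < k <= n)%N -> \sum_(s < n) eps n k 0 s = 1.
Proof.
move=> /andP[k0 kn]; have kn' : (k.-1 < n)%N by rewrite prednK.
rewrite (bigD1 (Ordinal kn')) //= mxE /= prednK // eqxx big1 ?addr0 // => s sk.
rewrite mxE; case: eqP => // sk'; case/eqP: sk; apply: val_inj => /=.
by rewrite -sk'.
Qed.

Lemma root_sum_coef (n : nat) (c : nat -> int) : (1 < n)%N ->
  \sum_(s < n) root_sum n c 0 s = c n *+ 2.
Proof.
move=> n1; rewrite /root_sum.
under eq_bigr => s _ do rewrite summxE.
rewrite exchange_big /= big_nat_recr /=; last by lia.
rewrite big_nat big1 ?add0r => [|k /andP[k0 kn]].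
  under eq_bigr => s _ do rewrite mxE /simple_root ltnn mxE.
  rewrite -mulr_sumr big_split /= !eps_sum ?mulr2n ?mulrDr ?mulr1 //; lia.
under eq_bigr => s _ do rewrite mxE /simple_root kn mxE [X in _ + X]mxE.
by rewrite -mulr_sumr sumrB !eps_sum ?subrr ?mulr0 //; lia.
Qed.

Lemma root_sum_ex (n : nat) (i j : nat) : (0 < i <= n)%N -> (0 < j <= n)%N ->
  exists c, root_sum n c = eps n i - eps n j /\ c n = 0.
Proof.
wlog ij : i j / (i <= j)%N.
  move=> W Hi Hj; case/orP: (leq_total i j) => ij; first exact: W.
  have [c [Hc c0]] := W j i ij Hj Hi; exists (fun k => - c k).
  rewrite c0 oppr0 -opprB -Hc /root_sum -sumrN; split=> //.
  by apply: eq_bigr => k _; rewrite scaleNr.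
move=> Hi Hj; exists (fun k => (i <= k < j)%N%:R); split; last first.
  by have -> : (i <= n < j)%N = false by lia.
have n0 : (0 < n)%N by lia.
rewrite /root_sum (big_cat_nat (n := i)) /=; [|lia|lia].
rewrite (big_cat_nat (n := j) (m := i)) /=; [|lia|lia].
have Z a b : (forall k, (a <= k < b)%N -> (i <= k < j)%N = false) ->
    \sum_(a <= k < b) (i <= k < j)%N%:R *: simple_root n k = 0.
  by move=> H; rewrite big_nat big1 // => k /H ->; rewrite mulr0n scale0r.
rewrite (Z 1%N i) ?(Z j n.+1) ?add0r ?addr0; try by (move=> *; lia).
rewrite -[RHS]opprB -(telescope_sumr _ ij) -sumrN big_nat [RHS]big_nat.
apply: eq_bigr => k Hk; rewrite Hk scale1r opprB /simple_root.
by have -> : (k < n)%N by lia.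
Qed.

Lemma root_sum_opp_ex (n : nat) (i j : nat) : (1 < n)%N ->
  (0 < i <= n)%N -> (0 < j <= n)%N ->
  exists c, root_sum n c = - (eps n i + eps n j) /\ c n = -1.
Proof.
move=> n1 Hi Hj.
have [c [Hc c0]] : exists c, root_sum n c = eps n i - eps n n.-1 /\ c n = 0.
  by apply: root_sum_ex => //; lia.
have [d [Hd d0]] : exists c, root_sum n c = eps n j - eps n n /\ c n = 0.
  by apply: root_sum_ex => //; lia.
exists (fun k => - c k - d k - (k == n)%:R); rewrite c0 d0 eqxx; split=> //.
have HE : root_sum n (fun k => (k == n)%:R) = eps n n.-1 + eps n n.
  rewrite /root_sum big_nat_recr /=; last by lia.
  rewrite eqxx scale1r big_nat big1 => [|k Hk].
    by rewrite add0r /simple_root ltnn.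
  have -> : (k == n) = false by lia.
  by rewrite mulr0n scale0r.
transitivity (- root_sum n c - root_sum n d - root_sum n (fun k => (k == n)%:R)).
  rewrite /root_sum -!sumrN -!big_split /=. apply: eq_bigr => k _.
  by rewrite !scalerBl scaleNr.
by rewrite Hc Hd HE; apply/rowP => s; rewrite !mxE; ring.
Qed.

Lemma so_mxD (F : numFieldType) (n : nat) (X Y : 'M[F]_(n + n)) :
  so_mx X -> so_mx Y -> so_mx (X + Y).
Proof.
by rewrite /so_mx linearD /= mulmxDl mulmxDr addrACA => -> ->; rewrite addr0.
Qed.

Lemma so_mx0 (F : numFieldType) (n : nat) : so_mx (0 : 'M[F]_(n + n)).
Proof. by rewrite /so_mx trmx0 mul0mx mulmx0 addr0. Qed.

Lemma graded_partD (F : numFieldType) (n : nat) D (X Y : 'M[F]_(n + n)) :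
  graded_part D X -> graded_part D Y -> graded_part D (X + Y).
Proof.
move=> [m [c [A [HA ->]]]] [m' [c' [A' [HA' ->]]]].
exists (m + m')%N, (fun i => match split i with inl j => c j | inr j => c' j end),
  (fun i => match split i with inl j => A j | inr j => A' j end); split.
  by move=> i; case: (split i).
rewrite big_split_ord /=; congr (_ + _); apply: eq_bigr => i _.
  by rewrite (unsplitK (inl i)).
by rewrite (unsplitK (inr i)).
Qed.

Lemma cartan_comm (F : numFieldType) (n : nat) (H : 'rV[F]_n) (a b c d : 'M[F]_n) :
  cartan H *m block_mx a b c d - block_mx a b c d *m cartan H
  = block_mx (\matrix_(p, q) ((H 0 p - H 0 q) * a p q))
             (\matrix_(p, q) ((H 0 p + H 0 q) * b p q))
             (\matrix_(p, q) (- (H 0 p + H 0 q) * c p q))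
             (\matrix_(p, q) (- (H 0 p - H 0 q) * d p q)).
Proof.
rewrite /cartan !mulmx_block !(mul0mx, addr0, add0r, mulmx0, mulNmx, mulmxN).
rewrite opp_block_mx add_block_mx.
by congr block_mx; apply/matrixP => p q; rewrite mul_mx_diag mul_diag_mx !mxE; ring.
Qed.

Lemma so_mx_block (F : numFieldType) (n : nat) (a b c d : 'M[F]_n) :
  so_mx (block_mx a b c d) <-> [/\ d = - a^T, b^T = - b & c^T = - c].
Proof.
rewrite /so_mx /hyp_mx tr_block_mx !mulmx_block.
rewrite !(mul0mx, mul1mx, mulmx1, addr0, add0r, mulmx0) add_block_mx -[RHS]block_mx0.
split=> [/eq_block_mx[E1 E2 E3 E4]|[-> -> ->]].
  split; apply/eqP; rewrite -addr_eq0.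
  - by rewrite addrC E2.
  - by rewrite E4.
  - by rewrite E1.
by rewrite !(addrN, addNr) linearN /= trmxK addNr.
Qed.

Lemma lin_form_delta (F : numFieldType) (n : nat) (b : 'rV[int]_n) s :
  lin_form b (delta_mx 0 s : 'rV[F]_n) = (b 0 s)%:~R.
Proof.
rewrite /lin_form (bigD1 s) //= mxE !eqxx mulr1 big1 ?addr0 // => j /negbTE js.
by rewrite mxE js andbF mulr0.
Qed.

Lemma lin_form_eps (F : numFieldType) (n : nat) (p : 'I_n) (H : 'rV[F]_n) :
  lin_form (eps n p.+1) H = H 0 p.
Proof.
rewrite /lin_form (bigD1 p) //= mxE !eqxx mul1r big1 ?addr0 // => j /negbTE js.
rewrite mxE eqSS; have -> : (nat_of_ord j == p) = false by [].
by rewrite mul0r.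
Qed.

Lemma lin_formD (F : numFieldType) (n : nat) (b b' : 'rV[int]_n) (H : 'rV[F]_n) :
  lin_form (b + b') H = lin_form b H + lin_form b' H.
Proof.
by rewrite -big_split; apply: eq_bigr => j _; rewrite mxE intrD mulrDl.
Qed.

Lemma lin_formN (F : numFieldType) (n : nat) (b : 'rV[int]_n) (H : 'rV[F]_n) :
  lin_form (- b) H = - lin_form b H.
Proof.
by rewrite -sumrN; apply: eq_bigr => j _; rewrite mxE mulrNz mulNr.
Qed.

Lemma graded_part1 (F : numFieldType) (n : nat) (D : int -> bool) c
   (X : 'M[F]_(n + n)) : D (c n) -> root_space c X -> graded_part D X.
Proof.
move=> Dc cX; exists 1%N, (fun _ => c), (fun _ => X); split=> //.
by rewrite big_ord1.
Qed.

Lemma sum_block_mx (F : numFieldType) (n : nat) (I : finType) (a b c d : I -> 'M[F]_n) :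
  \sum_i block_mx (a i) (b i) (c i) (d i)
    = block_mx (\sum_i a i) (\sum_i b i) (\sum_i c i) (\sum_i d i).
Proof.
apply/matrixP => p q; rewrite summxE.
by case: (split_ordP p) => p' ->; case: (split_ordP q) => q' ->;
  rewrite ?(block_mxEul, block_mxEur, block_mxEdl, block_mxEdr) summxE;
  apply: eq_bigr => i _; rewrite ?(block_mxEul, block_mxEur, block_mxEdl, block_mxEdr).
Qed.

Lemma lie_pnE (F : numFieldType) (n : nat) (X : 'M[F]_(n + n)) : (1 < n)%N ->
  lie_pn X <-> so_mx X /\ ursubmx X = 0.
Proof.
move=> n1; split.
  move=> [m [c [Y [HY ->]]]]; elim/big_ind: _ => //.
  - by split; [exact: so_mx0 | apply/matrixP => p q; rewrite !mxE].
  - move=> A B [sA A0] [sB B0]; split; first exact: so_mxD.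
    apply/matrixP => p q; move/matrixP/(_ p q): A0; move/matrixP/(_ p q): B0.
    by rewrite !mxE => -> ->; rewrite addr0.
  move=> i _; have [cn [sY]] := HY i.
  move: (Y i) sY => {HY}Z; rewrite -(submxK Z) => sZ wZ; split=> //.
  rewrite block_mxKur; apply/matrixP => p q; rewrite [RHS]mxE.
  apply/eqP/negPn/negP; rewrite !mxE => nz.
  have E s : ((s == p)%:R + (s == q)%:R)%:~R = (root_sum n (c i) 0 s)%:~R :> F.
    have := wZ (delta_mx 0 s); rewrite cartan_comm scale_block_mx.
    case/eq_block_mx => _ /matrixP /(_ p q) + _ _.
    rewrite lin_form_delta !mxE => E1; have <- := mulIf nz E1.
    by rewrite !eqxx /= [s == p]eq_sym [s == q]eq_sym intrD !natz //; do 2!case: eqP.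
  have := root_sum_coef (c i) n1.
  under eq_bigr => s _ do rewrite -(intr_inj (E s)).
  have S r : \sum_(s < n) (s == r)%:R = 1 :> int.
    by rewrite (bigD1 r) //= eqxx big1 ?addr0 // => s /negbTE ->.
  rewrite big_split /= !S => E2; move: cn E2; lia.
rewrite -(submxK X); set a := ulsubmx X; set b := ursubmx X.
set c := dlsubmx X; set d := drsubmx X.
rewrite block_mxKur so_mx_block => -[[-> _ cT] ->] {b d}.
have graded0 : lie_pn (0 : 'M[F]_(n + n)).
  apply: (@graded_part1 _ _ _ (fun=> 0)) => //; split; first exact: so_mx0.
  by move=> H; rewrite mulmx0 mul0mx subr0 scaler0.
have -> : block_mx a 0 c (- a^T) =
    \sum_p \sum_q (block_mx (a p q *: delta_mx p q) 0 0 (- (a p q *: delta_mx q p))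
    + block_mx 0 0 ((c p q / 2%:R) *: (delta_mx p q - delta_mx q p)) 0).
  transitivity (\sum_p \sum_q block_mx (a p q *: delta_mx p q) 0
      ((c p q / 2%:R) *: (delta_mx p q - delta_mx q p)) (- (a p q *: delta_mx q p))).
    rewrite [RHS](_ : _ = block_mx (\sum_p \sum_q a p q *: delta_mx p q) 0
      (\sum_p \sum_q (c p q / 2%:R) *: (delta_mx p q - delta_mx q p))
      (- (\sum_p \sum_q a p q *: delta_mx q p))).
      congr block_mx; first exact: matrix_sum_delta.
        transitivity (2%:R^-1 *: (c - c^T)).
          by rewrite cT opprK -mulr2n -scaler_nat scalerA mulVf ?scale1r ?pnatr_eq0.
        have -> : c^T = \sum_p \sum_q c p q *: delta_mx q p.
          rewrite {1}[c]matrix_sum_delta linear_sum; apply: eq_bigr => p _.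
          by rewrite linear_sum; apply: eq_bigr => q _; rewrite linearZ /= trmx_delta.
        rewrite {1}[c]matrix_sum_delta -sumrB scaler_sumr.
        apply: eq_bigr => p _; rewrite -sumrB scaler_sumr; apply: eq_bigr => q _.
        by rewrite -scalerBr scalerA mulrC.
      rewrite {1}[a]matrix_sum_delta linear_sum; congr (- _).
      apply: eq_bigr => p _; rewrite linear_sum; apply: eq_bigr => q _.
      by rewrite linearZ /= trmx_delta.
    under eq_bigr => p _ do rewrite sum_block_mx.
    rewrite sum_block_mx; congr block_mx; try by rewrite big1 // => p _; rewrite big1.
    by under eq_bigr => p _ do rewrite sumrN; rewrite sumrN.
  apply: eq_bigr => p _; apply: eq_bigr => q _.
  by rewrite add_block_mx !(addr0, add0r).
elim/big_ind: _ => //; first by move=> A B; apply: graded_partD.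
move=> p _; elim/big_ind: _ => //; first by move=> A B; apply: graded_partD.
move=> q _; apply: graded_partD.
  have [f [fE fn]] := @root_sum_ex n p.+1 q.+1 (ltn_ord p) (ltn_ord q).
  apply: (@graded_part1 _ _ _ f); first by rewrite fn.
  split.
    apply/so_mx_block; rewrite trmx0 oppr0; split=> //.
    by apply/matrixP => i j; rewrite !mxE andbC.
  move=> H; rewrite cartan_comm -/(root_sum n f) fE lin_formD lin_formN !lin_form_eps.
  rewrite scale_block_mx; congr block_mx; apply/matrixP => i j; rewrite !mxE ?mulr0 //.
    have [/andP[/eqP-> /eqP->]|_] := boolP ((i == p) && (j == q)); rewrite /=; ring.
  have [/andP[/eqP-> /eqP->]|_] := boolP ((i == q) && (j == p)); rewrite /=; ring.
have [f [fE fn]] := @root_sum_opp_ex n p.+1 q.+1 n1 (ltn_ord p) (ltn_ord q).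
apply: (@graded_part1 _ _ _ f); first by rewrite fn.
split.
  apply/so_mx_block; rewrite !trmx0 oppr0; split=> //.
  apply/matrixP => i j; rewrite !mxE ![(j == _) && _]andbC; ring.
move=> H; rewrite cartan_comm -/(root_sum n f) fE lin_formN lin_formD !lin_form_eps.
rewrite scale_block_mx; congr block_mx; apply/matrixP => i j; rewrite !mxE ?mulr0 //.
have [/andP[/eqP-> /eqP->]|_] := boolP ((i == p) && (j == q)).
  by ring.
have [/andP[/eqP-> /eqP->]|_] := boolP ((i == q) && (j == p)); rewrite /=; ring.
Qed.

(* Main.v *)
(* A parabolic element acts on Sym(g / p_n), the algebra of polynomials in     *)
(* the entries of a generic skew-symmetric n x n matrix X, only through its    *)
(* GL_n-part a, by X |-> a^T X a.  Let p_k be the Pfaffian of the leading      *)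
(* 2k x 2k block of X.  Upper triangular congruences have a dense orbit on     *)
(* skew-symmetric matrices, so a highest weight vector is determined by its    *)
(* weight up to a scalar; comparing weights gives f p^b = c p^a, and points    *)
(* where exactly one p_k vanishes force b = 0: highest weight vectors are the  *)
(* monomials in the p_k.  The apolar Hermitian product is contravariant for    *)
(* a |-> a^*, which yields complete reducibility and shows that the modules    *)
(* generated by the Pfaffian monomials are irreducible, pairwise orthogonal    *)
(* and spanning.  The fundamental weights are those of the p_k because each    *)
(* p_k is irreducible.                                                         *)

Require Import Defs.
From HB Require Import structures.
From mathcomp Require Import all_boot all_order all_fingroup all_algebra.
From mathcomp Require Import boolp reals complex mpoly ring zify.
From mathcomp.multinomials Require Import ssrcomplements.

Set Implicit Arguments.
Unset Strict Implicit.
Unset Printing Implicit Defensive.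

Import Order.TTheory GRing.Theory Num.Theory.
Local Open Scope ring_scope.

(** The algebra of all symmetric powers of g/p_n is the algebra of polynomial functions on
    skew-symmetric matrices [M] of size n. A parabolic element acts through its GL_n-part [a], by
    [M |-> a^T M a] ([parabolic_ur], [sym_act_rho]). This formula makes sense for every square
    matrix [a], singular ones included, and is polynomial in [a]. Hence the submodules for the
    parabolic group, the submodules for its Levi part and the subspaces stable under all [rho a] are
    the same ([levi_submodule_rho_stable], [rho_stable_submodule]).

    Let p_k be the Pfaffian of the leading block of size 2k, for k from 1 to t. It is fixed by upper
    unitriangular matrices, has degree k and torus weight eps_1 + ... + eps_2k. On the simple
    coroots this is lambda_2k for k < t, while for k = t it is lambda_(n-1) + lambda_n (n odd) or 2
    lambda_n (n even), see [rho_coroot_pf_poly]. Upper triangular matrices have a dense orbit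
    through [std_skew], so a highest weight vector is determined up to a scalar by its weight
    ([unip_inv_unique]), and it is a scalar multiple of a monomial in the p_k
    ([highest_weight_pf_mon]).

    Every nonzero stable subspace contains such a monomial ([rho_stable_pf_mon]). The apolar
    Hermitian product is positive definite and the adjoint of [rho a] is [rho] of the conjugate
    transpose of [a] ([apolar_rho]), so orthogonal complements of stable subspaces are stable. A
    triangular factorization of [a] shows that the modules generated by distinct monomials are
    orthogonal ([cyclic_module_orthogonal]). Consequently each of them is irreducible, and those of
    degree r span the homogeneous part of degree r, because its orthogonal complement of their sum
    contains no Pfaffian monomial ([sum_cyclic_module]).

    An isomorphism of irreducible submodules preserves highest weights, hence lines of highest
    weight vectors, whence multiplicity freeness. A monomial in the p_k is irreducible only if it is
    a single p_k, and each p_k is irreducible ([pf_poly_irreducible]), which gives the fundamental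
    weights and their degrees. *)

(** * Subspaces and polynomial curves in them *)

Definition subspace (F : fieldType) (V : lmodType F) (U : V -> Prop) : Prop :=
  U 0 /\ forall a p q, U p -> U q -> U (a *: p + q).

Section Subspace.
Variables (F : fieldType) (V : lmodType F) (U : V -> Prop).
Hypothesis sU : subspace U.

Lemma subspaceZ a p : U p -> U (a *: p).
Proof. by move=> Up; rewrite -[a *: p]addr0; apply: sU.2 => //; exact: sU.1. Qed.

Lemma subspaceD p q : U p -> U q -> U (p + q).
Proof. by move=> Up Uq; rewrite -[p]scale1r; apply: sU.2. Qed.

Lemma subspaceB p q : U p -> U q -> U (p - q).
Proof. by move=> Up Uq; rewrite addrC -scaleN1r; apply: sU.2. Qed.

Lemma subspace_sum (I : Type) (r : seq I) (P : pred I) (f : I -> V) :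
  (forall i, P i -> U (f i)) -> U (\sum_(i <- r | P i) f i).
Proof.
by move=> Uf; elim/big_ind: _ => //; [exact: sU.1 | exact: subspaceD].
Qed.

End Subspace.

(* Replacing s by 2s and subtracting 2^K times the original curve kills the   *)
(* top coefficient, which gives an induction on the degree.                   *)
Lemma subspace_coef (F : numFieldType) (V : lmodType F) (U : V -> Prop)
    (K : nat) (q : nat -> V) : subspace U ->
  (forall s : F, s != 0 -> U (\sum_(c < K) s ^+ c *: q c)) ->
  forall c, (c < K)%N -> U (q c).
Proof.
move=> sU; elim: K q => [|K IHK] q Uq c //.
have low c' : (c' < K)%N -> U (q c').
  move=> c'K; have e0 : 2%:R ^+ c' - 2%:R ^+ K != 0 :> F.
    by rewrite subr_eq0 -!natrX eqr_nat eqn_exp2l // ltn_eqF.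
  rewrite -[q c']scale1r -(mulVf e0) -scalerA; apply: (subspaceZ sU).
  apply: (IHK (fun c => (2%:R ^+ c - 2%:R ^+ K) *: q c)) => // s s0.
  have -> : \sum_(c < K) s ^+ c *: ((2%:R ^+ c - 2%:R ^+ K) *: q c)
     = \sum_(c < K.+1) (2%:R * s) ^+ c *: q c
       - 2%:R ^+ K *: \sum_(c < K.+1) s ^+ c *: q c.
    rewrite scaler_sumr -sumrB big_ord_recr /= scalerA -exprMn subrr addr0.
    apply: eq_bigr => i _; rewrite !scalerA -scalerBl exprMn; congr (_ *: _).
    by rewrite mulrBr mulrC [X in _ - X = _]mulrC.
  apply: (subspaceB sU); last by apply: (subspaceZ sU); apply: Uq.
  by apply: Uq; rewrite mulf_neq0 // pnatr_eq0.
rewrite ltnS leq_eqVlt => /predU1P[->|]; last exact: low.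
have := Uq 1 (oner_neq0 F); rewrite big_ord_recr /= expr1n scale1r => UK.
rewrite -[q K](addKr (\sum_(i < K) 1 ^+ i *: q i)) addrC; apply: (subspaceB sU) => //.
by apply: (subspace_sum sU) => i _; apply: (subspaceZ sU); apply: low.
Qed.

(** The coefficients of the curve already lie in [U], hence so does its value at 0. This plays the
    part of Zariski closedness in all density arguments below. *)
Lemma subspace_poly_horner (F : numFieldType) (A : comAlgType F) (U : A -> Prop)
    (Q : {poly A}) : subspace U ->
  (forall s : F, s != 0 -> U Q.[s%:A]) -> forall s : F, U Q.[s%:A].
Proof.
have E (s : F) : Q.[s%:A] = \sum_(c < size Q) s ^+ c *: Q`_c.
  by rewrite horner_coef; apply: eq_bigr => i _; rewrite exprZn expr1n -scalerAr mulr1.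
move=> sU UQ s; rewrite E; apply: (subspace_sum sU) => i _; apply: (subspaceZ sU).
apply: (subspace_coef (K := size Q) sU) => // s' s0; rewrite -E; exact: UQ.
Qed.

Lemma poly_alg_eq0 (F : numFieldType) (A : comAlgType F) (Q : {poly A}) :
  (forall s : F, s != 0 -> Q.[s%:A] = 0) -> Q = 0.
Proof.
move=> Q0; have s0 : subspace (fun x : A => x = 0).
  by split=> // a p q -> ->; rewrite scaler0 addr0.
apply/polyP => i; rewrite coef0; case: (ltnP i (size Q)) => [iQ|]; last exact: nth_default.
apply: (subspace_coef (K := size Q) (q := fun c => Q`_c) s0 _ iQ) => s sn0.
rewrite -[RHS](Q0 s sn0) horner_coef; apply: eq_bigr => c _.
by rewrite exprZn expr1n -scalerAr mulr1.
Qed.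

Lemma poly_eq0 (F : numFieldType) (Q : {poly F}) :
  (forall s : F, s != 0 -> Q.[s] = 0) -> Q = 0.
Proof.
move=> Q0; apply: (@poly_alg_eq0 F F^o) => s /Q0 Qs.
by rewrite -[RHS]Qs; congr (_.[_]); apply: mulr1.
Qed.

(** * Linear substitutions in polynomials *)

Section LinearSubstitution.
Variables (F : numFieldType) (N : nat).
Implicit Types (p q : {mpoly F[N]}) (A B : 'M[F]_N).

Definition lin_subst B p : {mpoly F[N]} :=
  p \mPo [tuple \sum_j B i j *: 'X_j | i < N].

HB.instance Definition _ B := GRing.RMorphism.copy (lin_subst B) (lin_subst B).
HB.instance Definition _ B := GRing.Linear.copy (lin_subst B) (lin_subst B).

Lemma lin_substX B i : lin_subst B 'X_i = \sum_j B i j *: 'X_j.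
Proof. by rewrite /lin_subst comp_mpolyXU -tnth_nth tnth_mktuple. Qed.

Lemma meval_lin_subst B p v :
  (lin_subst B p).@[v] = p.@[fun i => \sum_j B i j * v j].
Proof.
rewrite /lin_subst comp_mpoly_meval; apply: meval_eq => i; rewrite tnth_mktuple.
by rewrite raddf_sum /=; apply: eq_bigr => j _; rewrite mevalZ mevalXU.
Qed.

Lemma mpoly_ind_alg (P : {mpoly F[N]} -> Prop) :
  (forall c, P c%:MP) -> (forall i, P 'X_i) ->
  (forall p q, P p -> P q -> P (p + q)) -> (forall p q, P p -> P q -> P (p * q)) ->
  forall p, P p.
Proof.
move=> PC PX PD PM p; elim/mpolyind: p => [|c m p _ _ Pp]; first by rewrite -mpolyC0.
apply: (PD) => //; rewrite -mul_mpolyC; apply: (PM) => //.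
rewrite mpolyXE_id; elim/big_ind: _ => //; first by rewrite -mpolyC1.
by move=> i _; elim: (m i) => [|k IH]; rewrite ?expr0 ?exprS -?mpolyC1 //; apply: PM.
Qed.

(** Substitution reverses the order of products; [compound_mul] reverses it once more, so that [rho]
    is a left action. *)
Lemma lin_subst_comp A B p : lin_subst A (lin_subst B p) = lin_subst (B *m A) p.
Proof.
elim/mpoly_ind_alg: p => [c|i|p q IHp IHq|p q IHp IHq].
- by rewrite /lin_subst !comp_mpolyC.
- rewrite !lin_substX linear_sum /=.
  under eq_bigr => j _ do rewrite linearZ /= lin_substX scaler_sumr.
  rewrite exchange_big /=; apply: eq_bigr => k _; rewrite mxE scaler_suml.
  by apply: eq_bigr => j _; rewrite scalerA.
- by rewrite !rmorphD /= IHp IHq.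
- by rewrite !rmorphM /= IHp IHq.
Qed.

Lemma lin_subst1 p : lin_subst 1%:M p = p.
Proof.
elim/mpoly_ind_alg: p => [c|i|p q IHp IHq|p q IHp IHq].
- by rewrite /lin_subst !comp_mpolyC.
- rewrite lin_substX (bigD1 i) //= mxE eqxx scale1r big1 ?addr0 // => j /negbTE ji.
  by rewrite mxE eq_sym ji scale0r.
- by rewrite rmorphD /= IHp IHq.
- by rewrite rmorphM /= IHp IHq.
Qed.

Lemma lin_substC B c : lin_subst B c%:MP = c%:MP.
Proof. exact: comp_mpolyC. Qed.

Lemma lin_subst_homog B d p : p \is d.-homog -> lin_subst B p \is d.-homog.
Proof.
move=> /dhomogP hp; rewrite [p]mpolyE linear_sum big_seq /=.
apply: rpred_sum => m mp; rewrite linearZ /=; apply: dhomogZ.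
have <- : mdeg m = d := hp m mp.
rewrite /lin_subst comp_mpolyX mdegE.
elim/big_rec2: _ => [|i y1 y2 _ hy]; first exact: dhomog1.
apply: dhomogM => //; rewrite -[X in X.-homog]mul1n; apply: dhomogMn.
rewrite tnth_mktuple; apply: rpred_sum => j _; apply: dhomogZ.
by rewrite dhomogX /= mdeg1.
Qed.

Lemma lin_subst_curve (B : F -> 'M[F]_N) (q : 'M[{poly F}]_N) p :
    (forall s i j, B s i j = (q i j).[s]) ->
  exists Q : {poly {mpoly F[N]}}, forall s, lin_subst (B s) p = Q.[s%:A].
Proof.
move=> Bq; elim/mpoly_ind_alg: p => [c|i|p p' [Q HQ] [Q' HQ']|p p' [Q HQ] [Q' HQ']].
- by exists (c%:MP)%:P => s; rewrite hornerC lin_substC.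
- exists (\sum_j (map_poly (@mpolyC N F) (q i j)) * ('X_j)%:P) => s.
  rewrite lin_substX horner_sum; apply: eq_bigr => j _; rewrite hornerM hornerC.
  by rewrite -mul_mpolyC Bq alg_mpolyC horner_map.
- by exists (Q + Q') => s; rewrite rmorphD /= HQ HQ' hornerD.
- by exists (Q * Q') => s; rewrite rmorphM /= HQ HQ' hornerM.
Qed.

Lemma meval_curve (v : F -> 'I_N -> F) (q : 'I_N -> {poly F}) p :
    (forall s i, v s i = (q i).[s]) ->
  exists Q : {poly F}, forall s, p.@[v s] = Q.[s].
Proof.
move=> vq; elim/mpoly_ind_alg: p => [c|i|p p' [Q HQ] [Q' HQ']|p p' [Q HQ] [Q' HQ']].
- by exists c%:P => s; rewrite hornerC mevalC.
- by exists (q i) => s; rewrite mevalXU.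
- by exists (Q + Q') => s; rewrite mevalD HQ HQ' hornerD.
- by exists (Q * Q') => s; rewrite mevalM HQ HQ' hornerM.
Qed.

Lemma mderiv_lin_subst B i p :
  (lin_subst B p)^`M(i) = \sum_j B j i *: lin_subst B p^`M(j).
Proof.
elim/mpoly_ind_alg: p => [c|k|p q IHp IHq|p q IHp IHq].
- rewrite lin_substC mderivC big1 // => j _.
  by rewrite mderivC linear0 scaler0.
- have dX (a b : 'I_N) : ('X_a : {mpoly F[N]})^`M(b) = (a == b)%:R%:MP.
    rewrite mderivX mnm1E; case: eqP => [->|_]; last by rewrite scale0r mpolyC0.
    have -> : (U_(b) - U_(b))%MM = 0%MM by apply/mnmP => k'; rewrite mnmBE subnn mnm0E.
    by rewrite mpolyX0 scale1r mpolyC1.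
  rewrite lin_substX linear_sum /= (bigD1 i) //= big1 => [|j /negbTE ji].
    rewrite (bigD1 k) //= [in RHS]big1 => [|j /negbTE jk].
      by rewrite mderivZ !dX !eqxx lin_substC !addr0.
    by rewrite dX eq_sym jk mpolyC0 linear0 scaler0.
  by rewrite mderivZ dX ji mpolyC0 scaler0.
- rewrite rmorphD /= mderivD IHp IHq -big_split /=; apply: eq_bigr => j _.
  by rewrite mderivD rmorphD /= scalerDr.
- rewrite rmorphM /= mderivM IHp IHq mulr_suml mulr_sumr -big_split /=.
  apply: eq_bigr => j _; rewrite mderivM rmorphD !rmorphM /= scalerDr.
  by rewrite scalerAl scalerAr.
Qed.

End LinearSubstitution.

Lemma mpoly_ind_mulX (F : numFieldType) (N : nat) (P : {mpoly F[N]} -> Prop) :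
  subspace P -> P 1 -> (forall i p, P p -> P ('X_i * p)) -> forall p, P p.
Proof.
move=> sP P1 PX p; rewrite [p]mpolyE; apply: (subspace_sum sP) => m _.
apply: (subspaceZ sP); rewrite mpolyXE_id; elim/big_rec: _ => // i q _ Pq.
by elim: (m i) => [|k IHk]; rewrite ?expr0 ?mul1r // exprS -mulrA; apply: PX.
Qed.

(** * The apolar Hermitian product and orthogonal projection *)

Section ApolarProduct.
Variables (F : numClosedFieldType) (N : nat).
Implicit Types (p q : {mpoly F[N]}) (m : 'X_{1..N}).

(** This is the Fischer product: monomials are orthogonal and the monomial with exponent [m] has
    square norm m!. With these norms, multiplication by a variable is adjoint to the partial
    derivative. *)
Definition apolar p q : F :=
  \sum_(m <- msupp p) (\prod_i (m i)`!)%N%:R * p@_m * (q@_m)^*.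

Lemma apolarwE k p q : (msize p <= k)%N ->
  apolar p q = \sum_(m : 'X_{1..N < k}) (\prod_i (m i)`!)%N%:R * p@_m * (q@_m)^*.
Proof.
move=> pk; rewrite /apolar (big_mksub 'X_{1..N < k}) /= ?msupp_uniq //; last first.
  by move=> m /msize_mdeg_lt /leq_trans /(_ pk).
by apply: big_rmcond => m /memN_msupp_eq0 ->; rewrite mulr0 mul0r.
Qed.

Lemma apolarC p q : apolar p q = (apolar q p)^*.
Proof.
pose k := maxn (msize p) (msize q).
rewrite (apolarwE (k := k)) ?leq_maxl // (apolarwE (p := q) (k := k)) ?leq_maxr //.
rewrite rmorph_sum /=; apply: eq_bigr => m _.
by rewrite !rmorphM /= conjCK conjC_nat -!mulrA [p@_m * _]mulrC.
Qed.

Lemma apolarPl q a p p' : apolar (a *: p + p') q = a * apolar p q + apolar p' q.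
Proof.
pose k := maxn (msize (a *: p + p')) (maxn (msize p) (msize p')).
rewrite !(@apolarwE k) ?leq_max ?leqnn ?orbT //.
rewrite mulr_sumr -big_split; apply: eq_bigr => m _ /=.
by rewrite mcoeffD mcoeffZ; ring.
Qed.

Lemma apolar0l q : apolar 0 q = 0.
Proof. by rewrite /apolar msupp0 big_nil. Qed.

Lemma apolarDl q p p' : apolar (p + p') q = apolar p q + apolar p' q.
Proof. by rewrite -[p in LHS]scale1r apolarPl mul1r. Qed.

Lemma apolarZl q a p : apolar (a *: p) q = a * apolar p q.
Proof. by rewrite -[a *: p]addr0 apolarPl apolar0l addr0. Qed.

Lemma apolarBl q p p' : apolar (p - p') q = apolar p q - apolar p' q.
Proof. by rewrite apolarDl -scaleN1r apolarZl mulN1r. Qed.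

Lemma apolar_suml (I : Type) (r : seq I) (P : pred I) (f : I -> {mpoly F[N]}) q :
  apolar (\sum_(i <- r | P i) f i) q = \sum_(i <- r | P i) apolar (f i) q.
Proof. exact: (big_morph (apolar^~ q) (apolarDl q) (apolar0l q)). Qed.

Lemma apolar0r p : apolar p 0 = 0.
Proof. by rewrite apolarC apolar0l conjC0. Qed.

Lemma apolarDr p q q' : apolar p (q + q') = apolar p q + apolar p q'.
Proof. by rewrite apolarC apolarDl rmorphD /= -!apolarC. Qed.

Lemma apolarZr p a q : apolar p (a *: q) = a^* * apolar p q.
Proof. by rewrite apolarC apolarZl rmorphM /= -apolarC. Qed.

Lemma apolar_sumr (I : Type) (r : seq I) (P : pred I) (f : I -> {mpoly F[N]}) p :
  apolar p (\sum_(i <- r | P i) f i) = \sum_(i <- r | P i) apolar p (f i).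
Proof. exact: (big_morph (apolar p) (apolarDr p) (apolar0r p)). Qed.

Lemma apolar_eq0 p : apolar p p = 0 -> p = 0.
Proof.
rewrite /apolar => /eqP; rewrite psumr_eq0 => [/allP p0|m _]; last first.
  by rewrite -mulrA mulr_ge0 ?ler0n ?mul_conjC_ge0.
apply/mpolyP => m; rewrite mcoeff0; have [mp|/memN_msupp_eq0 //] := boolP (m \in msupp p).
have := p0 m mp; rewrite /= -mulrA !mulf_eq0 conjC_eq0 orbb pnatr_eq0.
case/orP => [/eqP m0|/eqP //].
suff: (0 < \prod_i (m i)`!)%N by rewrite m0.
by apply: prodn_gt0 => i; apply: fact_gt0.
Qed.

Lemma apolarXl m q : apolar 'X_[m] q = (\prod_i (m i)`!)%N%:R * (q@_m)^*.
Proof. by rewrite /apolar msuppX big_seq1 mcoeffX eqxx mulr1. Qed.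

Lemma apolar_subspacel q : subspace (fun p => apolar p q = 0).
Proof.
by split=> [|a p p' hp hp']; rewrite ?apolar0l // apolarPl hp hp' mulr0 addr0.
Qed.

(** On monomials this is the identity (m + U_i)! = (m_i + 1) m!, whose extra factor is the one
    produced by differentiation. *)
Lemma apolar_mulX i p q : apolar ('X_i * p) q = apolar p q^`M(i).
Proof.
rewrite [p]mpolyE mulr_sumr !apolar_suml; apply: eq_bigr => m _.
rewrite -scalerAr !apolarZl -mpolyXD !apolarXl mcoeff_deriv addmC rmorphMn /=.
rewrite mulrnAr -mulrnAl -mulrnA; congr (_ * (_%:R * _)).
rewrite (bigD1 i) //= [in RHS](bigD1 i) //= mnmDE mnm1E eqxx addn1 factS.
rewrite -[X in X = _]mulnA [LHS]mulnC; congr (_ * _ * _)%N.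
by apply: eq_bigr => j /negbTE ji; rewrite mnmDE mnm1E eq_sym ji addn0.
Qed.

(* The variables act by operators adjoint to the partial derivatives, so this *)
(* reduces to the chain rule by induction on p.                               *)
Lemma apolar_lin_subst (B : 'M[F]_N) p q :
  apolar (lin_subst B p) q = apolar p (lin_subst (map_mx Num.conj B^T) q).
Proof.
move: p q; apply: mpoly_ind_mulX => [|q|i p IHp q].
- split=> [q|a p p' hp hp' q]; first by rewrite linear0 !apolar0l.
  by rewrite linearP /= !apolarPl hp hp'.
- rewrite rmorph1 -mpolyX0 !apolarXl; congr (_ * _^*).
  elim/mpoly_ind_alg: q => [c|j|q q' h h'|q q' h h'].
  + by rewrite lin_substC.
  + rewrite lin_substX raddf_sum /= big1 => [|k _]; first by rewrite mcoeffX mnm1_eq0.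
    by rewrite mcoeffZ mcoeffX mnm1_eq0 mulr0.
  + by rewrite rmorphD /= h h' [lin_subst _ (_ + _)]rmorphD /= mcoeffD.
  + by rewrite rmorphM /= h h' [lin_subst _ (_ * _)]rmorphM /= rmorphM.
- rewrite rmorphM /= lin_substX mulr_suml apolar_suml apolar_mulX.
  rewrite mderiv_lin_subst apolar_sumr; apply: eq_bigr => j _.
  by rewrite -scalerAl apolarZl apolar_mulX IHp apolarZr !mxE conjCK.
Qed.

Definition orthogonal_to (U : {mpoly F[N]} -> Prop) p : Prop :=
  forall v, U v -> apolar p v = 0.

(** Gram-Schmidt along a list of monomials: allowing one more monomial [m] in the support enlarges
    the available part of [U] by at most one dimension, so no basis of [U] has to be chosen. *)
Lemma orthogonal_proj_supp (U : {mpoly F[N]} -> Prop) (ms : seq 'X_{1..N}) :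
  subspace U -> forall p, exists u,
    [/\ U u, {subset msupp u <= ms} &
      orthogonal_to (fun v => U v /\ {subset msupp v <= ms}) (p - u)].
Proof.
move=> sU; elim: ms => [|m ms IH] p.
  exists 0; split; first exact: sU.1; first by move=> m; rewrite msupp0.
  move=> v [_ v0]; have -> : v = 0; last by rewrite apolar0r.
  apply/msuppnil0; case: (msupp v) v0 => // m s /(_ m); rewrite mem_head.
  by move/(_ isT).
have drop (v : {mpoly F[N]}) : {subset msupp v <= m :: ms} -> v@_m = 0 ->
    {subset msupp v <= ms}.
  move=> sv vm m' m'v; have := sv m' m'v; rewrite inE => /predU1P[E|//].
  by move: m'v; rewrite mcoeff_msupp E vm eqxx.
case: (EM (exists q, [/\ U q, {subset msupp q <= m :: ms} & q@_m != 0])); last first.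
  move=> noq; have [u [Uu su ou]] := IH p; exists u; split=> //.
    by move=> m' /su; rewrite inE orbC => ->.
  move=> v [Uv sv]; apply: ou; split=> //; apply: drop => //.
  by apply/eqP/negPn/negP => vm; apply: noq; exists v.
case=> q [Uq sq qm]; have [mms|mms] := boolP (m \in ms).
  have E v : {subset msupp v <= m :: ms} -> {subset msupp v <= ms}.
    by move=> sv m' /sv; rewrite inE => /predU1P[->|].
  have [u [Uu su ou]] := IH p; exists u; split=> //.
    by move=> m' /su; rewrite inE orbC => ->.
  by move=> v [Uv sv]; apply: ou; split=> //; apply: E.
(* [q'] is the new Gram-Schmidt vector: it is orthogonal to the part of [U] supported in [ms], and
   its coefficient at [m] is still nonzero. *)
have [r [Ur sr or]] := IH q; pose q' := q - r.
have Uq' : U q' by exact: subspaceB.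
have q'm : q'@_m = q@_m.
  by rewrite mcoeffB (memN_msupp_eq0 (contraNN (@sr m) mms)) subr0.
have sub_r : {subset ms <= m :: ms} by move=> m' h; rewrite inE h orbT.
have sq' : {subset msupp q' <= m :: ms}.
  by move=> m' /msuppB_le; rewrite mem_cat => /orP[/sq //|/sr /sub_r].
have q'0 : apolar q' q' != 0.
  by apply/eqP => /apolar_eq0 E; move: qm; rewrite -q'm E mcoeff0 eqxx.
have [u0 [Uu0 su0 ou0]] := IH p.
pose c := apolar p q' / apolar q' q'.
exists (u0 + c *: q'); split.
- by apply: (subspaceD sU) => //; apply: (subspaceZ sU).
- move=> m' /msuppD_le; rewrite mem_cat => /orP[/su0 /sub_r //|/msuppZ_le /sq' //].
move=> v [Uv sv]; pose d := v@_m / q'@_m.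
have -> : v = (v - d *: q') + d *: q' by rewrite subrK.
have Uv0 : U (v - d *: q') by apply: (subspaceB sU) => //; apply: (subspaceZ sU).
have sv0 : {subset msupp (v - d *: q') <= ms}.
  apply: drop; last by rewrite mcoeffB mcoeffZ /d q'm divfK ?subrr.
  by move=> m' /msuppB_le; rewrite mem_cat => /orP[/sv //|/msuppZ_le /sq'].
have u0q' : apolar u0 q' = 0 by rewrite apolarC or ?conjC0.
rewrite opprD addrA apolarDr apolarZr apolarBl ou0 // apolarZl or // mulr0 subr0 add0r.
by rewrite !apolarBl u0q' apolarZl /c divfK // subr0 subrr mulr0.
Qed.

(** Homogeneity confines all supports in [U] to the finite list of monomials of degree at most
    [d]. *)
Lemma orthogonal_proj (U : {mpoly F[N]} -> Prop) (d : nat) :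
    subspace U -> (forall p, U p -> p \is d.-homog) ->
  forall p, exists u, U u /\ orthogonal_to U (p - u).
Proof.
move=> sU hU p; pose ms := [seq val m | m : 'X_{1..N < d.+1}].
have sub v : U v -> {subset msupp v <= ms}.
  move=> /hU /dhomogP hv m /hv /= dm.
  have md : (mdeg m < d.+1)%N by rewrite dm.
  by apply/mapP; exists (BMultinom md); rewrite ?mem_enum.
have [u [Uu _ ou]] := orthogonal_proj_supp ms sU p.
by exists u; split=> // v Uv; apply: ou; split=> //; apply: sub.
Qed.

End ApolarProduct.

(** * Elementary matrices and density of triangular factorizations *)

Definition elem_mx (F : fieldType) (n : nat) (i j : 'I_n) (z : F) : 'M[F]_n :=
  1%:M + z *: delta_mx i j.

Lemma tr_elem_mx (F : fieldType) (n : nat) (i j : 'I_n) (z : F) :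
  (elem_mx i j z)^T = elem_mx j i z.
Proof. by rewrite /elem_mx linearD linearZ /= trmx1 trmx_delta. Qed.

(** A unipotent matrix that differs from the identity only in row [k], right of the diagonal, is a
    product of elementary matrices. A whole step of Gauss elimination is thus reduced to single
    elementary factors. *)
Lemma elem_mx_ind (F : fieldType) (n : nat) (P : 'M[F]_n -> Prop) (k : 'I_n)
    (r : 'rV[F]_n) :
    (forall j : 'I_n, (j <= k)%N -> r 0 j = 0) -> P 1%:M ->
    (forall A (j : 'I_n) z, (k < j)%N -> P A -> P (A *m elem_mx k j z)) ->
  P (1%:M + (delta_mx k 0 : 'cV[F]_n) *m r).
Proof.
move=> r0 P1 PM.
have -> : r = \sum_(j < n | (k < j)%N) r 0 j *: delta_mx 0 j.
  rewrite {1}[r]row_sum_delta (bigID (fun j : 'I_n => (k < j)%N)) /=.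
  by rewrite [X in _ + X]big1 ?addr0 // => j; rewrite -leqNgt => /r0 ->; rewrite scale0r.
(* Recording that entry [k] of the partial row is zero kills the cross term when the next elementary
   factor is multiplied in. *)
pose K (x : 'rV[F]_n) := x 0 k = 0 /\ P (1%:M + (delta_mx k 0 : 'cV[F]_n) *m x).
suff: K (\sum_(j < n | (k < j)%N) r 0 j *: delta_mx 0 j) by case.
elim/big_rec: _ => [|j x kj [x0 Px]]; first by split; rewrite ?mxE // mulmx0 addr0.
split.
  by rewrite !mxE x0 addr0 eqxx /= -val_eqE /= ltn_eqF ?mulr0.
have -> : 1%:M + (delta_mx k 0 : 'cV[F]_n) *m (r 0 j *: delta_mx 0 j + x)
   = (1%:M + (delta_mx k 0 : 'cV[F]_n) *m x) *m elem_mx k j (r 0 j).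
  rewrite /elem_mx mulmxDr mulmx1 mulmxDl mul1mx -scalemxAr -mulmxA.
  have -> : x *m delta_mx k j = 0.
    apply/rowP => b; rewrite !mxE big1 // => l _; rewrite mxE.
    by case: eqP => [->|_]; rewrite ?x0 ?mul0r // mulr0.
  rewrite mulmx0 scaler0 addr0 mulmxDr -scalemxAr mul_delta_mx.
  by rewrite -addrA [_ *: _ + _]addrC.
exact: PM.
Qed.

Section DensityInduction.
Variables (F : numFieldType) (n : nat).
Implicit Types (g M : 'M[F]_n).

Lemma mul_row_unip g (k : 'I_n) (r : 'rV[F]_n) i j :
  (g *m (1%:M + (delta_mx k 0 : 'cV[F]_n) *m r)) i j = g i j + g i k * r 0 j.
Proof.
rewrite mulmxDr mulmx1 mulmxA -colE mxE; congr (_ + _).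
by rewrite mxE big_ord1 mxE.
Qed.

Lemma mul_col_unip g (k : 'I_n) (r : 'rV[F]_n) i j :
  ((1%:M + (delta_mx k 0 : 'cV[F]_n) *m r)^T *m g) i j = g i j + r 0 i * g k j.
Proof.
by rewrite -[g in LHS]trmxK -trmx_mul mxE mul_row_unip !mxE mulrC.
Qed.

(* A generic matrix is the product of a lower unitriangular, a diagonal and   *)
(* an upper unitriangular matrix; vanishing pivots are avoided by perturbing  *)
(* a diagonal entry.                                                          *)
Lemma mx_density_ind (P : 'M[F]_n -> Prop) :
    (forall g (i j : 'I_n) z, (i < j)%N -> P (g *m elem_mx i j z) -> P g) ->
    (forall g (i j : 'I_n) z, (i < j)%N -> P (elem_mx j i z *m g) -> P g) ->
    (forall g (k : 'I_n), (forall s : F, s != 0 -> P (g + s *: delta_mx k k)) -> P g) ->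
    (forall d : 'rV[F]_n, (forall i, d 0 i != 0) -> P (diag_mx d)) ->
  forall g, P g.
Proof.
move=> Pup Plow Pdens Pdiag.
have Prow (k : 'I_n) (r : 'rV[F]_n) g : (forall j : 'I_n, (j <= k)%N -> r 0 j = 0) ->
    P (g *m (1%:M + (delta_mx k 0 : 'cV[F]_n) *m r)) -> P g.
  move=> r0; move: g.
  apply: (@elem_mx_ind _ _ (fun A => forall g, P (g *m A) -> P g) k r) => //.
    by move=> g; rewrite mulmx1.
  by move=> A j z kj PA g; rewrite mulmxA => /(Pup _ _ _ _ kj); exact: PA.
have Pcol (k : 'I_n) (r : 'rV[F]_n) g : (forall j : 'I_n, (j <= k)%N -> r 0 j = 0) ->
    P ((1%:M + (delta_mx k 0 : 'cV[F]_n) *m r)^T *m g) -> P g.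
  move=> r0; move: g.
  apply: (@elem_mx_ind _ _ (fun A => forall g, P (A^T *m g) -> P g) k r) => //.
    by move=> g; rewrite trmx1 mul1mx.
  move=> A j z kj PA g; rewrite trmx_mul tr_elem_mx -mulmxA => /(Plow _ _ _ _ kj).
  exact: PA.
(* At stage [k] the first [k] rows and columns are those of a diagonal matrix with nonzero diagonal
   entries. *)
pose stage k (g : 'M[F]_n) := forall i j : 'I_n, (minn i j < k)%N ->
  if i == j then g i j != 0 else g i j == 0.
suff H m k g : (k + m = n)%N -> stage k g -> P g.
  by move=> g; apply: (H n 0%N) => // i j.
elim: m k g => [|m IHm] k g km Sg.
  have -> : g = diag_mx (\row_i g i i).
    apply/matrixP => i j; have := Sg i j; rewrite !mxE eq_sym.
    have -> : (minn i j < k)%N by have := ltn_ord i; lia.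
    by case: eqP => [->|_] // /(_ isT)/eqP.
  apply: Pdiag => i; rewrite mxE; have := Sg i i; rewrite eqxx; apply.
  by have := ltn_ord i; lia.
have kn : (k < n)%N by lia.
pose o := Ordinal kn.
suff {g Sg} H g : stage k g -> g o o != 0 -> P g.
  have [g0|] := eqVneq (g o o) 0; last exact: H.
  apply: (Pdens _ o) => s s0; apply: H; last by rewrite !mxE g0 !eqxx mulr1 add0r.
  move=> i j ij; have := Sg i j ij; rewrite !mxE.
  have -> : (i == o) && (j == o) = false; last by rewrite mulr0 addr0.
  by apply/negP => /andP[/eqP iE /eqP jE]; move: ij; rewrite iE jE /=; lia.
move=> Sg g0.
pose r : 'rV[F]_n := \row_j (if (k < j)%N then - g o j / g o o else 0).
pose c : 'rV[F]_n := \row_j (if (k < j)%N then - g j o / g o o else 0).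
have r0 (j : 'I_n) : (j <= o)%N -> r 0 j = 0 by rewrite /= mxE leqNgt; case: ltnP.
have c0 (j : 'I_n) : (j <= o)%N -> c 0 j = 0 by rewrite /= mxE leqNgt; case: ltnP.
apply: (Prow o r) => //; apply: (Pcol o c) => //; apply: (IHm k.+1); first by lia.
have low (a b : 'I_n) : (minn a b < k)%N -> a != b -> g a b = 0.
  by move=> ab ne; have := Sg a b ab; rewrite (negbTE ne) => /eqP.
have roj (j : 'I_n) : g o j + g o o * r 0 j = if o == j then g o o else 0.
  rewrite mxE; case: ltngtP => kj.
  - rewrite mulrC divfK // addrN; case: eqP => // oj; move: kj; rewrite -oj /=; lia.
  - rewrite mulr0 addr0 low //; last by apply/eqP => oj; move: kj; rewrite -oj /=; lia.
      by case: eqP => // oj; move: kj; rewrite -oj /=; lia.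
    by rewrite /=; lia.
  - have <- : o = j by apply: val_inj.
    by rewrite eqxx mulr0 addr0.
move=> i j ij; rewrite mul_col_unip !mul_row_unip.
rewrite roj; have [io|io] := eqVneq i o.
  by rewrite io roj c0 //= mul0r addr0; case: (o == j).
have [jo|jo] := eqVneq j o.
  rewrite jo (negbTE io) r0 // mulr0 addr0 mxE; case: ltnP => ik.
    by rewrite divfK // addrN.
  rewrite mul0r addr0 low //=; suff: nat_of_ord i != k by lia.
  by apply: contraNneq io => iE; apply/eqP/val_inj.
rewrite mulr0 addr0.
have ij' : (minn i j < k)%N.
  have ik : nat_of_ord i != k by apply: contraNneq io => iE; apply/eqP/val_inj.
  have jk : nat_of_ord j != k by apply: contraNneq jo => jE; apply/eqP/val_inj.
  by move: ij ik jk => /=; lia.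
have -> : g i o * r 0 j = 0; last by rewrite addr0; apply: Sg.
have [jk|kj] := leqP j o; first by rewrite r0 // mulr0.
rewrite low ?mul0r //=; move: ij' kj => /=; lia.
Qed.

Definition skew_mx M : Prop := M^T = - M.

(** Blocks with entries 0, 1, -1, 0 along the diagonal, pairing the indices 2i and 2i+1 counted from
    0; for odd [n] the last row and column are zero. This is the base point of the dense orbit. *)
Definition std_skew : 'M[F]_n :=
  \matrix_(i, j) (((i.+1 == j) && ~~ odd i)%:R - ((j.+1 == i) && ~~ odd j)%:R).

Lemma skew_mxE M i j : skew_mx M -> M i j = - M j i.
Proof. by move=> /matrixP /(_ j i); rewrite !mxE. Qed.

Lemma skew_mx_diag M i : skew_mx M -> M i i = 0.
Proof.
by move=> sM; apply/eqP; rewrite -[_ == 0](mulrn_eq0 _ 2) mulr2n {1}(skew_mxE _ _ sM) addNr.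
Qed.

Lemma skew_mx_congr (A : 'M[F]_n) M : skew_mx M -> skew_mx (A^T *m M *m A).
Proof. by rewrite /skew_mx => sM; rewrite !trmx_mul trmxK sM mulNmx mulmxN mulmxA. Qed.

(* A generic skew-symmetric matrix is congruent, under the upper unitriangular *)
(* group, to a sum of 2 x 2 blocks along the diagonal.                         *)
Lemma skew_density_ind (P : 'M[F]_n -> Prop) :
    (forall M (i j : 'I_n) z, skew_mx M -> (i < j)%N ->
       P ((elem_mx i j z)^T *m M *m elem_mx i j z) -> P M) ->
    (forall M (i j : 'I_n), skew_mx M -> i.+1 = j :> nat ->
       (forall s : F, s != 0 -> P (M + s *: (delta_mx i j - delta_mx j i))) -> P M) ->
    (forall d : 'rV[F]_n, (forall i, d 0 i != 0) ->
       P (diag_mx d *m std_skew *m diag_mx d)) ->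
  forall M, skew_mx M -> P M.
Proof.
move=> Pup Pdens Pdiag.
have Prow (k : 'I_n) (r : 'rV[F]_n) M : (forall j : 'I_n, (j <= k)%N -> r 0 j = 0) ->
    skew_mx M ->
    P ((1%:M + (delta_mx k 0 : 'cV[F]_n) *m r)^T *m M
        *m (1%:M + (delta_mx k 0 : 'cV[F]_n) *m r)) -> P M.
  move=> r0; move: M.
  apply: (@elem_mx_ind _ _ (fun A => forall M, skew_mx M -> P (A^T *m M *m A) -> P M) k r) => //.
    by move=> M _; rewrite trmx1 mul1mx mulmx1.
  move=> A j z kj PA M sM; rewrite trmx_mul => PM; apply: PA => //.
  apply: (Pup _ _ _ z _ kj); first exact: skew_mx_congr.
  by move: PM; rewrite !mulmxA.
(* At stage [k] the first [k] diagonal 2 x 2 blocks are split off and nondegenerate. *)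
pose stage k (M : 'M[F]_n) := skew_mx M /\ forall i j : 'I_n, (i < k.*2)%N ->
  (i./2 != j./2 -> M i j = 0) /\ (i./2 == j./2 -> i != j -> M i j != 0).
suff H m k M : (k + m = n./2)%N -> stage k M -> P M.
  by move=> M sM; apply: (H n./2 0%N) => //; split=> // i j; rewrite ltn0.
elim: m k M => [|m IHm] k M km [sM Sg].
  (* Each block is scaled through its even index alone, by its upper right entry. An unpaired last
     index has no successor and receives the default 1, which keeps all entries of [d] nonzero. *)
  pose d : 'rV[F]_n := \row_i (if odd i then 1 else
    if insub i.+1 is Some j then M i j else 1).
  have -> : M = diag_mx d *m std_skew *m diag_mx d.
    apply/matrixP => i j; rewrite mul_diag_mx mul_mx_diag !mxE.
    wlog ij : i j / (i <= j)%N.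
      move=> W; case: (leqP i j) => ij; first exact: W.
      rewrite (skew_mxE _ _ sM) W; last by lia.
      by ring.
    have -> : ((j.+1 == i) && ~~ odd j) = false by lia.
    have [E|E] := boolP ((i.+1 == j) && ~~ odd i).
      case/andP: E => /eqP E oi; rewrite (negbTE oi).
      have -> : odd j by lia.
      case: insubP => [u _ uE|]; last by rewrite E ltn_ord.
      have -> : u = j by apply: val_inj; rewrite uE.
      by rewrite subr0 !mulr1.
    rewrite subr0 mulr0 mul0r.
    have [->|ne] := eqVneq i j; first exact: skew_mx_diag.
    have ne' : nat_of_ord i != nat_of_ord j by [].
    by apply: (Sg i j _).1; have := ltn_ord j; lia.
  apply: Pdiag => i; rewrite mxE; case: ifP => oi; first exact: oner_neq0.
  case: insubP => [j lt_in jE|]; last by rewrite oner_eq0.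
  have {}jE : j = i.+1 :> nat := jE.
  apply: (Sg i j _).2; first by move: lt_in; lia.
    by rewrite jE; lia.
  by apply/eqP => ij; move: jE; rewrite -ij; lia.
have an : (k.*2 < n)%N by lia.
have bn : (k.*2.+1 < n)%N by lia.
pose a := Ordinal an; pose b := Ordinal bn.
suff {M sM Sg} H M : stage k M -> M a b != 0 -> P M.
  have [g0|] := eqVneq (M a b) 0; last exact: H.
  apply: (Pdens _ a b) => // s s0; apply: H; last first.
    have ab : (a == b) = false by apply/eqP => /(congr1 val) /=; lia.
    by rewrite !mxE !eqxx ab /= subr0 g0 mulr1 add0r.
  split.
    rewrite /skew_mx linearD linearZ linearB /= !trmx_delta sM opprD; congr (_ + _).
    by rewrite -scalerN opprB.
  move=> i j ik; rewrite !mxE.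
  have -> : (i == a) = false by apply/eqP => iE; move: ik; rewrite iE /=; lia.
  have -> : (i == b) = false by apply/eqP => iE; move: ik; rewrite iE /=; lia.
  by rewrite subrr mulr0 addr0; apply: Sg.
move=> [sM Sg] g0.
(* The pivot [M a b] is off the diagonal, so row [b] is cleared with column [a] (by [r]) and row [a]
   with column [b] (by [r']). *)
pose r : 'rV[F]_n := \row_j (if (b < j)%N then - M j b / M a b else 0).
pose r' : 'rV[F]_n := \row_j (if (b < j)%N then M j a / M a b else 0).
have r0 (j : 'I_n) : (j <= b)%N -> r 0 j = 0 by rewrite mxE leqNgt => /negbTE ->.
have r'0 (j : 'I_n) : (j <= b)%N -> r' 0 j = 0 by rewrite mxE leqNgt => /negbTE ->.
apply: (Prow a r) => //; first by move=> j ja; apply: r0; move: ja => /=; lia.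
apply: (Prow b r') => //; first exact: skew_mx_congr.
set M1 := _ *m M *m _; set M2 := _ *m M1 *m _.
have sM1 : skew_mx M1 by exact: skew_mx_congr.
apply: (IHm k.+1); first by lia.
split=> [|i j ik]; first exact: skew_mx_congr.
have ib : (i <= b)%N by move: ik => /=; lia.
have M1E (x y : 'I_n) : (x <= b)%N -> M1 x y = M x y + M x a * r 0 y.
  by move=> xb; rewrite /M1 -mulmxA mul_col_unip r0 // mul0r addr0 mul_row_unip.
have -> : M2 i j = M i j + M i a * r 0 j + M i b * r' 0 j.
  rewrite /M2 -mulmxA mul_col_unip r'0 // mul0r addr0 mul_row_unip !M1E //.
  by rewrite [r 0 b]r0 // mulr0 addr0.
have low (x y : 'I_n) : (x < k.*2)%N -> (x./2 != y./2) -> M x y = 0.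
  by move=> xk; apply: (Sg x y xk).1.
case: (ltnP i k.*2) => [ik'|ki].
  rewrite [M i a]low ?[M i b]low ?mul0r ?addr0 //=; try lia.
  by split; [exact: low | apply: (Sg i j ik').2].
have colz (y : 'I_n) : (y < k.*2)%N -> M a y = 0 /\ M b y = 0.
  by move=> yk; rewrite !(skew_mxE _ y sM) !low ?oppr0 //=; lia.
have [ia|ib'] : i = a \/ i = b.
  have: i = k.*2 :> nat \/ i = k.*2.+1 :> nat by move: ib => /=; lia.
  by case=> [?|?]; [left|right]; apply: val_inj.
- subst i; rewrite (skew_mx_diag _ sM) mul0r addr0; split=> [aj|aj ne].
    case: (leqP j b) => jb.
      rewrite r'0 // mulr0 addr0; apply: (colz j _).1; move: aj jb => /=; lia.
    by rewrite mxE jb mulrC divfK // (skew_mxE _ _ sM) addNr.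
  have -> : j = b by apply: val_inj; move: aj ne; rewrite -val_eqE /=; lia.
  by rewrite r'0 // mulr0 addr0.
- subst i; rewrite (skew_mx_diag _ sM) mul0r addr0; split=> [aj|aj ne].
    case: (leqP j b) => jb.
      rewrite r0 // mulr0 addr0; apply: (colz j _).2; move: aj jb => /=; lia.
    rewrite mxE jb [M b a](skew_mxE _ _ sM) [M b j](skew_mxE _ _ sM).
    by rewrite mulNr mulNr mulrN opprK mulrC divfK // addNr.
  have -> : j = a by apply: val_inj; move: aj ne; rewrite -val_eqE /=; lia.
  rewrite r0 /=; last by lia.
  by rewrite mulr0 addr0 (skew_mxE _ _ sM) oppr_eq0.
Qed.

End DensityInduction.

(** * Pfaffians: congruence and nonvanishing *)

Section Pfaffian.
Variable (R : comNzRingType).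

(* 2^k k! times the Pfaffian, for the pairing of i with k + i. *)
Definition pfaffian (k : nat) (A : 'M[R]_(k + k)) : R :=
  \sum_(s : 'S_(k + k)) (-1) ^+ s * \prod_(i < k) A (s (lshift k i)) (s (rshift k i)).

(** The argument is that for multiplicativity of determinants: expand every factor, obtaining one
    determinant of columns of [B] for each choice of column indices. Choices with a repetition give
    0, and the injective ones are permutations, contributing a sign times the determinant of [B]. *)
Lemma pfaffian_congr (k : nat) (A B : 'M[R]_(k + k)) :
  pfaffian (B *m A *m B^T) = \det B * pfaffian A.
Proof.
pose f (p : {ffun 'I_k -> 'I_(k + k) * 'I_(k + k)}) x :=
  match split x with inl i => (p i).1 | inr i => (p i).2 end.
pose D (g : 'I_(k + k) -> 'I_(k + k)) := \det (\matrix_(x, y) B y (g x)).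
transitivity (\sum_(p : {ffun 'I_k -> 'I_(k + k) * 'I_(k + k)})
  (\prod_i A (p i).1 (p i).2) * D (f p)).
  rewrite /pfaffian.
  transitivity (\sum_(s : 'S_(k + k)) \sum_(p : {ffun 'I_k -> 'I_(k + k) * 'I_(k + k)})
    (-1) ^+ s * \prod_i
     (B (s (lshift k i)) (p i).1 * A (p i).1 (p i).2 * B (s (rshift k i)) (p i).2)).
    apply: eq_bigr => s _; rewrite -big_distrr /=; congr (_ * _).
    rewrite -(bigA_distr_bigA (fun i u => B (s (lshift k i)) u.1 * A u.1 u.2
       * B (s (rshift k i)) u.2)) /=.
    apply: eq_bigr => i _; rewrite !mxE.
    rewrite (eq_bigr (fun v => \sum_u B (s (lshift k i)) u * A u v
      * B (s (rshift k i)) v)) => [|v _]; last by rewrite !mxE mulr_suml.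
    by rewrite exchange_big pair_bigA.
  rewrite exchange_big; apply: eq_bigr => p _; rewrite big_distrr /=.
  apply: eq_bigr => s _; rewrite mulrCA; congr (_ * _).
  rewrite big_split_ord /= -!big_split; apply: eq_bigr => i _ /=.
  by rewrite !mxE /f (unsplitK (inl i)) (unsplitK (inr i)) mulrAC mulrC.
(* Choosing a pair of indices for each of the [k] factors amounts to choosing a self-map of all
   [k + k] indices. *)
pose h (g : {ffun 'I_(k + k) -> 'I_(k + k)}) := [ffun i : 'I_k => (g (lshift k i), g (rshift k i))].
rewrite (reindex h) /=; last first.
  exists (fun p => [ffun x => f p x]) => [g|p] _; apply/ffunP => x; rewrite !ffunE.
    by rewrite /f; case: (split_ordP x) => i ->; rewrite ffunE.
  by rewrite /f (unsplitK (inl x)) (unsplitK (inr x)); case: (p x).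
have Dh g : D (f (h g)) = D g.
  congr (\det _); apply/matrixP => x y; rewrite !mxE /f.
  by case: (split_ordP x) => i ->; rewrite ffunE.
rewrite (bigID (fun g : {ffun 'I_(k + k) -> 'I_(k + k)} => injectiveb g)) /=.
rewrite addrC big1 ?add0r => [|g Ug]; last first.
  case/injectivePn: Ug => x [y xy gxy].
  by rewrite Dh /D (determinant_alternate xy) ?mulr0 // => z; rewrite !mxE gxy.
rewrite (reindex (@pval _)) /=; last first.
  pose in_Sn := insubd (1%g : 'S_(k + k)).
  by exists in_Sn => /= g Ug; first apply: val_inj; apply: insubdK.
rewrite /pfaffian big_distrr /=; apply: eq_big => /= [s | s _]; rewrite ?(valP s) //.
rewrite Dh.
have -> : D (pval s) = (-1) ^+ s * \det B.
  rewrite -det_perm -[\det B]det_tr -det_mulmx -row_permE; congr (\det _).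
  by apply/matrixP => x y; rewrite !mxE pvalE.
rewrite (eq_bigr (fun i => A (s (lshift k i)) (s (rshift k i)))) => [|i _].
  by rewrite mulrC -mulrA mulrCA.
by rewrite !ffunE /= !pvalE.
Qed.

Lemma pfaffian_row0 (k : nat) (A : 'M[R]_(k + k)) x :
  (forall y, A x y = 0) -> (forall y, A y x = 0) -> pfaffian A = 0.
Proof.
move=> A0 A0'; rewrite /pfaffian big1 // => s _.
have [i xi] : exists i, x = s (lshift k i) \/ x = s (rshift k i).
  case: (split_ordP ((s^-1)%g x)) => i E; exists i; [left|right];
  by rewrite -E permKV.
by rewrite (bigD1 i) //=; case: xi => <-; rewrite ?A0 ?A0' mul0r mulr0.
Qed.

End Pfaffian.

Lemma pfaffian_map (R S : comNzRingType) (f : {rmorphism R -> S}) (k : nat)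
    (A : 'M[R]_(k + k)) : pfaffian (map_mx f A) = f (pfaffian A).
Proof.
rewrite rmorph_sum; apply: eq_bigr => s _ /=; rewrite rmorphM rmorph_sign rmorph_prod.
by congr (_ * _); apply: eq_bigr => i _; rewrite mxE.
Qed.

Definition symp_mx (R : comNzRingType) (k : nat) : 'M[R]_(k + k) :=
  block_mx 0 1%:M (- 1%:M) 0.

(* Each nonzero term is a square: after exchanging the two members of some    *)
(* pairs, s permutes the pairs and perm_mx s is block_mx Q 0 0 Q.             *)
Lemma symp_term_ge0 (k : nat) (s : 'S_(k + k)) :
  0 <= (-1) ^+ s * \prod_(i < k) symp_mx int k (s (lshift k i)) (s (rshift k i)).
Proof.
have Jll i j : symp_mx int k (lshift k i) (lshift k j) = 0.
  by rewrite block_mxEul mxE.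
have Jrr i j : symp_mx int k (rshift k i) (rshift k j) = 0.
  by rewrite block_mxEdr mxE.
have Jlr i j : symp_mx int k (lshift k i) (rshift k j) = (i == j)%:R.
  by rewrite block_mxEur mxE.
have Jrl i j : symp_mx int k (rshift k i) (lshift k j) = - (i == j)%:R.
  by rewrite block_mxEdl !mxE.
pose flips (s : 'S_(k + k)) := #|[pred i : 'I_k | (k <= s (lshift k i))%N]|.
have [m] := ubnP (flips s); elim: m s => // m IHm s sm.
have [/existsP[i /eqP i0]|/existsPn nz] :=
  boolP [exists i, symp_mx int k (s (lshift k i)) (s (rshift k i)) == 0].
  by rewrite (bigD1 i) //= i0 mul0r mulr0.
(* Exchanging the two members of pair [i] changes the sign of the permutation and the sign of the
   i-th factor, so the term is unchanged, while one pair fewer starts in the upper half. *)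
have [fl|/existsPn nofl] := boolP [exists i : 'I_k, (k <= s (lshift k i))%N].
  case/existsP: fl => i fi.
  pose s' := (tperm (lshift k i) (rshift k i) * s)%g.
  have s'l : s' (lshift k i) = s (rshift k i) by rewrite permM tpermL.
  have s'r : s' (rshift k i) = s (lshift k i) by rewrite permM tpermR.
  have s'j j : j != i -> s' (lshift k j) = s (lshift k j) /\
      s' (rshift k j) = s (rshift k j).
    move=> ji; rewrite !permM; split; rewrite tpermD ?eq_lrshift ?eq_rlshift //.
      by rewrite eq_lshift eq_sym.
    by rewrite eq_rshift eq_sym.
  have lt_r : (s (rshift k i) < k)%N /\ symp_mx int k (s (lshift k i)) (s (rshift k i))
        = - symp_mx int k (s (rshift k i)) (s (lshift k i)).
    move: fi (nz i).
    case: (split_ordP (s (lshift k i))) => a ->; first by rewrite /= leqNgt ltn_ord.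
    case: (split_ordP (s (rshift k i))) => b -> _; last by rewrite Jrr eqxx.
    by split; rewrite ?Jrl ?Jlr /= ?ltn_ord // eq_sym.
  have := IHm s'; rewrite odd_permM odd_tperm eq_lrshift /=.
  rewrite signrN (bigD1 i) //= [in X in _ -> X](bigD1 i) //=.
  rewrite s'l s'r lt_r.2 => H.
  rewrite [\prod_(j < k | j != i) _](eq_bigr (fun j =>
    symp_mx int k (s' (lshift k j)) (s' (rshift k j)))); last first.
    by move=> j ji; have [E1 E2] := s'j j ji; rewrite E1 E2.
  rewrite mulNr mulrN -mulNr.
  apply: H; rewrite ltnS in sm; apply: leq_trans sm; apply: proper_card; apply/properP; split.
    apply/subsetP => j; rewrite !inE; have [->|/s'j[-> //]] := eqVneq j i.
    by rewrite fi.
  by exists i; rewrite !inE // s'l -ltnNge lt_r.1.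
pose Q : 'M[int]_k := \matrix_(i, j) (s (lshift k i) == lshift k j)%:R.
have sE i : exists j, s (lshift k i) = lshift k j /\ s (rshift k i) = rshift k j.
  move: (nz i) (nofl i).
  case: (split_ordP (s (lshift k i))) => a ->; last by rewrite /= leq_addr.
  case: (split_ordP (s (rshift k i))) => b ->; first by rewrite Jll eqxx.
  by rewrite Jlr; have [->|] := eqVneq a b; [move=> _ _; exists b | rewrite eqxx].
have -> : \prod_(i < k) symp_mx int k (s (lshift k i)) (s (rshift k i)) = 1.
  rewrite big1 // => i _; have [j [-> ->]] := sE i; by rewrite Jlr eqxx.
rewrite mulr1 -det_perm; have -> : perm_mx s = block_mx Q 0 0 Q.
  apply/matrixP => x y.
  case: (split_ordP x) => i ->; have [i' [El Er]] := sE i;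
  case: (split_ordP y) => j ->;
  by rewrite ?(block_mxEul, block_mxEur, block_mxEdl, block_mxEdr) !mxE ?El ?Er
    ?eq_lshift ?eq_rshift ?eq_lrshift ?eq_rlshift //.
by rewrite det_ublock -expr2 sqr_ge0.
Qed.

(** Over the integers all terms of the sum are nonnegative and the identity permutation contributes
    1; the positive integer obtained stays nonzero in characteristic 0. *)
Lemma pfaffian_symp_neq0 (F : numFieldType) (k : nat) : pfaffian (symp_mx F k) != 0.
Proof.
have -> : symp_mx F k = map_mx (fun z : int => z%:~R) (symp_mx int k).
  rewrite /symp_mx map_block_mx; congr block_mx; apply/matrixP => i j;
  by rewrite !mxE ?rmorphN /= ?mulrz_nat ?rmorph_nat ?natz //; case: (i == j).
rewrite pfaffian_map intr_eq0 gt_eqF // /pfaffian (bigD1 1%g) //=.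
rewrite ltr_wpDr ?sumr_ge0 // => [s _|]; first exact: symp_term_ge0.
rewrite odd_perm1 mul1r big1 ?ltr01 // => i _.
by rewrite !perm1 block_mxEur mxE eqxx.
Qed.

(** * Leading Pfaffians and their values at special points *)

Section LeadingPfaffian.
Variables (R : comNzRingType) (n : nat).

Lemma lead_idx_proof (l : 'I_n./2) : (l.+1 + l.+1 <= n)%N.
Proof. by have := ltn_ord l; lia. Qed.

Definition lead_idx (l : 'I_n./2) : 'I_(l.+1 + l.+1) -> 'I_n :=
  widen_ord (lead_idx_proof l).

Definition lead_pf (l : 'I_n./2) (A : 'M[R]_n) : R :=
  pfaffian (mxsub (@lead_idx l) (@lead_idx l) A).

(** The hypothesis makes [B] block upper triangular, so the leading block of the congruent matrix
    depends only on the leading blocks of [A] and [B]. *)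
Lemma lead_pf_congr (l : 'I_n./2) (A B : 'M[R]_n) :
    (forall x y : 'I_n, (y < l.+1.*2 <= x)%N -> B x y = 0) ->
  lead_pf l (B^T *m A *m B)
    = \det (mxsub (@lead_idx l) (@lead_idx l) B) * lead_pf l A.
Proof.
move=> B0; rewrite -det_tr -pfaffian_congr /lead_pf; congr pfaffian.
have sumE (f : 'I_n -> R) : (forall x : 'I_n, (l.+1.*2 <= x)%N -> f x = 0) ->
    \sum_x f x = \sum_y f (@lead_idx l y).
  move=> f0; rewrite (bigID (fun x : 'I_n => (x < l.+1 + l.+1)%N)) /=.
  rewrite [X in _ + X]big1 ?addr0 => [|x xl]; last by apply: f0; move: xl; lia.
  by rewrite (big_ord_narrow (lead_idx_proof l)).
have lw (x : 'I_(l.+1 + l.+1)) : (@lead_idx l x < l.+1.*2)%N.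
  by have := ltn_ord x; rewrite /= -addnn.
apply/matrixP => x y; rewrite !mxE.
rewrite sumE => [|z zl]; last by rewrite B0 ?mulr0 // zl lw.
apply: eq_bigr => z _; rewrite !mxE sumE => [|u ul]; last first.
  by rewrite mxE B0 ?mul0r // ul lw.
by congr (_ * _); apply: eq_bigr => u _; rewrite !mxE.
Qed.

Lemma lead_pf_congr_unit (l : 'I_n./2) (A B : 'M[R]_n) :
    (forall x y : 'I_n, (y < x)%N -> B x y = 0) ->
    (forall x, B x x = 1) ->
  lead_pf l (B^T *m A *m B) = lead_pf l A.
Proof.
move=> Bup B1; rewrite lead_pf_congr => [|x y xy]; last by apply: Bup; lia.
rewrite -det_tr det_trig ?big1 ?mul1r // => [i _|]; first by rewrite !mxE.
by apply/is_trig_mxP => i j ij; rewrite !mxE Bup.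
Qed.

Lemma lead_pf_congr_diag (l : 'I_n./2) (A : 'M[R]_n) (d : 'rV[R]_n) :
  lead_pf l (diag_mx d *m A *m diag_mx d)
    = (\prod_(x < n | (x < l.+1.*2)%N) d 0 x) * lead_pf l A.
Proof.
rewrite -{1}[diag_mx d]tr_diag_mx lead_pf_congr => [|x y xy]; last first.
  by rewrite mxE; case: eqP xy => [->|_]; rewrite ?mulr0n //; lia.
congr (_ * _); rewrite det_trig; last first.
  apply/is_trig_mxP => i j ij; rewrite !mxE; case: eqP => // /(congr1 val) /=.
  by move=> E; move: ij; rewrite E ltnn.
have E (x : 'I_n) : (x < l.+1.*2)%N = (x < l.+1 + l.+1)%N by rewrite addnn.
rewrite (eq_bigl _ _ E) (big_ord_narrow (lead_idx_proof l)).
by apply: eq_bigr => i _; rewrite !mxE eqxx.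
Qed.

Lemma lead_pf_row0 (l : 'I_n./2) (A : 'M[R]_n) (x : 'I_n) : (x < l.+1.*2)%N ->
  (forall y : 'I_n, (y < l.+1.*2)%N -> A x y = 0 /\ A y x = 0) -> lead_pf l A = 0.
Proof.
move=> xl A0; have xl' : (x < l.+1 + l.+1)%N by rewrite addnn.
have xE : @lead_idx l (Ordinal xl') = x by apply: val_inj.
apply: (@pfaffian_row0 _ _ _ (Ordinal xl')) => y; rewrite mxE xE;
  by apply A0; rewrite /= -addnn.
Qed.

End LeadingPfaffian.

Lemma lead_pf_map (R S : comNzRingType) (f : {rmorphism R -> S}) (n : nat)
    (l : 'I_n./2) (A : 'M[R]_n) : lead_pf l (map_mx f A) = f (lead_pf l A).
Proof.
by rewrite /lead_pf -pfaffian_map; congr pfaffian; apply/matrixP => i j; rewrite !mxE.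
Qed.

(** The pairing of 2i with 2i+1 in [std_skew] becomes the pairing of i with k+i in [symp_mx] after
    the reordering [g] of the indices, which is a congruence. *)
Lemma lead_pf_std_neq0 (F : numFieldType) (n : nat) (l : 'I_n./2) :
  lead_pf l (std_skew F n) != 0.
Proof.
pose k := l.+1; pose c (i : 'I_k) (b : bool) : 'I_(k + k) := inord (i.*2 + b).
have cE i b : c i b = (i.*2 + b)%N :> nat.
  have ik : (i < l.+1)%N := ltn_ord i.
  have bk : (i.*2 + b < k + k)%N 
    by rewrite addnn; apply: (@leq_trans i.+1.*2); [case: b; lia | rewrite leq_double].
  by rewrite /c inordK.
pose g x : 'I_(k + k) := match split x with inl i => c i false | inr i => c i true end.
pose Q : 'M[F]_(k + k) := \matrix_(x, y) (y == g x)%:R.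
set M := mxsub (@lead_idx n l) (@lead_idx n l) (std_skew F n).
suff E : Q *m M *m Q^T = symp_mx F k.
  have := pfaffian_symp_neq0 F k; rewrite -E pfaffian_congr /lead_pf -/M.
  by apply: contraNneq => ->; rewrite mulr0.
have sub : Q *m M *m Q^T = mxsub g g M.
  apply/matrixP => x y; rewrite mxE (bigD1 (g y)) //= big1 => [|z /negbTE zy].
    rewrite addr0 !mxE eqxx mulr1 (bigD1 (g x)) //= big1 => [|z /negbTE zx].
      by rewrite !mxE eqxx mul1r addr0.
    by rewrite !mxE zx mul0r.
  by rewrite [Q^T _ _]mxE [Q _ _]mxE zy mulr0.
have Me x y : M x y = (((lead_idx x).+1 == lead_idx y) && ~~ odd (lead_idx x))%:R
    - (((lead_idx y).+1 == lead_idx x) && ~~ odd (lead_idx y))%:R.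
  by rewrite !mxE.
have gl i : g (lshift k i) = c i false by rewrite /g (unsplitK (inl i)).
have gr i : g (rshift k i) = c i true by rewrite /g (unsplitK (inr i)).
have dbl (i j : 'I_k) : (i.*2 == j.*2) = (i == j) by rewrite -!muln2 eqn_mul2r.
rewrite sub; apply/matrixP => x y; rewrite mxE Me /=.
case: (split_ordP x) => i ->; case: (split_ordP y) => j ->;
  rewrite ?gl ?gr !cE ?addn0 ?addn1 /= ?odd_double /= ?andbT ?andbF ?subr0 ?sub0r ?eqSS.
- have -> : (i.*2.+1 == j.*2) = false by lia.
  have -> : (j.*2.+1 == i.*2) = false by lia.
  by rewrite subrr block_mxEul mxE.
- by rewrite block_mxEur mxE dbl ?andbF ?subr0.
- by rewrite block_mxEdl !mxE dbl eq_sym.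
- by rewrite ?oppr0 block_mxEdr mxE.
Qed.

(** A permutation preserving the leading indices is a congruence of the kind treated in
    [lead_pf_congr], and it carries the matrix back to [std_skew]. *)
Lemma lead_pf_perm_neq0 (F : numFieldType) (n : nat) (l : 'I_n./2) (s : 'S_n) :
    (forall x : 'I_n, (x < l.+1.*2)%N -> ((s^-1)%g x < l.+1.*2)%N) ->
  lead_pf l (\matrix_(x, y) std_skew F n (s x) (s y)) != 0.
Proof.
set M := \matrix_(x, y) _ => sl.
pose B : 'M[F]_n := \matrix_(a, x) (a == (s^-1)%g x)%:R.
have E : B^T *m M *m B = std_skew F n.
  apply/matrixP => x y; rewrite mxE (bigD1 ((s^-1)%g y)) //= big1 => [|z /negbTE zy].
    rewrite addr0 [B _ _]mxE eqxx mulr1 mxE (bigD1 ((s^-1)%g x)) //= big1 => [|z /negbTE zx].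
      by rewrite [B^T _ _]mxE [B _ _]mxE eqxx mul1r addr0 mxE !permKV.
    by rewrite [B^T _ _]mxE [B _ _]mxE zx mul0r.
  by rewrite [B _ _]mxE zy mulr0.
have := lead_pf_std_neq0 F l; rewrite -{1}E lead_pf_congr => [|x y /andP[yl xl]].
  by apply: contraNneq => ->; rewrite mulr0.
by rewrite mxE; case: eqP => // xE; move: xl; rewrite xE leqNgt sl.
Qed.

(** * Gradings by torus weights *)

(** The grading in which the i-th variable has degree [c i]. As a [measure] it makes the weight
    components under a one-parameter diagonal group available as [pihomog]. *)
Definition lin_meas (N : nat) (c : 'I_N -> nat) (m : 'X_{1..N}) : nat :=
  (\sum_i m i * c i)%N.

Lemma lin_meas0 (N : nat) (c : 'I_N -> nat) : lin_meas c 0%MM = 0%N.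
Proof. by rewrite /lin_meas big1 // => i _; rewrite mnm0E. Qed.

Lemma lin_measD (N : nat) (c : 'I_N -> nat) :
  {morph lin_meas c : m1 m2 / (m1 + m2)%MM >-> (m1 + m2)%N}.
Proof.
by move=> m1 m2; rewrite /lin_meas -big_split; apply: eq_bigr => i _; rewrite mnmDE mulnDl.
Qed.

HB.instance Definition _ (N : nat) (c : 'I_N -> nat) :=
  isMeasure.Build N (lin_meas c) (lin_meas0 c) (lin_measD c).

Lemma lin_meas1 (N : nat) (c : 'I_N -> nat) i : lin_meas c U_(i)%MM = c i.
Proof.
rewrite /lin_meas (bigD1 i) //= big1 ?addn0 => [|j /negbTE ji]; rewrite mnm1E.
  by rewrite eqxx mul1n.
by rewrite eq_sym ji mul0n.
Qed.

Section Weights.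
Variables (F : numFieldType) (N : nat).
Implicit Types (p q : {mpoly F[N]}) (e : 'rV[F]_N) (c : 'I_N -> nat).

Lemma mcoeff_lin_subst_diag e p m :
  (lin_subst (diag_mx e) p)@_m = (\prod_i e 0 i ^+ m i) * p@_m.
Proof.
have X k : lin_subst (diag_mx e) 'X_[k] = (\prod_i e 0 i ^+ k i) *: 'X_[k].
  rewrite /lin_subst comp_mpolyX [in RHS]mpolyXE_id -scaler_prod.
  apply: eq_bigr => i _; rewrite tnth_mktuple -exprZn; congr (_ ^+ _).
  rewrite (bigD1 i) //= big1 ?addr0 => [|j /negbTE ji]; rewrite mxE ?eqxx //.
  by rewrite eq_sym ji mulr0n scale0r.
rewrite [in LHS](mpolyE p) [in RHS](mpolyE p) [lin_subst _ _]linear_sum /= !raddf_sum /= mulr_sumr.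
apply: eq_bigr => k _; rewrite linearZ /= X !mcoeffZ !mcoeffX.
by case: eqP => [->|_]; rewrite ?mulr0 // !mulr1 mulrC.
Qed.

Lemma lin_subst_homog_meas c d s p : p \is d.-homog for (lin_meas c) ->
  lin_subst (diag_mx (\row_i s ^+ c i)) p = s ^+ d *: p.
Proof.
move=> /dhomogP hp; apply/mpolyP => m; rewrite mcoeff_lin_subst_diag mcoeffZ.
have [mp|/memN_msupp_eq0 ->] := boolP (m \in msupp p); last by rewrite !mulr0.
have <- : lin_meas c m = d := hp m mp.
rewrite /lin_meas -prodrXr; congr (_ * _).
by apply: eq_bigr => i _; rewrite mxE -exprM mulnC.
Qed.

(** The orbit of [p] under the one-parameter group is a polynomial curve whose coefficients are the
    homogeneous components of [p], so [subspace_coef] applies. *)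
Lemma pihomog_mem (U : {mpoly F[N]} -> Prop) c : subspace U ->
    (forall s p, s != 0 -> U p -> U (lin_subst (diag_mx (\row_i s ^+ c i)) p)) ->
  forall d p, U p -> U (pihomog (lin_meas c) d p).
Proof.
move=> sU Uc d p Up; pose K := maxn (mmeasure (lin_meas c) p) d.+1.
apply: (subspace_coef (K := K) (q := fun d => pihomog (lin_meas c) d p) sU); last first.
  by rewrite leq_maxr.
move=> s s0; have := Uc s p s0 Up.
rewrite {1}(pihomog_partitionE (mf := lin_meas c) (k := K) (p := p)) ?leq_maxl //.
rewrite linear_sum /=; congr (U _); apply: eq_bigr => i _.
by rewrite (lin_subst_homog_meas _ (pihomogP _ _ _)).
Qed.

Lemma mcoeff_pihomog (mf : measure N) d p m :
  (pihomog mf d p)@_m = if mf m == d then p@_m else 0.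
Proof.
rewrite [in LHS](mpolyE p) [pihomog _ _ _]linear_sum /= raddf_sum /=.
under eq_bigr => k _ do rewrite linearZ /= pihomogX mcoeffZ.
case: eqP => md; last first.
  rewrite big1 // => k _; case: eqP => kd; rewrite ?mcoeff0 ?mulr0 // mcoeffX.
  by case: eqP => [km|_]; rewrite ?mulr0 //; rewrite km in kd.
rewrite [in RHS](mpolyE p) raddf_sum /=; apply: eq_bigr => k _.
rewrite mcoeffZ mcoeffX; case: (eqVneq k m) => [->|km].
  by rewrite md eqxx mcoeffX eqxx.
by case: eqP; rewrite ?mcoeff0 // mcoeffX (negbTE km).
Qed.

(** If [p] is not homogeneous for one of the gradings, its component through the leading monomial is
    nonzero and has fewer monomials; the descent on the number of monomials treats all gradings at
    once. *)
Lemma exists_multihomog (I : Type) (mf : I -> measure N) (U : {mpoly F[N]} -> Prop) :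
    (forall i d p, U p -> U (pihomog (mf i) d p)) ->
  forall p, U p -> p != 0 -> exists q,
    [/\ U q, q != 0, {subset msupp q <= msupp p}
      & forall i, exists d, q \is d.-homog for (mf i)].
Proof.
move=> Uh p; have [k] := ubnP (size (msupp p)); elim: k p => // k IHk p pk Up p0.
have [hom|] := EM (forall i, exists d, p \is d.-homog for (mf i)); first by exists p; split.
move=> /existsNP[i /forallNP nh]; pose m := mlead p; pose q := pihomog (mf i) (mf i m) p.
have mp : m \in msupp p by apply: mlead_supp.
have sub : {subset msupp q <= msupp p}.
  move=> m'; rewrite !mcoeff_msupp mcoeff_pihomog; by case: ifP => // _ /eqP.
have q0 : q != 0.
  apply/eqP => /(congr1 (mcoeff m)); rewrite mcoeff_pihomog eqxx mcoeff0 => /eqP.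
  by rewrite mcoeff_eq0 mp.
have [||r [Ur r0 sr hr]] := IHk q _ _ q0; last first.
- by exists r; split=> // m' /sr /sub.
- exact: Uh.
have /allPn[m1 m1p m1d] : ~~ (p \is (mf i m).-homog for (mf i)) by apply/negP; exact: nh.
rewrite ltnS in pk; apply: leq_trans pk.
have : (size (msupp q) <= size (rem m1 (msupp p)))%N.
  apply: uniq_leq_size; first exact: msupp_uniq.
  move=> m2 m2q; rewrite (mem_rem_uniq _ (msupp_uniq _)) inE /= sub // andbT.
  apply: contraTneq m2q => ->; rewrite mcoeff_msupp mcoeff_pihomog negbK.
  by move: m1d => /= /negbTE ->.
by rewrite size_rem // -ltnS prednK //; case: (msupp p) m1p.
Qed.

(** The polynomials vanishing everywhere form a subspace stable under rescaling of each variable. A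
    nonzero one would therefore yield a nonzero multiple of a monomial, which does not vanish at the
    point with all coordinates 1. *)
Lemma meval_eq0 p : (forall v, p.@[v] = 0) -> p = 0.
Proof.
move=> p0; apply/eqP/negPn/negP => nz.
pose U q := forall v : 'I_N -> F, q.@[v] = 0.
have sU : subspace U.
  split=> [v|a q r Uq Ur v]; first by rewrite meval0.
  by rewrite mevalD mevalZ Uq Ur mulr0 addr0.
pose mf (i : 'I_N) : measure N := lin_meas (fun j => (j == i) : nat).
have [|q [Uq q0 _ hq]] := @exists_multihomog 'I_N mf U _ p p0 nz.
  move=> i d q Uq; apply: (pihomog_mem sU) => // s r s0 Ur v.
  by rewrite meval_lin_subst; apply: Ur.
suff qE : q = q@_(mlead q) *: 'X_[mlead q].
  have := Uq (fun=> 1); rewrite qE mevalZ mevalX big1 ?mulr1 => [|i _].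
    by move/eqP; rewrite mleadc_eq0 (negbTE q0).
  by rewrite expr1n.
apply/mpolyP => m; rewrite mcoeffZ mcoeffX.
case: eqP => [<-|ne]; rewrite ?mulr1 // mulr0; apply/eqP/negPn; rewrite mcoeff_eq0 negbK.
apply/negP => mq; apply: ne; apply/mnmP => i; have [d /dhomogP hd] := hq i.
have mfE m' : mf i m' = m' i.
  rewrite /mf /= /lin_meas (bigD1 i) //= eqxx muln1 big1 ?addn0 // => j /negbTE ->.
  by rewrite muln0.
by rewrite -!mfE (hd _ mq) (hd _ (mlead_supp q0)).
Qed.

End Weights.

(** * The action of square matrices on polynomials in a skew-symmetric matrix *)

Section Bivectors.
Variables (F : numFieldType) (n : nat).
Notation N := (tangent_dim n).
Implicit Types (a b M : 'M[F]_n) (p q : sym_tangent F n).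

Definition tix (i : 'I_N) : 'I_n * 'I_n := val (enum_val i).

Lemma tix_lt i : ((tix i).1 < (tix i).2)%N.
Proof. exact: (valP (enum_val i)). Qed.

Lemma tix_ex (x y : 'I_n) : (x < y)%N -> exists i, tix i = (x, y).
Proof.
move=> xy; exists (enum_rank (exist _ (x, y) xy : tangent_idx n)).
by rewrite /tix enum_rankK.
Qed.

Lemma tix_inj : injective tix.
Proof. by move=> i j /val_inj /enum_val_inj. Qed.

Lemma tix_swap i j : ((tix i).1 == (tix j).2) && ((tix i).2 == (tix j).1) = false.
Proof.
apply/negP => /andP[/eqP E1 /eqP E2]; have := tix_lt i; have := tix_lt j.
by rewrite E1 E2; lia.
Qed.

Definition bivec (i : 'I_N) : 'M[F]_n :=
  delta_mx (tix i).1 (tix i).2 - delta_mx (tix i).2 (tix i).1.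

(** The transpose of the second compound matrix: the entries are the 2 x 2 minors of [a], with rows
    [tix j] and columns [tix i], that is, the action of [a] on bivectors. *)
Definition compound a : 'M[F]_N :=
  \matrix_(i, j) (a (tix j).1 (tix i).1 * a (tix j).2 (tix i).2
                  - a (tix j).1 (tix i).2 * a (tix j).2 (tix i).1).

Lemma congr_deltaE (a b : 'M[F]_n) x y (u v : 'I_n) :
  (a *m delta_mx u v *m b) x y = a x u * b v y.
Proof.
by rewrite -(mul_delta_mx (0 : 'I_1)) mulmxA -mulmxA -colE -rowE mxE big_ord1 !mxE.
Qed.

Lemma compoundE a i j :
  compound a i j = (a *m bivec i *m a^T) (tix j).1 (tix j).2.
Proof. by rewrite mulmxBr mulmxBl [RHS]mxE [X in _ = _ + X]mxE !congr_deltaE !mxE. Qed.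

Lemma skew_bivec i : skew_mx (bivec i).
Proof. by rewrite /skew_mx /bivec linearB /= !trmx_delta opprB. Qed.

Lemma bivecE i j : bivec i (tix j).1 (tix j).2 = (i == j)%:R.
Proof.
rewrite !mxE [((tix j).1 == _) && ((tix j).2 == (tix i).1)]tix_swap subr0.
congr ((_ : bool)%:R); apply/andP/eqP => [[/eqP E1 /eqP E2]|->]; last by rewrite !eqxx.
by apply: tix_inj; move: E1 E2; case: (tix i) (tix j) => ? ? [? ?] /= -> ->.
Qed.

Lemma skew_sum_bivec M : skew_mx M -> M = \sum_i M (tix i).1 (tix i).2 *: bivec i.
Proof.
move=> sM.
have sS : skew_mx (\sum_i M (tix i).1 (tix i).2 *: bivec i).
  rewrite /skew_mx linear_sum -sumrN; apply: eq_bigr => i _.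
  by rewrite linearZ /= skew_bivec scalerN.
apply/matrixP => x y; case: (ltngtP x y) => xy.
- have [i iE] := tix_ex xy; have B j : bivec j x y = (j == i)%:R.
    by have := bivecE j i; rewrite iE.
  rewrite summxE (bigD1 i) //= big1 => [|j /negbTE ji]; rewrite mxE B ?ji ?mulr0 //.
  by rewrite eqxx mulr1 addr0 iE.
- rewrite (skew_mxE _ _ sM) (skew_mxE _ _ sS); congr (- _).
  have [i iE] := tix_ex xy; have B j : bivec j y x = (j == i)%:R.
    by have := bivecE j i; rewrite iE.
  rewrite summxE (bigD1 i) //= big1 => [|j /negbTE ji]; rewrite mxE B ?ji ?mulr0 //.
  by rewrite eqxx mulr1 addr0 iE.
- by have -> : x = y by [apply: val_inj]; rewrite !skew_mx_diag.
Qed.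

Lemma compound_mul a b : compound (a *m b) = compound b *m compound a.
Proof.
apply/matrixP => i j; rewrite compoundE trmx_mul.
have sB : skew_mx (b *m bivec i *m b^T).
  by have := skew_mx_congr b^T (skew_bivec i); rewrite trmxK.
have -> : a *m b *m bivec i *m (b^T *m a^T)
    = \sum_k compound b i k *: (a *m bivec k *m a^T).
  have -> : a *m b *m bivec i *m (b^T *m a^T) = a *m (b *m bivec i *m b^T) *m a^T.
    by rewrite !mulmxA.
  rewrite {1}(skew_sum_bivec sB).
  rewrite mulmx_sumr mulmx_suml; apply: eq_bigr => k _.
  by rewrite -scalemxAr -scalemxAl compoundE.
by rewrite summxE mxE; apply: eq_bigr => k _; rewrite mxE compoundE -?compoundE.
Qed.

Lemma compound1 : compound 1%:M = 1%:M.
Proof. by apply/matrixP => i j; rewrite compoundE trmx1 mul1mx mulmx1 bivecE mxE. Qed.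

Lemma compound_diag (d : 'rV[F]_n) :
  compound (diag_mx d) = diag_mx (\row_i (d 0 (tix i).1 * d 0 (tix i).2)).
Proof.
apply/matrixP => i j; rewrite compoundE tr_diag_mx mul_mx_diag mul_diag_mx mxE.
rewrite mxE bivecE !mxE; case: eqP => [->|_]; last by rewrite mulr0 mul0r mulr0n.
by rewrite mulr1 mulr1n.
Qed.

(** Defined for all matrices, so that it is polynomial in [a]: limits along curves are available,
    and a singular diagonal [a] can set a row of variables to zero. *)
Definition rho a p : sym_tangent F n := lin_subst (compound a) p.

HB.instance Definition _ a := GRing.RMorphism.copy (rho a) (rho a).
HB.instance Definition _ a := GRing.Linear.copy (rho a) (rho a).

Lemma rho_mul a b p : rho a (rho b p) = rho (a *m b) p.
Proof. by rewrite /rho lin_subst_comp compound_mul. Qed.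

Lemma rho1 p : rho 1%:M p = p.
Proof. by rewrite /rho compound1 lin_subst1. Qed.

Lemma rho_homog a d p : p \is d.-homog -> rho a p \is d.-homog.
Proof. exact: lin_subst_homog. Qed.

Lemma rho_curve g h p :
  exists Q : {poly sym_tangent F n}, forall s : F, rho (g + s *: h) p = Q.[s%:A].
Proof.
pose e x y : {poly F} := (g x y)%:P + (h x y) *: 'X.
apply: (lin_subst_curve (q := \matrix_(i, j)
  (e (tix j).1 (tix i).1 * e (tix j).2 (tix i).2
   - e (tix j).1 (tix i).2 * e (tix j).2 (tix i).1))) => s i j.
by rewrite !mxE !hornerE mulrC [in LHS](mulrC s); ring.
Qed.

Definition ev p M : F := p.@[fun i => M (tix i).1 (tix i).2].

Lemma evB p q M : ev (p - q) M = ev p M - ev q M. Proof. exact: mevalB. Qed.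
Lemma evM p q M : ev (p * q) M = ev p M * ev q M. Proof. exact: mevalM. Qed.
Lemma evZ c p M : ev (c *: p) M = c * ev p M. Proof. exact: mevalZ. Qed.

Lemma ev_rho a p M : skew_mx M -> ev (rho a p) M = ev p (a^T *m M *m a).
Proof.
move=> sM; rewrite /ev /rho meval_lin_subst; apply: meval_eq => i.
rewrite {2}(skew_sum_bivec sM) mulmx_sumr mulmx_suml summxE; apply: eq_bigr => j _.
rewrite -scalemxAr -scalemxAl [RHS]mxE mulrC; congr (_ * _).
by rewrite mulmxBr mulmxBl [RHS]mxE [X in _ = _ + X]mxE !congr_deltaE !mxE; ring.
Qed.

Lemma ev_inj p q : (forall M, skew_mx M -> ev p M = ev q M) -> p = q.
Proof.
move=> pq; apply/eqP; rewrite -subr_eq0; apply/eqP/meval_eq0 => v.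
pose M := \sum_i v i *: bivec i.
have sM : skew_mx M.
  by rewrite /skew_mx linear_sum -sumrN; apply: eq_bigr => i _;
    rewrite linearZ /= skew_bivec scalerN.
have vE i : v i = M (tix i).1 (tix i).2.
  rewrite summxE (bigD1 i) //= big1 => [|j /negbTE ji]; rewrite mxE bivecE ?ji ?mulr0 //.
  by rewrite eqxx mulr1 addr0.
have := evB p q M; rewrite pq // subrr /ev => <-; exact: meval_eq.
Qed.

Lemma ev_curve p g h :
  exists Q : {poly F}, forall s, ev p (g + s *: h) = Q.[s].
Proof.
apply: (meval_curve (q := fun i => (g (tix i).1 (tix i).2)%:P
  + h (tix i).1 (tix i).2 *: 'X)) => s i.
by rewrite !mxE !hornerE mulrC.
Qed.

End Bivectors.

(** The compound of a conjugate transpose is the conjugate transpose of the compound, so the adjoint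
    of an operator [rho a] is again of this form. *)
Lemma apolar_rho (F : numClosedFieldType) (n : nat) (a : 'M[F]_n) p q :
  apolar (rho a p) q = apolar p (rho (map_mx Num.conj a^T) q).
Proof.
rewrite /rho apolar_lin_subst.
suff -> : compound (map_mx Num.conj a^T) = map_mx Num.conj (compound a)^T by [].
by apply/matrixP => i j; rewrite !mxE rmorphB !rmorphM /= [in X in _ = _ - X]mulrC.
Qed.

Lemma skew_std_skew (F : numFieldType) (n : nat) : skew_mx (std_skew F n).
Proof. by apply/matrixP => i j; rewrite !mxE opprB. Qed.

(** * Pfaffian monomials and uniqueness of highest weight vectors *)

Section HighestWeightVectors.
Variables (F : numFieldType) (n : nat).
Notation N := (tangent_dim n).
Notation t := n./2.
Notation J := (std_skew F n).
Implicit Types (p q f g : sym_tangent F n) (d : 'rV[F]_n) (e : 'I_t -> nat).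

Definition generic_skew : 'M[sym_tangent F n]_n :=
  \matrix_(x, y) \sum_i (bivec F i x y) *: 'X_i.

Definition pf_poly (l : 'I_t) : sym_tangent F n := lead_pf l generic_skew.

Lemma ev_pf_poly l (M : 'M[F]_n) : skew_mx M -> ev (pf_poly l) M = lead_pf l M.
Proof.
move=> sM; rewrite /ev /pf_poly -lead_pf_map; congr lead_pf.
apply/matrixP => x y; rewrite [in RHS](skew_sum_bivec sM) summxE !mxE raddf_sum /=.
by apply: eq_bigr => i _; rewrite mevalZ mevalXU [RHS]mxE mulrC.
Qed.

Lemma pf_poly_homog l : pf_poly l \is l.+1.-homog.
Proof.
rewrite /pf_poly /lead_pf /pfaffian; apply: rpred_sum => s _.
have -> : ((-1) ^+ s : sym_tangent F n) = ((-1) ^+ s)%:MP.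
  by case: (odd_perm s); rewrite ?expr1 ?expr0 ?mpolyCN mpolyC1.
rewrite mul_mpolyC; apply: dhomogZ.
rewrite -[l.+1 in X in X.-homog]card_ord -sum1_card.
elim/big_rec2: _ => [|i y1 y2 _ hy]; first exact: dhomog1.
apply: dhomogM => //; rewrite !mxE; apply: rpred_sum => j _; apply: dhomogZ.
by rewrite dhomogX /= mdeg1.
Qed.

Definition pf_mon e : sym_tangent F n := \prod_l pf_poly l ^+ e l.

Lemma ev_pf_mon e (M : 'M[F]_n) : skew_mx M ->
  ev (pf_mon e) M = \prod_l lead_pf l M ^+ e l.
Proof.
move=> sM; rewrite /ev rmorph_prod /=; apply: eq_bigr => l _.
by rewrite rmorphXn /=; congr (_ ^+ _); apply: ev_pf_poly.
Qed.

Lemma ev_pf_mon_std e : ev (pf_mon e) J != 0.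
Proof.
rewrite ev_pf_mon ?prodf_seq_neq0; last exact: skew_std_skew.
by apply/allP => l _ /=; rewrite expf_neq0 ?lead_pf_std_neq0.
Qed.

Lemma pf_mon_neq0 e : pf_mon e != 0.
Proof. by apply/eqP => E; have := ev_pf_mon_std e; rewrite E /ev meval0 eqxx. Qed.

Lemma pf_mon_homog e : pf_mon e \is (\sum_(l < t) l.+1 * e l)%N.-homog.
Proof.
rewrite /pf_mon; elim/big_rec2: _ => [|l y1 y2 _ hy]; first exact: dhomog1.
by apply: dhomogM => //; apply: dhomogMn; apply: pf_poly_homog.
Qed.

Lemma rho_pf_poly_diag d l : rho (diag_mx d) (pf_poly l)
  = (\prod_(x < n | (x < l.+1.*2)%N) d 0 x) *: pf_poly l.
Proof.
apply: ev_inj => M sM; rewrite ev_rho // evZ !ev_pf_poly //; last exact: skew_mx_congr.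
by rewrite tr_diag_mx lead_pf_congr_diag.
Qed.

Lemma rho_pf_mon_diag d e : rho (diag_mx d) (pf_mon e)
  = (\prod_x d 0 x ^+ (\sum_(l < t | (x < l.+1.*2)%N) e l)) *: pf_mon e.
Proof.
rewrite /pf_mon rmorph_prod /=.
under eq_bigr => l _ do rewrite rmorphXn /= rho_pf_poly_diag exprZn.
rewrite scaler_prod; congr (_ *: _).
under [RHS]eq_bigr => x _ do rewrite -prodrXr big_mkcond /=.
rewrite exchange_big /=; apply: eq_bigr => l _.
by rewrite -prodrXl big_mkcond.
Qed.

Definition unip_inv p : Prop :=
  forall (i j : 'I_n) z, (i < j)%N -> rho (elem_mx i j z) p = p.

Definition torus_eigen p : Prop :=
  forall d, (forall x, d 0 x != 0) -> exists c, rho (diag_mx d) p = c *: p.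

Lemma unip_inv_pf_mon e : unip_inv (pf_mon e).
Proof.
move=> i j z ij; rewrite rmorph_prod /=; apply: eq_bigr => l _; rewrite rmorphXn /=.
congr (_ ^+ _); apply: ev_inj => M sM.
rewrite ev_rho // !ev_pf_poly //; last exact: skew_mx_congr.
apply: lead_pf_congr_unit => [x y yx|x]; rewrite !mxE.
  have -> : (x == y) = false by apply/eqP => xy; move: yx; rewrite xy ltnn.
  have -> : (x == i) && (y == j) = false; last by rewrite mulr0 addr0.
  by apply/negP => /andP[/eqP xi /eqP yj]; move: yx; rewrite xi yj; lia.
rewrite eqxx; have -> : (x == i) && (x == j) = false; last by rewrite mulr0 addr0.
by apply/negP => /andP[/eqP -> /eqP ij']; move: ij; rewrite ij' ltnn.
Qed.

(* The group of upper triangular matrices has a dense orbit, through J.       *)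
Lemma unip_inv_eq0 p : unip_inv p -> torus_eigen p -> ev p J = 0 -> p = 0.
Proof.
move=> up tp pJ; apply: ev_inj => M; rewrite {2}/ev meval0.
apply: (skew_density_ind (P := fun M => ev p M = 0)) => {}M.
- by move=> i j z sM ij; rewrite -ev_rho // up.
- move=> i j sM ij H; have [Q HQ] := ev_curve p M (delta_mx i j - delta_mx j i).
  have Q0 : Q = 0 by apply: poly_eq0 => s s0; rewrite -HQ H.
  by have := HQ 0; rewrite scale0r addr0 Q0 horner0.
- move=> M0; have := @ev_rho F n (diag_mx M) p J (skew_std_skew F n).
  have [c ->] := tp M M0; rewrite tr_diag_mx => <-.
  by rewrite evZ pJ mulr0.
Qed.

(** The difference of the two sides is a torus eigenvector fixed by the unipotent matrices and
    vanishing at [J], hence zero by density of the orbit of [J]. *)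
Lemma unip_inv_unique f g : unip_inv f -> unip_inv g ->
    (forall d, (forall x, d 0 x != 0) -> exists c,
       rho (diag_mx d) f = c *: f /\ rho (diag_mx d) g = c *: g) ->
  ev g J *: f = ev f J *: g.
Proof.
move=> uf ug tfg; apply/eqP; rewrite -subr_eq0; apply/eqP/unip_inv_eq0.
- by move=> i j z ij; rewrite linearB !linearZ /= uf // ug.
- move=> d d0; have [c [cf cg]] := tfg d d0; exists c.
  rewrite [rho _ _]linearB [X in X - _]linearZ [X in _ - X]linearZ /= cf cg.
  by rewrite scalerBr !scalerA ![_ * c]mulrC.
- by rewrite evB !evZ mulrC subrr.
Qed.

Definition row_count (x : 'I_n) (i : 'I_N) : nat :=
  ((x == (tix i).1) + (x == (tix i).2))%N.

Lemma mcoeff_rho_diag d p m :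
  (rho (diag_mx d) p)@_m = (\prod_x d 0 x ^+ lin_meas (row_count x) m) * p@_m.
Proof.
rewrite /rho compound_diag mcoeff_lin_subst_diag; congr (_ * _).
under [RHS]eq_bigr => x _ do rewrite /lin_meas -prodrXr.
rewrite exchange_big /=; apply: eq_bigr => i _.
under [RHS]eq_bigr => x _ do rewrite mulnC exprM.
rewrite prodrXl; congr (_ ^+ _); rewrite mxE /row_count.
under [RHS]eq_bigr => x _ do rewrite exprD.
rewrite big_split /=; congr (_ * _).
  by rewrite (bigD1 (tix i).1) //= eqxx big1 ?mulr1 // => x /negbTE ->.
by rewrite (bigD1 (tix i).2) //= eqxx big1 ?mulr1 // => x /negbTE ->.
Qed.

(** The torus scales each coefficient by a monomial in the entries of [d]; the eigenvalue is read
    off at the leading monomial. *)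
Lemma torus_eigen_weight p : torus_eigen p -> p != 0 ->
  exists w : 'I_n -> nat, forall d, (forall x, d 0 x != 0) ->
    rho (diag_mx d) p = (\prod_x d 0 x ^+ w x) *: p.
Proof.
move=> tp p0; pose m := mlead p; exists (fun x => lin_meas (row_count x) m) => d d0.
have [c cE] := tp d d0; rewrite cE; congr (_ *: _).
have := congr1 (mcoeff m) cE; rewrite mcoeff_rho_diag mcoeffZ => /mulIf -> //.
by rewrite mleadc_eq0.
Qed.

Lemma ev_weight_std p (w : 'I_n -> nat) d : (forall x, d 0 x != 0) ->
    rho (diag_mx d) p = (\prod_x d 0 x ^+ w x) *: p -> ev p J != 0 ->
    diag_mx d *m J *m diag_mx d = J -> \prod_x d 0 x ^+ w x = 1.
Proof.
move=> d0 wp pJ dJ; have := @ev_rho F n (diag_mx d) p J (skew_std_skew F n).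
rewrite wp tr_diag_mx dJ evZ => /(canRL (mulfK pJ)) ->; exact: divff.
Qed.

Lemma stdE (i j : 'I_n) : J i j =
  ((i.+1 == j) && ~~ odd i)%:R - ((j.+1 == i) && ~~ odd j)%:R.
Proof. by rewrite mxE. Qed.

(** The weight of [p] must be trivial on the diagonal matrices that fix [J] under congruence. Test
    elements are 2 and 1/2 on a pair of indices, and 2 on the unpaired last index when [n] is
    odd. *)
Lemma weight_pair p (w : 'I_n -> nat) : ev p J != 0 ->
    (forall d, (forall x, d 0 x != 0) ->
       rho (diag_mx d) p = (\prod_x d 0 x ^+ w x) *: p) ->
  (forall x y : 'I_n, x.+1 = y :> nat -> ~~ odd x -> w x = w y) /\
  (forall x : 'I_n, x.+1 = n -> ~~ odd x -> w x = 0%N).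
Proof.
move=> pJ wp.
have inj2 a b : 2%:R ^+ a = 2%:R ^+ b :> F -> a = b.
  by move/eqP; rewrite -!natrX eqr_nat eqn_exp2l // => /eqP.
split=> [x y xy ox|x xn ox].
  pose d : 'rV[F]_n := \row_a (if a == x then 2%:R else if a == y then 2%:R^-1 else 1).
  have ne : (y == x) = false by apply/eqP => E; move: xy; rewrite E; lia.
  have d0 a : d 0 a != 0.
    by rewrite mxE; case: ifP => _; [|case: ifP => _]; rewrite ?invr_eq0 ?pnatr_eq0 ?oner_eq0.
  have dJ : diag_mx d *m J *m diag_mx d = J.
    apply/matrixP => i j; rewrite mul_mx_diag mul_diag_mx [LHS]mxE mxE stdE.
    have [E|] := boolP (((i.+1 == j) && ~~ odd i) || ((j.+1 == i) && ~~ odd j)); last first.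
      by rewrite negb_or => /andP[/negbTE -> /negbTE ->]; rewrite subrr mulr0 mul0r.
    rewrite mulrAC; suff -> : d 0 i * d 0 j = 1 by rewrite mul1r.
    have [ix jy] : (j == y) = (i == x) /\ (j == x) = (i == y).
      by rewrite -!val_eqE /=; split; apply/eqP/eqP => H; move: E; rewrite ?H; lia.
    rewrite !mxE ix jy; case: eqP => [->|_].
      by rewrite eq_sym ne divff ?pnatr_eq0.
    by case: eqP => _; rewrite ?mulVf ?mulr1 ?pnatr_eq0.
  have := ev_weight_std d0 (wp d d0) pJ dJ.
  rewrite (bigD1 x) //= (bigD1 y) ?ne //= big1 ?mulr1 => [|a /andP[/negbTE ax /negbTE ay]].
    rewrite !mxE !eqxx ne exprVn => H; apply: inj2.
    by rewrite -[LHS](@divfK _ (2%:R ^+ w y)) ?H ?mul1r // expf_neq0 ?pnatr_eq0.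
  by rewrite mxE ax ay expr1n.
pose d : 'rV[F]_n := \row_a (if a == x then 2%:R else 1).
have d0 a : d 0 a != 0 by rewrite mxE; case: ifP => _; rewrite ?pnatr_eq0 ?oner_eq0.
have dJ : diag_mx d *m J *m diag_mx d = J.
  apply/matrixP => i j; rewrite mul_mx_diag mul_diag_mx [LHS]mxE mxE stdE !mxE.
  have [->|_] := eqVneq i x.
    have -> : (x.+1 == j) = false by have := ltn_ord j; lia.
    have -> : (j.+1 == x) && ~~ odd j = false by lia.
    by rewrite subrr mulr0 mul0r.
  have [->|_] := eqVneq j x; last by rewrite mul1r mulr1.
  have -> : (x.+1 == i) = false by have := ltn_ord i; lia.
  have -> : (i.+1 == x) && ~~ odd i = false by lia.
  by rewrite subrr mulr0 mul0r.
have := ev_weight_std d0 (wp d d0) pJ dJ.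
rewrite (bigD1 x) //= big1 ?mulr1 => [|a /negbTE ax]; last by rewrite mxE ax expr1n.
by rewrite mxE eqxx => H; apply: inj2; rewrite H expr0.
Qed.

End HighestWeightVectors.

(** * Classification and existence of highest weight vectors *)

Section HighestWeightClassification.
Variables (F : numFieldType) (n : nat).
Notation N := (tangent_dim n).
Notation t := n./2.
Notation J := (std_skew F n).
Implicit Types (p q f g : sym_tangent F n) (d : 'rV[F]_n) (e : 'I_t -> nat).

(** Subtraction of natural numbers truncates, so one sum collects the increases of [v] and the other
    its decreases; no monotonicity of [v] is assumed. *)
Lemma telescope_truncated (v : nat -> nat) (m k : nat) : v (k + m)%N = 0%N ->
  (v k + \sum_(k <= l < k + m) (v l.+1 - v l) = \sum_(k <= l < k + m) (v l - v l.+1))%N.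
Proof.
elim: m k => [|m IHm] k; first by rewrite addn0 !big_geq // => ->.
rewrite -addSnnS => vt; rewrite !(big_ltn (m := k)) -?{1}IHm //; lia.
Qed.

(** For the last [l], row 2l of [J] is scaled to zero. Otherwise the indices 2l+1 and 2l+3 are
    exchanged, so that 2l is paired with 2l+3: this pair straddles the boundary of the block of size
    2l+2, and of no other leading block of even size. *)
Lemma exists_lead_pf_eq0 (l : 'I_t) : exists M : 'M[F]_n,
  [/\ skew_mx M, lead_pf l M = 0 & forall k, k != l -> lead_pf k M != 0].
Proof.
have lt := ltn_ord l; case: (ltnP l.+1 t) => lt'; last first.
  pose d : 'rV[F]_n := \row_x (if x == l.*2 :> nat then 0 else 1).
  have ln : (l.*2 < n)%N by lia.
  exists (diag_mx d *m J *m diag_mx d); split.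
  - by rewrite -{1}[diag_mx d]tr_diag_mx; apply: skew_mx_congr; apply: skew_std_skew.
  - rewrite lead_pf_congr_diag (bigD1 (Ordinal ln)) /=; last by lia.
    by rewrite mxE /= eqxx !mul0r.
  move=> k kl; have kl' : (k < l)%N.
    by move: kl; rewrite -val_eqE /= => kl; have := ltn_ord k; lia.
  rewrite lead_pf_congr_diag big1 ?mul1r ?lead_pf_std_neq0 // => x xk.
  by rewrite mxE; case: eqP => // E; move: xk; rewrite E; lia.
have an : (l.*2.+1 < n)%N by lia.
have bn : (l.*2.+3 < n)%N by lia.
pose s := tperm (Ordinal an) (Ordinal bn).
have sM : skew_mx (\matrix_(x, y) J (s x) (s y)).
  by apply/matrixP => x y; rewrite !mxE opprB.
exists (\matrix_(x, y) J (s x) (s y)); split=> //.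
  have cn : (l.*2 < n)%N by lia.
  apply: (@lead_pf_row0 _ _ _ _ (Ordinal cn)) => [|y yl]; first by rewrite /=; lia.
  suff M0 : J (s (Ordinal cn)) (s y) = 0.
    by split; [|rewrite (skew_mxE _ _ sM)]; rewrite mxE M0 ?oppr0.
  have -> : s (Ordinal cn) = Ordinal cn.
    by rewrite tpermD //; apply/eqP => /(congr1 val) /=; lia.
  rewrite stdE /=; have -> : ((s y).+1 == l.*2) && ~~ odd (s y) = false by lia.
  rewrite subr0; suff -> : (l.*2.+1 == s y) = false by [].
  apply/eqP => sy; have : s y = Ordinal an by apply: val_inj; rewrite /= -sy.
  move/(canRL (tpermK _ _)); rewrite tpermL => yE; move: yl; rewrite yE /=; lia.
move=> k kl; apply: lead_pf_perm_neq0 => x xk; rewrite tpermV /s.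
have kl' : (k < l)%N \/ (l < k)%N.
  by apply/orP; rewrite -neq_ltn.
case: tpermP => [E|E|//]; move: xk; rewrite E /=; lia.
Qed.

Lemma lead_pf_mon_neq0 e (l : 'I_t) (M : 'M[F]_n) : e l = 0%N ->
  (forall k, k != l -> lead_pf k M != 0) -> \prod_k lead_pf k M ^+ e k != 0.
Proof.
move=> el M0; rewrite prodf_seq_neq0; apply/allP => k _ /=.
by have [->|/M0 kM] := eqVneq k l; rewrite ?el ?expr0 ?oner_neq0 // expf_neq0.
Qed.

Lemma pf_mon_eq1 e : (forall l, e l = 0%N) -> pf_mon F e = 1.
Proof. by move=> e0; apply: big1 => l _; rewrite e0 expr0. Qed.

(* Quotients of consecutive torus weights give f p^b = c p^a with a, b of     *)
(* disjoint supports; a point where exactly one Pfaffian vanishes shows b = 0. *)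
Lemma highest_weight_pf_mon f : unip_inv f -> torus_eigen f -> f != 0 ->
  exists e c, c != 0 /\ f = c *: pf_mon F e.
Proof.
move=> uf tf f0; have [w wf] := torus_eigen_weight tf f0.
have fJ : ev f J != 0.
  by apply: contraNneq f0 => fJ; apply/eqP/unip_inv_eq0.
have [wpair wlast] := weight_pair fJ wf.
(* [v k] is the common weight of the two indices 2k and 2k+1; the value 0 from [t] on also accounts
   for the unpaired last index. *)
pose v k := if (k < t)%N then oapp w 0%N (insub k.*2) else 0%N.
have wv (x : 'I_n) : w x = v x./2.
  rewrite /v; case: ifP => xt; last by apply: wlast; have := ltn_ord x; lia.
  case: insubP => [y _ yE|]; last by rewrite -leqNgt; lia.
  have yE' : y = x./2.*2 :> nat := yE.
  rewrite /=; case: (boolP (odd x)) => ox; first by rewrite (wpair y x) //; lia.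
  by congr w; apply: val_inj; rewrite /= yE'; lia.
have vt k : (t <= k)%N -> v k = 0%N by rewrite /v ltnNge => ->.
pose a (l : 'I_t) := (v l - v l.+1)%N; pose b (l : 'I_t) := (v l.+1 - v l)%N.
have tailE (h : nat -> nat) (x : 'I_n) :
    (\sum_(l < t | (x < l.+1.*2)%N) h l = \sum_(x./2 <= l < x./2 + (t - x./2)) h l)%N.
  have -> : (x./2 + (t - x./2) = t)%N by have := ltn_ord x; lia.
  rewrite big_mkcond -(big_mkord xpredT (fun l => if (x < l.+1.*2)%N then h l else 0%N)).
  rewrite (big_cat_nat (n := x./2)) //=; last by have := ltn_ord x; lia.
  rewrite big_nat big1 ?add0n => [|i ix]; last by have -> : (x < i.+1.*2)%N = false by lia.
  by apply: eq_big_nat => i ix; have -> : (x < i.+1.*2)%N by lia.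
have E : ev (pf_mon F a) J *: (f * pf_mon F b) = ev (f * pf_mon F b) J *: pf_mon F a.
  apply: unip_inv_unique.
  - by move=> i j z ij; rewrite rmorphM /= uf // unip_inv_pf_mon.
  - exact: unip_inv_pf_mon.
  move=> d d0; eexists; split; last exact: rho_pf_mon_diag.
  rewrite rmorphM /= wf // rho_pf_mon_diag -scalerAl -scalerAr scalerA.
  congr (_ *: _); rewrite -big_split; apply: eq_bigr => x _ /=; rewrite -exprD wv.
  rewrite /a /b (tailE (fun l => v l - v l.+1)%N) (tailE (fun l => v l.+1 - v l)%N).
  by rewrite telescope_truncated // vt //; lia.
have b0 l : b l = 0%N.
  apply/eqP/negPn/negP => bl.
  have al : a l = 0%N by move: bl; rewrite /a /b; lia.
  have [M [sM Ml Mk]] := exists_lead_pf_eq0 l.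
  have := congr1 (fun p => ev p M) E; rewrite !evZ evM !(ev_pf_mon _ sM).
  rewrite [X in _ * (_ * X)](bigD1 l) //= Ml expr0n (negbTE bl) mul0r !mulr0 => /eqP.
  rewrite eq_sym mulf_eq0 (negbTE (lead_pf_mon_neq0 al Mk)) orbF evM mulf_eq0.
  by rewrite (negbTE fJ) (negbTE (ev_pf_mon_std _ _)).
exists a, (ev f J / ev (pf_mon F a) J); split.
  by rewrite mulf_neq0 ?invr_eq0 ?ev_pf_mon_std.
apply: (scalerI (ev_pf_mon_std F a)); move: E; rewrite (pf_mon_eq1 b0) mulr1 => ->.
by rewrite scalerA mulrCA divff ?mulr1 ?ev_pf_mon_std.
Qed.

Lemma mmeasure_leP (mf : measure N) p h :
  reflect (forall m, m \in msupp p -> (mf m < h)%N) (mmeasure mf p <= h)%N.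
Proof.
apply: (iffP idP) => [ph m mp|H]; first by apply: leq_trans (mmeasure_mnm_lt mf mp) ph.
by rewrite mmeasureE big_seq; elim/big_ind: _ => // a b ha hb; rewrite geq_max ha.
Qed.

Lemma mmeasureM_le (mf : measure N) p q a b :
  (mmeasure mf p <= a)%N -> (mmeasure mf q <= b.+1)%N -> (mmeasure mf (p * q) <= a + b)%N.
Proof.
move=> /mmeasure_leP pa /mmeasure_leP qb; apply/mmeasure_leP => m.
move=> /msuppM_le /allpairsP[[m1 m2] /= [m1p m2q ->]].
by rewrite mfD; have := pa m1 m1p; have := qb m2 m2q; lia.
Qed.

(* Upper unitriangular matrices act by the identity plus terms of smaller     *)
(* height.                                                                    *)
Lemma height_unip (a : 'M[F]_n) p :
    (forall x y : 'I_n, (y < x)%N -> a x y = 0) -> (forall x, a x x = 1) -> p != 0 ->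
  (mmeasure (lin_meas (fun i : 'I_N => (tix i).1 + (tix i).2)%N) (rho a p - p)
    < mmeasure (lin_meas (fun i : 'I_N => (tix i).1 + (tix i).2)%N) p)%N.
Proof.
move=> aup a1 p0; set mf : measure N := lin_meas _.
(* [mmeasure] is one more than the largest height of a monomial, so [K A h] says that [A] has height
   at most [h] and that its increment under [rho a] has height below [h]. *)
pose K (A : sym_tangent F n) h := (mmeasure mf (rho a A - A) <= h)%N /\ (mmeasure mf A <= h.+1)%N.
have KM A B h k : K A h -> K B k -> K (A * B) (h + k)%N.
  move=> [A1 A2] [B1 B2]; split; last by rewrite -addSn; apply: mmeasureM_le.
  have -> : rho a (A * B) - A * B = (rho a A - A) * (rho a B - B)
      + ((rho a A - A) * B + (rho a B - B) * A) by rewrite rmorphM /=; ring.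
  apply: leq_trans (mmeasureD_le _ _ _) _; rewrite geq_max; apply/andP; split.
    by apply: mmeasureM_le => //; apply: leqW.
  apply: leq_trans (mmeasureD_le _ _ _) _; rewrite geq_max; apply/andP; split.
    exact: mmeasureM_le.
  by rewrite addnC; apply: mmeasureM_le.
have KX i : K 'X_i (mf U_(i)%MM).
  split; last by rewrite mmeasureX.
  have -> : rho a 'X_i - 'X_i = \sum_(j | compound a i j != (i == j)%:R)
      (compound a i j - (i == j)%:R) *: 'X_j :> sym_tangent F n.
    rewrite /rho lin_substX [RHS]big_mkcond /=.
    have -> : 'X_i = \sum_j (i == j)%:R *: 'X_j :> sym_tangent F n.
      rewrite (bigD1 i) //= eqxx scale1r big1 ?addr0 // => j /negbTE ji.
      by rewrite eq_sym ji scale0r.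
    rewrite -sumrB; apply: eq_bigr => j _; rewrite -scalerBl.
    by have [->|//] := eqVneq (compound a i j) (i == j)%:R; rewrite subrr scale0r.
  apply: (big_ind (fun q => mmeasure mf q <= mf U_(i)%MM)%N) => [|x y hx hy|j cj].
  - by rewrite mmeasure0.
  - by apply: leq_trans (mmeasureD_le _ _ _) _; rewrite geq_max hx.
  apply: leq_trans (mmeasureZ_le _ _ _) _; rewrite mmeasureX.
  rewrite /mf /= !lin_meas1; move: cj; rewrite mxE.
  have ti := tix_lt i; have tj := tix_lt j; apply: contraR; rewrite -leqNgt => ij.
  have [<-|ne] := eqVneq i j.
    by rewrite !a1 [a (tix i).2 (tix i).1]aup // mulr0 subr0 mulr1.
  have z1 : a (tix j).1 (tix i).2 * a (tix j).2 (tix i).1 = 0.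
    have [h|h] := ltnP (tix i).1 (tix j).2; first by rewrite [a (tix j).2 _]aup ?mulr0.
    by exfalso; lia.
  rewrite z1 subr0.
  have [h|h] := ltnP (tix i).1 (tix j).1; first by rewrite aup ?mul0r.
  have [h'|h'] := ltnP (tix i).2 (tix j).2; first by rewrite [a (tix j).2 _]aup ?mulr0.
  case/eqP: ne; apply: tix_inj; have E1 : (tix i).1 = (tix j).1 by apply: val_inj => /=; lia.
  have E2 : (tix i).2 = (tix j).2 by apply: val_inj => /=; lia.
  by move: E1 E2; case: (tix i) (tix j) => ? ? [? ?] /= -> ->.
have KXm m : K 'X_[m] (mf m).
  rewrite mpolyXE_id mfE; elim/big_rec2: _ => [|i h A _ KA].
    by split; rewrite ?rmorph1 ?subrr ?mmeasure0 // mmeasure1.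
  apply: (KM) => //; elim: (m i) => [|k IHk].
    by rewrite mul0n expr0; split; rewrite ?rmorph1 ?subrr ?mmeasure0 // mmeasure1.
  by rewrite exprS mulSn; apply: KM.
have pS : (mmeasure mf p > 0)%N by rewrite lt0n mmeasure_poly_eq0.
rewrite -(prednK pS) ltnS {1 2}[p]mpolyE linear_sum -sumrB big_seq.
apply: (big_ind (fun q => mmeasure mf q <= (mmeasure mf p).-1)%N) => [|x y hx hy|m mp].
- by rewrite mmeasure0.
- by apply: leq_trans (mmeasureD_le _ _ _) _; rewrite geq_max hx.
rewrite linearZ /= -scalerBr; apply: leq_trans (mmeasureZ_le _ _ _) _.
apply: leq_trans (KXm m).1 _; rewrite -ltnS prednK //; exact: mmeasure_mnm_lt.
Qed.

(** Singular matrices are included; submodules for the Levi part nevertheless satisfy this, see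
    [levi_submodule_rho_stable]. *)
Definition rho_stable (U : sym_tangent F n -> Prop) : Prop :=
  subspace U /\ forall a p, U p -> U (rho a p).

Lemma rho_stable_pihomog U (x : 'I_n) k p : rho_stable U -> U p ->
  U (pihomog (lin_meas (row_count x)) k p).
Proof.
move=> [sU aU]; apply: pihomog_mem => // s {}p s0 Up.
have := aU (diag_mx (\row_y (if y == x then s else 1))) p Up.
rewrite /rho compound_diag; congr (U (lin_subst (diag_mx _) p)).
apply/rowP => i; rewrite !mxE /row_count exprD eq_sym; congr (_ * _).
  by case: eqP => _; rewrite ?expr1 ?expr0.
by rewrite eq_sym; case: eqP => _; rewrite ?expr1 ?expr0.
Qed.

Lemma multihomog_torus_eigen p :
  (forall x : 'I_n, exists k, p \is k.-homog for (lin_meas (row_count x))) -> torus_eigen p.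
Proof.
move=> hp d d0; exists (\prod_x d 0 x ^+ lin_meas (row_count x) (mlead p)).
apply/mpolyP => m; rewrite mcoeff_rho_diag mcoeffZ.
have [mp|/memN_msupp_eq0 ->] := boolP (m \in msupp p); last by rewrite !mulr0.
have p0 : p != 0 by apply: contraTneq mp => ->; rewrite msupp0.
congr (_ * _); apply: eq_bigr => x _; have [k /dhomogP hk] := hp x.
by have -> := hk _ mp; have -> := hk _ (mlead_supp p0).
Qed.

(** Pass to a torus-homogeneous component [q]. If some elementary unipotent matrix moves it, the
    increment is a nonzero element of [U] of smaller height by [height_unip], so the descent ends at
    an invariant vector. *)
Lemma exists_highest_weight U p : rho_stable U -> U p -> p != 0 ->
  exists f, [/\ U f, f != 0, unip_inv f & torus_eigen f].
Proof.
move=> sU; set mf : measure N := lin_meas (fun i : 'I_N => (tix i).1 + (tix i).2)%N.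
have [k] := ubnP (mmeasure mf p); elim: k p => // k IHk p pk Up p0.
have [q [Uq q0 qp hq]] := exists_multihomog
  (mf := fun x : 'I_n => (lin_meas (row_count x) : measure N))
  (fun x h q Uq => rho_stable_pihomog x h sU Uq) Up p0.
have [uq|] := EM (unip_inv q).
  by exists q; split=> //; apply: multihomog_torus_eigen.
move=> /existsNP[i /existsNP[j /existsNP[z /not_implyP[ij nq]]]].
apply: (IHk (rho (elem_mx i j z) q - q)); last by rewrite subr_eq0; apply/eqP.
  apply: leq_trans (height_unip _ _ q0) _ => [x y yx|x|].
  - rewrite !mxE; have -> : (x == y) = false by apply/eqP => xy; move: yx; rewrite xy ltnn.
    have -> : (x == i) && (y == j) = false; last by rewrite mulr0 addr0.
    by apply/negP => /andP[/eqP xi /eqP yj]; move: yx; rewrite xi yj; lia.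
  - rewrite !mxE eqxx; have -> : (x == i) && (x == j) = false; last by rewrite mulr0 addr0.
    by apply/negP => /andP[/eqP -> /eqP ij']; move: ij; rewrite ij' ltnn.
  - apply: leq_trans (pk : (mmeasure mf p <= k)%N).
    by apply/mmeasure_leP => m /qp mp; exact: mmeasure_mnm_lt.
by apply: (subspaceB sU.1) => //; apply: sU.2.
Qed.

Lemma rho_stable_pf_mon U p : rho_stable U -> U p -> p != 0 ->
  exists e, U (pf_mon F e).
Proof.
move=> sU Up p0; have [f [Uf f0 uf tf]] := exists_highest_weight sU Up p0.
have [e [c [c0 fE]]] := highest_weight_pf_mon uf tf f0; exists e.
by rewrite -[pf_mon F e]scale1r -(mulVf c0) -scalerA -fE; apply: (subspaceZ sU.1).
Qed.

End HighestWeightClassification.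

(** * Modules generated by Pfaffian monomials *)

Section CyclicModules.
Variables (F : numClosedFieldType) (n : nat).
Notation t := n./2.
Implicit Types (p q : sym_tangent F n) (e : 'I_t -> nat) (U : sym_tangent F n -> Prop).

(** The span of the orbit, as the intersection of all stable subspaces containing the monomial: a
    membership proof serves as an induction principle for any stable property. *)
Definition cyclic_module e p : Prop :=
  forall U, rho_stable U -> U (pf_mon F e) -> U p.

Lemma cyclic_module_gen e : cyclic_module e (pf_mon F e).
Proof. by []. Qed.

Lemma rho_stable_cyclic e : rho_stable (cyclic_module e).
Proof.
split; first split.
- by move=> U sU _; apply: sU.1.1.
- by move=> a p q Wp Wq U sU Ue; apply: sU.1.2; [apply: Wp | apply: Wq].
- by move=> a p Wp U sU Ue; apply: sU.2; apply: Wp.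
Qed.

Lemma rho_stable_homog d : rho_stable (fun p => p \is d.-homog).
Proof.
split=> [|a p]; last exact: rho_homog.
by split=> [|a p q hp hq]; [exact: dhomog0 | apply: dhomogD => //; apply: dhomogZ].
Qed.

Lemma cyclic_module_homog e p : cyclic_module e p ->
  p \is (\sum_(l < t) l.+1 * e l)%N.-homog.
Proof.
move=> Wp; apply: (Wp (fun q => q \is _.-homog)); last exact: pf_mon_homog.
exact: rho_stable_homog.
Qed.

Lemma rho_stable_orthogonal U : rho_stable U -> rho_stable (orthogonal_to U).
Proof.
move=> [sU aU]; split; first split.
- by move=> v _; rewrite apolar0l.
- by move=> a p q op oq v Uv; rewrite apolarPl op // oq // mulr0 addr0.
- by move=> a p op v Uv; rewrite apolar_rho; apply: op; apply: aU.
Qed.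

(** Distinct exponents give distinct weights: at the largest index [l] where they differ, scaling
    row 2l by 2 acts with different eigenvalues, and this real diagonal operator is self-adjoint. *)
Lemma apolar_pf_mon e e' : ~ e =1 e' -> apolar (pf_mon F e) (pf_mon F e') = 0.
Proof.
move=> /existsNP[l0 /eqP ne0].
pose l := [arg max_(k > l0 | e k != e' k) (k : nat)].
have [ne lmax] : e l != e' l /\ forall k : 'I_t, (l < k)%N -> e k = e' k.
  rewrite /l; case: arg_maxnP => // k nk kmax; split=> // j kj.
  by apply/eqP; apply: contraTT kj => /kmax; rewrite -leqNgt.
have xn : (l.*2 < n)%N by have := ltn_ord l; lia.
pose x := Ordinal xn.
pose S e := (\sum_(k < t | (x < k.+1.*2)%N) e k)%N.
have Sne : S e != S e'.
  have xl : (x < l.+1.*2)%N by rewrite /=; lia.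
  rewrite /S (bigD1 l) //= [in X in _ != X](bigD1 l) //=.
  rewrite [X in (_ + X)%N == _](eq_bigr e') ?eqn_add2r //.
  move=> k /andP[xk kl]; apply: lmax; move: xk kl; rewrite -val_eqE /=; lia.
pose d : 'rV[F]_n := \row_y (if y == x then 2%:R else 1).
have chi e1 : rho (diag_mx d) (pf_mon F e1) = 2%:R ^+ S e1 *: pf_mon F e1.
  rewrite rho_pf_mon_diag (bigD1 x) //= [X in _ * X]big1 ?mulr1; first by rewrite mxE eqxx.
  by move=> y yx; rewrite mxE (negbTE yx) expr1n.
have dstar : map_mx Num.conj (diag_mx d)^T = diag_mx d.
  rewrite tr_diag_mx; apply/matrixP => i j; rewrite !mxE rmorphMn /=.
  by case: ifP => _; rewrite ?conjC1 ?conjC_nat.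
have := apolar_rho (diag_mx d) (pf_mon F e) (pf_mon F e').
rewrite dstar !chi apolarZl apolarZr rmorphXn /= conjC_nat => /eqP.
rewrite -subr_eq0 -mulrBl mulf_eq0 subr_eq0 -!natrX eqr_nat eqn_exp2l //.
by rewrite (negbTE Sne) => /eqP.
Qed.

Lemma rho_stable_curve U (g h : 'M[F]_n) p : subspace U ->
  (forall s : F, s != 0 -> U (rho (g + s *: h) p)) -> U (rho g p).
Proof.
move=> sU Us; have [Q HQ] := rho_curve g h p.
have -> : rho g p = Q.[(0 : F)%:A] by rewrite -HQ scale0r addr0.
by apply: (subspace_poly_horner sU) => s s0; rewrite -HQ; apply: Us.
Qed.

Lemma elem_mx_conj (i j : 'I_n) (z : F) :
  map_mx Num.conj (elem_mx i j z)^T = elem_mx j i z^*.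
Proof.
rewrite tr_elem_mx; apply/matrixP => x y; rewrite !mxE rmorphD rmorphM /= !conjC_nat.
by [].
Qed.

(** Factor a generic [g] as lower unitriangular, diagonal, upper unitriangular. The upper factor
    fixes the first monomial, the adjoint of the lower factor is upper and fixes the second, and the
    diagonal factor only rescales. *)
Lemma apolar_rho_pf_mon e e' (g : 'M[F]_n) : ~ e =1 e' ->
  apolar (rho g (pf_mon F e)) (pf_mon F e') = 0.
Proof.
move=> ne; move: g.
apply: (mx_density_ind (P := fun g => apolar (rho g (pf_mon F e)) (pf_mon F e') = 0)).
- by move=> g i j z ij; rewrite -rho_mul unip_inv_pf_mon.
- move=> g i j z ij; rewrite -rho_mul apolar_rho elem_mx_conj.
  by rewrite unip_inv_pf_mon.
- move=> g k H; apply: (rho_stable_curve (U := fun p => apolar p (pf_mon F e') = 0)).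
    exact: apolar_subspacel.
  exact: H.
- by move=> d _; rewrite rho_pf_mon_diag apolarZl apolar_pf_mon // mulr0.
Qed.

Lemma cyclic_module_orthogonal e e' p q : ~ e =1 e' ->
  cyclic_module e p -> cyclic_module e' q -> apolar p q = 0.
Proof.
move=> ne Wp Wq.
apply: (Wp (orthogonal_to (cyclic_module e'))) => //.
  by apply: rho_stable_orthogonal; apply: rho_stable_cyclic.
move=> {Wq}q Wq.
(* Quantifying over all [g] makes the property stable in [q], since moving [rho a] to the other side
   only changes [g]. *)
suff: forall g, apolar (rho g (pf_mon F e)) q = 0 by move/(_ 1%:M); rewrite rho1.
apply: (Wq (fun q => forall g, apolar (rho g (pf_mon F e)) q = 0)); last first.
  by move=> g; apply: apolar_rho_pf_mon.
split; first split.
- by move=> g; rewrite apolar0r.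
- by move=> a r s hr hs g; rewrite apolarDr apolarZr hr hs mulr0 addr0.
move=> a r hr g; rewrite apolarC apolar_rho -apolarC rho_mul; exact: hr.
Qed.

(** A nonzero stable subspace of the module contains some Pfaffian monomial; were its exponent
    different from [e], it would be orthogonal to itself. So it is the generator. *)
Lemma cyclic_module_irreducible e U p : rho_stable U ->
  (forall q, U q -> cyclic_module e q) -> U p -> p != 0 ->
  forall q, cyclic_module e q -> U q.
Proof.
move=> sU UW Up p0 q Wq; apply: Wq => //.
have [e' Ue'] := rho_stable_pf_mon sU Up p0.
have [ee'|ne] := EM (e =1 e').
  by rewrite (_ : pf_mon F e = pf_mon F e') //; apply: eq_bigr => l _; rewrite ee'.
have := cyclic_module_orthogonal ne (UW _ Ue') (@cyclic_module_gen e').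
by move/apolar_eq0/eqP; rewrite (negbTE (pf_mon_neq0 _ _)).
Qed.

Section Decomposition.
Variables (I : finType) (r : nat) (E : I -> 'I_t -> nat).
Hypothesis Er : forall i, (\sum_(l < t) l.+1 * E i l)%N = r.

Lemma sum_cyclic_module : 
    (forall e, (\sum_(l < t) l.+1 * e l)%N = r -> exists i, E i =1 e) ->
  forall p, p \is r.-homog -> exists x : {ffun I -> sym_tangent F n},
    (forall i, cyclic_module (E i) (x i)) /\ p = \sum_i x i.
Proof.
move=> Ee p hp; pose Z q := exists x : {ffun I -> sym_tangent F n},
  (forall i, cyclic_module (E i) (x i)) /\ q = \sum_i x i.
have sW i := rho_stable_cyclic (E i).
have sZ : rho_stable Z.
  split; first split.
  - exists [ffun=> 0]; split=> [i|]; first by rewrite ffunE; apply: (sW i).1.1.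
    by rewrite big1 // => i _; rewrite ffunE.
  - move=> a _ _ [x [Wx ->]] [y [Wy ->]]; exists [ffun i => a *: x i + y i].
    split=> [i|]; first by rewrite ffunE; apply: (sW i).1.2.
    by rewrite scaler_sumr -big_split; apply: eq_bigr => i _; rewrite ffunE.
  - move=> a _ [x [Wx ->]]; exists [ffun i => rho a (x i)].
    split=> [i|]; first by rewrite ffunE; apply: (sW i).2.
    by rewrite [rho _ _]linear_sum; apply: eq_bigr => i _; rewrite ffunE.
have hZ q : Z q -> q \is r.-homog.
  move=> [x [Wx ->]]; apply: rpred_sum => i _; rewrite -(Er i).
  exact: cyclic_module_homog.
have [u [Zu ou]] := orthogonal_proj sZ.1 hZ p.
suff /eqP : p - u = 0 by rewrite subr_eq0 => /eqP ->.
apply/eqP/negPn/negP => nz.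
(* The complement of the sum is stable. If nonzero, it contains a Pfaffian monomial of degree [r],
   which also lies in the sum and is thus orthogonal to itself. *)
pose V q := q \is r.-homog /\ orthogonal_to Z q.
have sV : rho_stable V.
  have sO := rho_stable_orthogonal sZ; have sH := rho_stable_homog r.
  split; first split.
  - by split; [exact: sH.1.1 | exact: sO.1.1].
  - by move=> a q s [? ?] [? ?]; split; [exact: sH.1.2 | exact: sO.1.2].
  - by move=> a q [? ?]; split; [exact: sH.2 | exact: sO.2].
have Vpu : V (p - u) by split=> //; apply: rpredB => //; exact: hZ.
have [e [he oe]] := rho_stable_pf_mon sV Vpu nz.
have [i Ei] := Ee e (dhomog_uniq (pf_mon_neq0 _ _) (pf_mon_homog _ _) he).
have /oe : Z (pf_mon F e).
  exists [ffun j => if j == i then pf_mon F e else 0]; split=> [j|]; last first.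
    by rewrite (bigD1 i) //= big1 ?addr0 => [|j /negbTE ji]; rewrite ffunE ?ji ?eqxx.
  rewrite ffunE; case: eqP => [->|_]; last exact: (sW j).1.1.
  rewrite (_ : pf_mon F e = pf_mon F (E i)); first exact: cyclic_module_gen.
  by apply: eq_bigr => l _; rewrite Ei.
by move/apolar_eq0/eqP; rewrite (negbTE (pf_mon_neq0 _ _)).
Qed.

(** Pairing the difference of the two sums with its own i-th summand leaves only the square norm of
    that summand, by orthogonality. *)
Lemma sum_cyclic_module_inj (x y : {ffun I -> sym_tangent F n}) :
    (forall i j, E i =1 E j -> i = j) ->
    (forall i, cyclic_module (E i) (x i)) -> (forall i, cyclic_module (E i) (y i)) ->
  \sum_i x i = \sum_i y i -> x = y.
Proof.
move=> Einj Wx Wy xy; apply/ffunP => i; apply/eqP; rewrite -subr_eq0; apply/eqP.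
pose z j := x j - y j.
have Wz j : cyclic_module (E j) (z j).
  exact: (subspaceB (rho_stable_cyclic (E j)).1).
apply: apolar_eq0; rewrite -/(z i).
have : apolar (\sum_j z j) (z i) = 0 by rewrite sumrB xy subrr apolar0l.
rewrite apolar_suml (bigD1 i) //= big1 ?addr0 // => j /eqP ji.
apply: (cyclic_module_orthogonal _ (Wz j) (Wz i)) => /Einj; exact: ji.
Qed.

End Decomposition.
End CyclicModules.

(** * Irreducibility of the leading Pfaffians *)

Section PfaffianIrreducible.
Variables (F : numFieldType) (n : nat) (l : 'I_n./2).
Notation J := (std_skew F n).
Notation P := (pf_poly F l).
Implicit Types (a b : sym_tangent F n).

(** Acting by this singular diagonal matrix sets all variables of row and column [x] to zero. *)
Definition drop_row (x : 'I_n) : 'rV[F]_n := \row_y (y != x)%:R.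

Lemma rho_drop_row_supp x a : rho (diag_mx (drop_row x)) a = a ->
  forall m, m \in msupp a -> lin_meas (row_count x) m = 0%N.
Proof.
move=> Ra m ma; apply/eqP; rewrite -leqn0 leqNgt; apply/negP => w0.
have := congr1 (mcoeff m) Ra; rewrite mcoeff_rho_diag (bigD1 x) //= mxE eqxx.
rewrite expr0n gtn_eqF // !mul0r => /esym/eqP.
by rewrite mcoeff_eq0 ma.
Qed.

(* Scaling row x of the generic matrix by s multiplies P by s or by 1, so in  *)
(* F[X][s] the product of the two scaled factors is s P or P.                 *)
Lemma rho_drop_row_factor a b (x : 'I_n) : P = a * b ->
  [\/ [/\ (l.+1.*2 <= x)%N, rho (diag_mx (drop_row x)) a = a
        & rho (diag_mx (drop_row x)) b = b],
      [/\ (x < l.+1.*2)%N, rho (diag_mx (drop_row x)) a = a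
        & rho (diag_mx (drop_row x)) b = 0]
    | [/\ (x < l.+1.*2)%N, rho (diag_mx (drop_row x)) a = 0
        & rho (diag_mx (drop_row x)) b = b]].
Proof.
move=> Pab.
have P0 : P != 0.
  by apply/eqP => E; have := ev_pf_poly l (skew_std_skew F n);
     rewrite E /ev meval0; apply/eqP; rewrite eq_sym lead_pf_std_neq0.
have [a0 b0] : a != 0 /\ b != 0.
  by apply/andP; move: P0; rewrite Pab mulf_eq0 negb_or.
pose D s := diag_mx (drop_row x) + s *: delta_mx x x : 'M[F]_n.
have DE s : D s = diag_mx (\row_y (if y == x then s else 1)).
  apply/matrixP => i j; rewrite !mxE; have [->|ij] := eqVneq i j.
    by case: eqP => _ /=; rewrite ?mulr1 ?add0r // mulr0 addr0.
  by rewrite !mulr0n add0r; case: eqP => [ix|]; rewrite ?mulr0 //= -ix eq_sym (negbTE ij) mulr0.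
have D0 : D 0 = diag_mx (drop_row x) by rewrite /D scale0r addr0.
have D1 p : rho (D 1) p = p.
  rewrite DE (_ : diag_mx _ = 1%:M) ?rho1 //; apply/matrixP => i j; rewrite !mxE.
  by case: ifP.
have [A HA] := rho_curve (diag_mx (drop_row x)) (delta_mx x x) a.
have [B HB] := rho_curve (diag_mx (drop_row x)) (delta_mx x x) b.
have aE : a = A.[(1 : F)%:A] by rewrite -HA -/(D 1) D1.
have bE : b = B.[(1 : F)%:A] by rewrite -HB -/(D 1) D1.
have DaE : rho (diag_mx (drop_row x)) a = A.[(0 : F)%:A] by rewrite -HA -/(D 0) D0.
have DbE : rho (diag_mx (drop_row x)) b = B.[(0 : F)%:A] by rewrite -HB -/(D 0) D0.
have A0 : A != 0 by apply: contraNneq a0 => A0; rewrite aE A0 horner0.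
have B0 : B != 0 by apply: contraNneq b0 => B0; rewrite bE B0 horner0.
have AB : A * B = P *: 'X^((x < l.+1.*2)%N).
  apply/eqP; rewrite -subr_eq0; apply/eqP; apply: (@poly_alg_eq0 F) => s s0.
  rewrite hornerD hornerN hornerM -HA -HB -rmorphM /= -Pab -/(D s) DE rho_pf_poly_diag.
  rewrite hornerZ hornerXn exprZn expr1n.
  have -> : \prod_(y < n | (y < l.+1.*2)%N) (\row_z (if z == x then s else 1)) 0 y
      = s ^+ (x < l.+1.*2)%N.
    case: ltnP => xl.
      rewrite (bigD1 x) //= mxE eqxx big1 ?mulr1 ?expr1 // => y /andP[_ /negbTE yx].
      by rewrite mxE yx.
    rewrite big1 ?expr0 // => y yl; rewrite mxE; case: eqP => // yx.
    by move: yl; rewrite yx ltnNge xl.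
  by rewrite -scalerAr mulr1 subrr.
(* A size is one more than the degree in s, so the degrees of the two scaled factors add up to 1 or
   0 and at least one factor does not depend on s. *)
have sAB : (size A + size B = (x < l.+1.*2) + 2)%N.
  have := congr1 (fun Q : {poly _} => size Q) AB; rewrite size_mul // size_scale // size_polyXn.
  by rewrite addn2; case: (size A + size B)%N => //= m ->.
have const (Q : {poly sym_tangent F n}) (s : F) : size Q = 1%N -> Q.[s%:A] = Q.[(1 : F)%:A].
  by move=> /eqP/size_poly1P[c _ ->]; rewrite !hornerC.
case: (ltnP x l.+1.*2) sAB => xl sAB.
  have AB0 : A.[(0 : F)%:A] * B.[(0 : F)%:A] = 0.
    by rewrite -hornerM AB xl hornerZ hornerXn scale0r expr0n mulr0.
  have [s1|s1] : size A = 1%N \/ size B = 1%N.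
    by move: sAB A0 B0; rewrite -!size_poly_gt0; lia.
  - constructor 2; split=> //; first by rewrite DaE const // -aE.
    by move/eqP: AB0; rewrite const // -aE mulf_eq0 (negbTE a0) DbE => /eqP.
  - constructor 3; split=> //; last by rewrite DbE const // -bE.
    by move/eqP: AB0; rewrite [B.[_]]const // -bE mulf_eq0 (negbTE b0) orbF DaE => /eqP.
have [sA sB] : size A = 1%N /\ size B = 1%N.
  by move: sAB A0 B0; rewrite -!size_poly_gt0; lia.
by constructor 1; split; rewrite // ?DaE ?DbE const // -?aE -?bE.
Qed.

Lemma ev_pf_poly0 (M : 'M[F]_n) (x : 'I_n) : (x < l.+1.*2)%N ->
  skew_mx M -> (forall y, M x y = 0) -> ev P M = 0.
Proof.
move=> xl sM M0; rewrite ev_pf_poly // (lead_pf_row0 xl) // => y _.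
by rewrite [M y x](skew_mxE _ _ sM) M0 oppr0.
Qed.

Lemma supp0_unit a : a != 0 ->
  (forall x m, m \in msupp a -> lin_meas (row_count x) m = 0%N) -> a \is a GRing.unit.
Proof.
move=> a0 a1.
have m0 m : m \in msupp a -> m = 0%MM.
  move=> ma; apply/mnmP => i; rewrite mnm0E.
  have := a1 (tix i).1 m ma; rewrite /lin_meas (bigD1 i) //= /row_count eqxx.
  by lia.
have aE : a = (a@_0%MM)%:MP.
  apply/mpolyP => m; rewrite mcoeffC; have [->|mne] := eqVneq m 0%MM; first by rewrite mulr1.
  by rewrite mulr0; apply: memN_msupp_eq0; apply: contra mne => /m0 ->.
have c0 : a@_0%MM != 0 by apply: contraNneq a0 => c0; rewrite aE c0 mpolyC0.
by apply/unitrPr; exists ((a@_0%MM)^-1)%:MP; rewrite {1}aE -mpolyCM divff // mpolyC1.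
Qed.

(** Move [x] and [y] to the first pair of [J] by a permutation preserving the leading indices: they
    are then joined to each other and to nothing else. *)
Lemma exists_edge_point (x y : 'I_n) : (x < l.+1.*2)%N -> (y < l.+1.*2)%N -> x != y ->
  exists M : 'M[F]_n, [/\ skew_mx M, ev P M != 0
    & forall u v, M u v != 0 -> (u == x) = (v == y) /\ (u == y) = (v == x)].
Proof.
move=> xl yl xy; have ln := ltn_ord l.
have n0 : (0 < n)%N by lia.
have n1 : (1 < n)%N by lia.
pose o0 := Ordinal n0; pose o1 := Ordinal n1.
pose y' := tperm x o0 y.
pose s := (tperm x o0 * tperm y' o1)%g.
have y'0 : y' != o0.
  by rewrite /y' -{2}(tpermL x o0) (inj_eq perm_inj) eq_sym.
have sx : s x = o0 by rewrite permM tpermL tpermD.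
have sy : s y = o1 by rewrite permM -/y' tpermL.
have sM : skew_mx (\matrix_(u, v) J (s u) (s v)).
  by apply/matrixP => u v; rewrite !mxE opprB.
exists (\matrix_(u, v) J (s u) (s v)); split=> //.
  rewrite ev_pf_poly //; apply: lead_pf_perm_neq0 => u ul.
  have tl (p q r : 'I_n) : (p < l.+1.*2)%N -> (q < l.+1.*2)%N -> (r < l.+1.*2)%N ->
      (tperm p q r < l.+1.*2)%N by move=> *; case: tpermP.
  have y'l : (y' < l.+1.*2)%N by apply: (tl).
  by rewrite invMg !tpermV permM; apply: (tl) => //; apply: (tl).
have e0 v : J o0 v != 0 -> v = o1.
  rewrite stdE /=; have [E _|_] := eqVneq 1%N v; first by apply: val_inj; rewrite /= -E.
  by rewrite subrr eqxx.
have key u v : J (s u) (s v) != 0 -> u = x -> v = y.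
  move=> Jn ux; apply: (@perm_inj _ s); rewrite sy; apply: e0.
  by rewrite -sx -ux.
have e1 v : J o1 v != 0 -> v = o0.
  rewrite stdE /= andbF sub0r oppr_eq0; have [/eqP E _|_] := boolP (v.+1 == 1)%N.
    by apply: val_inj => /=; lia.
  by rewrite eqxx.
have key1 u v : J (s u) (s v) != 0 -> u = y -> v = x.
  move=> Jn uy; apply: (@perm_inj _ s); rewrite sx; apply: e1.
  by rewrite -sy -uy.
move=> u v; rewrite mxE => Jn.
have Jn' : J (s v) (s u) != 0 by rewrite (skew_mxE _ _ (skew_std_skew F n)) oppr_eq0.
by split; apply/eqP/eqP; eauto.
Qed.

(** If neither factor is a unit, [b] involves some row [x] and [a] some row [y], while [a] ignores
    row [x] and [b] ignores row [y]. At a point where [x] and [y] are joined only to each other,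
    clearing row [x] or clearing row [y] gives the same matrix. The value of [P] is therefore
    unchanged when row [y] is cleared, where it is 0; but the point was chosen with nonzero
    value. *)
Lemma pf_poly_irreducible : irreducible_mpoly P.
Proof.
have ln := ltn_ord l.
have xn : (0 < n)%N by lia.
have P0 : P != 0.
  apply/eqP => E; have := ev_pf_poly l (skew_std_skew F n).
  by rewrite E /ev meval0; apply/eqP; rewrite eq_sym lead_pf_std_neq0.
split=> // [|a b Pab].
  apply/negP => /unitrPr[q Pq].
  have sk0 : skew_mx (0 : 'M[F]_n) by rewrite /skew_mx linear0 oppr0.
  have := congr1 (fun p => ev p 0) Pq; rewrite evM (@ev_pf_poly0 _ (Ordinal xn)) //.
    by rewrite mul0r /ev meval1 => /esym/eqP; rewrite oner_eq0.
  by move=> y; rewrite mxE.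
have [a0 b0] : a != 0 /\ b != 0.
  by apply/andP; move: P0; rewrite Pab mulf_eq0 negb_or.
have [noa|] := EM (forall x : 'I_n, rho (diag_mx (drop_row x)) a = a).
  by left; apply: supp0_unit => // x; apply: rho_drop_row_supp.
have [nob _|] := EM (forall x : 'I_n, rho (diag_mx (drop_row x)) b = b).
  by right; apply: supp0_unit => // x; apply: rho_drop_row_supp.
move=> /existsNP[x bx] /existsNP[y ay].
case: (rho_drop_row_factor x Pab) => [[_ _ /bx []]|[xl ax _]|[_ _ /bx []]].
case: (rho_drop_row_factor y Pab) => [[_ /ay []]|[_ /ay []]|[yl _ by_]].
  have xy : x != y by apply: contra_not_neq bx => ->.
  have [M [sM PM Me]] := exists_edge_point xl yl xy.
  case/eqP: PM; rewrite Pab evM.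
  pose M' x := diag_mx (drop_row x) *m M *m diag_mx (drop_row x).
  have sM' z : skew_mx (M' z) by rewrite /M' -{1}tr_diag_mx; apply: skew_mx_congr.
  have M'E : M' x = M' y.
    apply/matrixP => u v; rewrite /M' !mul_mx_diag !mul_diag_mx !mxE.
    have [->|/Me[ux uy]] := eqVneq (M u v) 0; first by rewrite !mulr0 !mul0r.
    by rewrite ux uy mulrAC [RHS]mulrAC; congr (_ * _); rewrite mulrC.
  have evD' z p : rho (diag_mx (drop_row z)) p = p -> ev p M = ev p (M' z).
    by move=> Rp; have := ev_rho (diag_mx (drop_row z)) p sM; rewrite Rp tr_diag_mx.
  rewrite (evD' _ _ ax) (evD' _ _ by_) M'E -evM -Pab.
  apply: (ev_pf_poly0 yl (sM' y)) => v.
  by rewrite /M' mul_mx_diag mul_diag_mx !mxE eqxx !mul0r.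
Qed.

End PfaffianIrreducible.

(** * The spin group, its vector representation and the parabolic action *)

Section CliffordGroup.
Variables (F : numFieldType) (n : nat).
Notation S := 'M[F]_(spinor_dim n).
Notation e := (e_op F n).
Notation f := (f_op F n).
Implicit Types (g h : S) (v w : 'cV[F]_(n + n)) (a b : 'M[F]_n).

Lemma gamma0 : gamma (0 : 'cV[F]_(n + n)) = 0.
Proof. by rewrite /gamma big1 // => k _; rewrite !mxE !scale0r addr0. Qed.

Lemma gammaD v w : gamma (v + w) = gamma v + gamma w.
Proof. by rewrite -[v in LHS]scale1r gamma_linear scale1r. Qed.

Lemma gammaZ (c : F) v : gamma (c *: v) = c *: gamma v.
Proof. by rewrite -[c *: v]addr0 gamma_linear gamma0 addr0. Qed.

Lemma gamma_sum (I : finType) (u : I -> 'cV[F]_(n + n)) :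
  gamma (\sum_i u i) = \sum_i gamma (u i).
Proof. exact: (big_morph _ gammaD gamma0). Qed.

Definition basis_e (k : 'I_n) : 'cV[F]_(n + n) := delta_mx (lshift n k) 0.
Definition basis_f (k : 'I_n) : 'cV[F]_(n + n) := delta_mx (rshift n k) 0.

Lemma gamma_basis_e k : gamma (basis_e k) = e k.+1.
Proof.
rewrite /gamma (bigD1 k) //= big1 ?addr0 => [|l /negbTE lk]; rewrite !mxE !eqxx /=.
  by rewrite eq_rlshift scale1r scale0r addr0.
by rewrite eq_rlshift (inj_eq (@lshift_inj _ _)) lk !scale0r addr0.
Qed.

Lemma gamma_basis_f k : gamma (basis_f k) = f k.+1.
Proof.
rewrite /gamma (bigD1 k) //= big1 ?addr0 => [|l /negbTE lk]; rewrite !mxE !eqxx /=.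
  by rewrite eq_lrshift scale1r scale0r add0r.
by rewrite eq_lrshift (inj_eq (@rshift_inj _ _)) lk !scale0r addr0.
Qed.

Lemma col_sum_basis v :
  v = \sum_k (v (lshift n k) 0 *: basis_e k + v (rshift n k) 0 *: basis_f k).
Proof.
rewrite {1}[v]matrix_sum_delta big_split_ord big_split /=.
by congr (_ + _); apply: eq_bigr => i _; rewrite big_ord1.
Qed.

Lemma gamma_inj : injective (@gamma F n).
Proof.
move=> v w vw; apply/colP => i; rewrite -!polar_hyp.
apply: (mulfI (spinor_dim_neq0 F n)); by rewrite -!mxtrace_gamma vw.
Qed.

Lemma quad_eq1 v : gamma v *m gamma v = 1%:M -> quad v == 1.
Proof.
rewrite gamma_sqr => /(congr1 mxtrace); rewrite !mxtrace_scalar.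
rewrite -[LHS]mulr_natr -[RHS]mul1r => H; apply/eqP.
exact: (mulIf (spinor_dim_neq0 F n)).
Qed.

Lemma spin_pair u v : quad u == 1 -> quad v == 1 -> spin (gamma u *m gamma v).
Proof.
move=> qu qv; exists [:: u; v]; split=> //; first by rewrite /= qu qv.
by rewrite !big_cons big_nil mulmx1.
Qed.

Lemma spin_mul g h : spin g -> spin h -> spin (g *m h).
Proof.
move=> [vs [ev qv ->]] [ws [ew qw ->]]; exists (vs ++ ws); split.
- by rewrite size_cat oddD (negbTE ev) (negbTE ew).
- by rewrite all_cat qv.
- by elim: vs {ev qv} => [|v vs IHvs]; rewrite ?big_nil ?mul1mx //= !big_cons -mulmxA IHvs.
Qed.

(** A commutation relation with all vectors identifies the image of [g], because [gamma] is
    injective; neither the inverse of [g] nor the trace formula has to be computed. *)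
Lemma vect_rep_eq g (A : 'M[F]_(n + n)) : spin g ->
  (forall v, g *m gamma v = gamma (A *m v) *m g) -> vect_rep g = A.
Proof.
move=> sg gA; have ug := spin_unit sg.
have E v : vect_rep g *m v = A *m v.
  by apply: gamma_inj; rewrite vect_repE // gA mulmxK.
apply/matrixP => i j; have /colP/(_ i) := E (delta_mx j 0).
by rewrite -!colE !mxE.
Qed.

Lemma vect_rep_orth g : spin g ->
  (vect_rep g)^T *m hyp_mx F n *m vect_rep g = hyp_mx F n.
Proof.
move=> sg; have ug := spin_unit sg; set A := vect_rep g.
have pE v w : polar (A *m v) (A *m w) = polar v w.
  apply: (mulfI (spinor_dim_neq0 F n)); rewrite -!mxtrace_gamma !vect_repE //.
  congr (_ * _); rewrite -!mulmxA [invmx g *m _]mulmxA mulVmx // mul1mx.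
  by rewrite mxtrace_mulC -!mulmxA mulVmx // mulmx1.
have polarE v w : polar v w = (v^T *m hyp_mx F n *m w) 0 0.
  rewrite /polar mxE big_split_ord big_split /= addrC; congr (_ + _); apply: eq_bigr => k _.
    congr (_ * _); rewrite mxE big_split_ord /= [X in X + _]big1 ?add0r => [|i _].
      rewrite (bigD1 k) //= big1 ?addr0 => [|i /negbTE ik].
        by rewrite block_mxEdl !mxE eqxx mulr1.
      by rewrite block_mxEdl !mxE ik mulr0.
    by rewrite block_mxEul !mxE mulr0.
  congr (_ * _); rewrite mxE big_split_ord /= [X in _ + X]big1 ?addr0 => [|i _].
    rewrite (bigD1 k) //= big1 ?addr0 => [|i /negbTE ik].
      by rewrite block_mxEur !mxE eqxx mulr1.
    by rewrite block_mxEur !mxE ik mulr0.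
  by rewrite block_mxEdr !mxE mulr0.
apply/matrixP => i j.
pose di : 'cV[F]_(n + n) := delta_mx i 0; pose dj : 'cV[F]_(n + n) := delta_mx j 0.
have sel (M : 'M[F]_(n + n)) : (di^T *m M *m dj) 0 0 = M i j.
  by rewrite trmx_delta -rowE -colE !mxE.
have := pE di dj; rewrite !polarE.
have -> : (A *m di)^T *m hyp_mx F n *m (A *m dj)
    = di^T *m (A^T *m hyp_mx F n *m A) *m dj by rewrite trmx_mul !mulmxA.
by rewrite !sel.
Qed.

Lemma hyp_mx_sqr : hyp_mx F n *m hyp_mx F n = 1%:M.
Proof.
by rewrite /hyp_mx mulmx_block !(mul0mx, mulmx0, mul1mx, addr0, add0r) -scalar_mx_block.
Qed.

Lemma orth_inv (A : 'M[F]_(n + n)) : A^T *m hyp_mx F n *m A = hyp_mx F n ->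
  A \in unitmx /\ invmx A = hyp_mx F n *m A^T *m hyp_mx F n.
Proof.
move=> AA; have E : hyp_mx F n *m A^T *m hyp_mx F n *m A = 1%:M.
  by rewrite -!mulmxA [A^T *m _]mulmxA AA hyp_mx_sqr.
have [_ uA] := mulmx1_unit E; split=> //.
by rewrite -[LHS]mul1mx -E mulmxK.
Qed.

Lemma orth_inv_block (a b c d : 'M[F]_n) :
  hyp_mx F n *m (block_mx a b c d)^T *m hyp_mx F n = block_mx d^T b^T c^T a^T.
Proof.
rewrite tr_block_mx /hyp_mx !mulmx_block.
by rewrite !(mul0mx, mulmx0, mul1mx, mulmx1, addr0, add0r).
Qed.

Lemma so_mx_tr (X : 'M[F]_(n + n)) : so_mx X -> so_mx X^T.
Proof.
move=> sX; rewrite /so_mx trmxK.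
have -> : X *m hyp_mx F n + hyp_mx F n *m X^T
    = hyp_mx F n *m (X^T *m hyp_mx F n + hyp_mx F n *m X) *m hyp_mx F n.
  rewrite mulmxDr mulmxDl !mulmxA hyp_mx_sqr mul1mx addrC -!mulmxA hyp_mx_sqr.
  by rewrite mulmx1.
by rewrite sX mulmx0 mul0mx.
Qed.

Lemma so_mx_Ad (A X : 'M[F]_(n + n)) : A^T *m hyp_mx F n *m A = hyp_mx F n ->
  so_mx X -> so_mx (Ad A X).
Proof.
move=> AA sX; have [uA _] := orth_inv AA; set B := invmx A.
have BA : B *m A = 1%:M by exact: mulVmx.
have AB : A *m B = 1%:M by exact: mulmxV.
have JA : hyp_mx F n *m A = B^T *m hyp_mx F n.
  by rewrite -{2}AA !mulmxA -trmx_mul AB trmx1 mul1mx.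
have AJ : A^T *m hyp_mx F n = hyp_mx F n *m B.
  by rewrite -[LHS]mulmx1 -AB mulmxA AA.
rewrite /so_mx /Ad -/B !trmx_mul -!mulmxA AJ !mulmxA JA.
by rewrite -!mulmxA -mulmxDr !mulmxA -mulmxDl sX mul0mx mulmx0.
Qed.

(** Transposition fixes the Cartan subalgebra and exchanges opposite roots, so statements on the
    opposite parabolic follow from [lie_pnE]. *)
Lemma graded_part_tr (D : int -> bool) (X : 'M[F]_(n + n)) :
  graded_part D X -> graded_part (fun z => D (- z)) X^T.
Proof.
move=> [m [c [Y [HY ->]]]]; exists m, (fun i k => - c i k), (fun i => (Y i)^T); split.
  move=> i; have [Di [sY wY]] := HY i; split; first by rewrite opprK.
  split=> [|H]; first exact: so_mx_tr.
  have tH : (cartan H)^T = cartan H.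
    by rewrite /cartan tr_block_mx !trmx0 linearN /= tr_diag_mx.
  rewrite -{1 2}tH -!trmx_mul -linearB /= -opprB wY linearN linearZ /= -scaleNr.
  congr (_ *: _); rewrite -lin_formN -sumrN; congr (lin_form _ H).
  by apply: eq_bigr => k _; rewrite scaleNr.
by rewrite linear_sum.
Qed.

Lemma lie_pn_oppE (X : 'M[F]_(n + n)) : (1 < n)%N ->
  lie_pn_opp X <-> so_mx X /\ dlsubmx X = 0.
Proof.
move=> n1; have E : lie_pn_opp X <-> lie_pn X^T.
  split=> [|/graded_part_tr]; first move/graded_part_tr.
    move=> [m [c [Y [HY XE]]]]; exists m, c, Y; split=> // i.
    by have [D ?] := HY i; split=> //; rewrite -oppr_ge0.
  rewrite trmxK => -[m [c [Y [HY XE]]]]; exists m, c, Y; split=> // i.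
  by have [D ?] := HY i; split=> //; rewrite -oppr_le0.
rewrite E lie_pnE //; split=> -[sX X0]; split.
- by rewrite -[X]trmxK; apply: so_mx_tr.
- by apply: trmx_inj; rewrite trmx0 -X0; apply/matrixP => i j; rewrite !mxE.
- exact: so_mx_tr.
- by rewrite -[RHS]trmx0 -X0; apply/matrixP => i j; rewrite !mxE.
Qed.

Lemma levi_block g a b : (1 < n)%N -> spin g -> vect_rep g = block_mx a 0 0 b -> levi g.
Proof.
move=> n1 sg gE; have AA := vect_rep_orth sg; have [uA iA] := orth_inv AA.
have AdE X : Ad (vect_rep g) X = block_mx a 0 0 b *m X *m block_mx b^T 0 0 a^T.
  by rewrite /Ad iA gE orth_inv_block !trmx0.
split; split=> // X.
  rewrite !lie_pnE // => -[sX X0]; split; first exact: so_mx_Ad.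
  rewrite AdE -(submxK X) X0 !mulmx_block !(mul0mx, mulmx0, addr0, add0r).
  by rewrite block_mxKur.
rewrite !lie_pn_oppE // => -[sX X0]; split; first exact: so_mx_Ad.
rewrite AdE -(submxK X) X0 !mulmx_block !(mul0mx, mulmx0, addr0, add0r).
by rewrite block_mxKdl.
Qed.

(* The upper half of vect_rep g would have rank at most 1 if its right block  *)
(* were nonzero.                                                              *)
Lemma parabolic_ur g : (1 < n)%N -> parabolic g -> ursubmx (vect_rep g) = 0.
Proof.
move=> n1 [sg pg]; have AA := vect_rep_orth sg; have [uA iA] := orth_inv AA.
pose a := ulsubmx (vect_rep g); pose b := ursubmx (vect_rep g).
pose c := dlsubmx (vect_rep g); pose d := drsubmx (vect_rep g).
have gE : vect_rep g = block_mx a b c d by rewrite submxK.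
rewrite -/b; pose A := block_mx a b c d.
move: pg AA uA iA; rewrite gE -/A => pg AA uA iA; clearbody a b c d.
have ur0 X : lie_pn X -> ursubmx (A *m X *m block_mx d^T b^T c^T a^T) = 0.
  by move=> /pg; rewrite lie_pnE // /Ad iA orth_inv_block => -[].
have ab i j p q : a i p * b j q = b i q * a j p.
  have : lie_pn (block_mx (delta_mx p q) 0 0 (- (delta_mx p q)^T : 'M[F]_n)).
    by rewrite lie_pnE // block_mxKur so_mx_block !trmx0 oppr0.
  move/ur0; rewrite !mulmx_block !(mul0mx, mulmx0, addr0, add0r) block_mxKur.
  move/matrixP/(_ i j); rewrite mulmxN mulNmx trmx_delta !mxE.
  have := @congr_deltaE F n a b^T i j p q; have := @congr_deltaE F n b a^T i j q p.
  by rewrite !mxE => -> -> /eqP; rewrite subr_eq0 => /eqP.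
have bb i j p q : b i p * b j q = b i q * b j p.
  have : lie_pn (block_mx 0 0 (delta_mx p q - delta_mx q p : 'M[F]_n) 0).
    rewrite lie_pnE // block_mxKur so_mx_block !trmx0 oppr0; split=> //; split=> //.
    by rewrite linearB /= !trmx_delta opprB.
  move/ur0; rewrite !mulmx_block !(mul0mx, mulmx0, addr0, add0r) block_mxKur.
  move/matrixP/(_ i j); rewrite mulmxBr mulmxBl !mxE.
  have := @congr_deltaE F n b b^T i j p q; have := @congr_deltaE F n b b^T i j q p.
  by rewrite !mxE => -> -> /eqP; rewrite subr_eq0 => /eqP.
apply/eqP/negPn/negP => b0.
have [i0 [q u0]] : exists i q, b i q != 0.
  apply: contrapT => nz; case/eqP: b0; apply/matrixP => i q; rewrite [RHS]mxE.
  by apply/eqP/negPn/negP => bn; apply: nz; exists i, q.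
have [i1 ne] : exists i1 : 'I_n, i1 != i0.
  have n0 : (0 < n)%N by lia.
  have [E|] := eqVneq i0 (Ordinal n0); last by rewrite eq_sym => ?; exists (Ordinal n0).
  by exists (Ordinal n1); rewrite E.
pose r : 'rV[F]_(n + n) := row_mx (b i0 q *: delta_mx 0 i1 - b i1 q *: delta_mx 0 i0) 0.
have rA : r *m A = 0.
  rewrite /A /r mul_row_block !mul0mx !addr0.
  have sel (M : 'M[F]_n) j : ((b i0 q *: delta_mx 0 i1 - b i1 q *: delta_mx 0 i0 : 'rV[F]_n) *m M) 0 j
      = b i0 q * M i1 j - b i1 q * M i0 j.
    by rewrite mulmxBl -!scalemxAl -!rowE !mxE.
  rewrite -[RHS]row_mx0; congr row_mx; apply/rowP => j; rewrite sel [RHS]mxE.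
    by rewrite -ab mulrC subrr.
  by rewrite bb mulrC subrr.
have : r = 0 by rewrite -[r](mulmxK uA) rA mul0mx.
move/rowP/(_ (lshift n i1)); rewrite row_mxEl !mxE !eqxx (negbTE ne) /= mulr1 mulr0 subr0.
by move/eqP; rewrite (negbTE u0).
Qed.

(** With a vanishing upper right block, conjugation sends the upper right block x of a tangent
    vector to a x a^T; the lower left block of the group element does not affect the class modulo
    p_n. *)
Lemma sym_act_rho g p : (1 < n)%N -> parabolic g ->
  sym_act g p = rho (ulsubmx (vect_rep g)) p.
Proof.
move=> n1 pg; have b0 := parabolic_ur n1 pg; have [sg _] := pg.
have [uA iA] := orth_inv (vect_rep_orth sg).
rewrite /sym_act /rho /lin_subst; congr (_ \mPo _); apply: eq_mktuple => i.
rewrite /tangent_act (reindex (fun j : 'I_(tangent_dim n) => enum_val j)) /=; last first.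
  by exists enum_rank => ? _; rewrite ?enum_rankK ?enum_valK.
apply: eq_bigr => j _; rewrite enum_valK; congr (_ *: _); rewrite compoundE.
pose a := ulsubmx (vect_rep g); pose c := dlsubmx (vect_rep g).
pose d := drsubmx (vect_rep g).
have gE : vect_rep g = block_mx a 0 c d by rewrite -b0 submxK.
rewrite -/a /Ad iA gE orth_inv_block /tangent_vec.
by rewrite !mulmx_block !(mul0mx, mulmx0, addr0, add0r) block_mxKur.
Qed.

End CliffordGroup.

(** * Root subgroups and coroots inside the spin group *)

Section LeviElements.
Variables (F : numClosedFieldType) (n : nat).
Notation S := 'M[F]_(spinor_dim n).
Notation e := (e_op F n).
Notation f := (f_op F n).
Implicit Types (g h : S) (v w : 'cV[F]_(n + n)) (a b : 'M[F]_n).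

Lemma e_op_sqr i : e i *m e i = 0.
Proof.
have /eqP := e_op_anti F n i i; rewrite -mulr2n -scaler_nat scaler_eq0 pnatr_eq0 /=.
by move/eqP.
Qed.

Lemma f_op_sqr i : f i *m f i = 0.
Proof. by rewrite -trmx_mul e_op_sqr trmx0. Qed.

Lemma e_opC i j : e i *m e j = - (e j *m e i).
Proof. by apply/eqP; rewrite -addr_eq0 e_op_anti. Qed.

Lemma f_opC i j : f i *m f j = - (f j *m f i).
Proof. by apply/eqP; rewrite -addr_eq0 f_op_anti. Qed.

Lemma ef_opE (i j : 'I_n) : e i.+1 *m f j.+1 = (i == j)%:R%:M - f j.+1 *m e i.+1.
Proof. by rewrite -[LHS](addrK (f j.+1 *m e i.+1)) ef_op_anti eqSS /= ltn_ord andbT. Qed.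

Lemma fe_opE (i j : 'I_n) : f j.+1 *m e i.+1 = (i == j)%:R%:M - e i.+1 *m f j.+1.
Proof. by rewrite ef_opE opprB addrC subrK. Qed.

(** The image of [g] in the orthogonal group is block diagonal with upper block [a], stated as a
    commutation relation so that it can be checked on the vectors e_k and f_k. *)
Definition lies_over g a : Prop :=
  spin g /\ exists b, forall v, g *m gamma v = gamma (block_mx a 0 0 b *m v) *m g.

Lemma lies_over_levi g a : (1 < n)%N -> lies_over g a ->
  levi g /\ forall p, sym_act g p = rho a p.
Proof.
move=> n1 [sg [b gb]]; have gE := vect_rep_eq sg gb.
have lg := levi_block n1 sg gE; split; first exact: lg.
by move=> p; rewrite (sym_act_rho p n1 lg.1) gE block_mxKul.
Qed.

Lemma intertwines_basis g a b :
    (forall k : 'I_n, g *m e k.+1 = gamma (block_mx a 0 0 b *m basis_e F k) *m g) ->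
    (forall k : 'I_n, g *m f k.+1 = gamma (block_mx a 0 0 b *m basis_f F k) *m g) ->
  forall v, g *m gamma v = gamma (block_mx a 0 0 b *m v) *m g.
Proof.
move=> ge gf v; rewrite [v]col_sum_basis.
rewrite gamma_sum !mulmx_sumr gamma_sum mulmx_suml; apply: eq_bigr => k _.
rewrite mulmxDr -!scalemxAr !gammaD !gammaZ gamma_basis_e gamma_basis_f.
by rewrite mulmxDl mulmxDr -!scalemxAl -!scalemxAr ge gf.
Qed.

Lemma block_basis_e a b k :
  block_mx a 0 0 b *m basis_e F k = \sum_l a l k *: basis_e F l.
Proof.
apply/colP => i; rewrite -colE mxE summxE; case: (split_ordP i) => j ->.
  rewrite block_mxEul (bigD1 j) //= big1 ?addr0 => [|l /negbTE lj]; rewrite !mxE.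
    by rewrite !eqxx mulr1.
  by rewrite (inj_eq (@lshift_inj _ _)) eq_sym lj mulr0.
by rewrite block_mxEdl mxE big1 // => l _; rewrite !mxE eq_rlshift mulr0.
Qed.

Lemma block_basis_f a b k :
  block_mx a 0 0 b *m basis_f F k = \sum_l b l k *: basis_f F l.
Proof.
apply/colP => i; rewrite -colE mxE summxE; case: (split_ordP i) => j ->.
  by rewrite block_mxEur mxE big1 // => l _; rewrite !mxE eq_lrshift mulr0.
rewrite block_mxEdr (bigD1 j) //= big1 ?addr0 => [|l /negbTE lj]; rewrite !mxE.
  by rewrite !eqxx mulr1.
by rewrite (inj_eq (@rshift_inj _ _)) eq_sym lj mulr0.
Qed.

Lemma gamma_block_e a b k :
  gamma (block_mx a 0 0 b *m basis_e F k) = \sum_l a l k *: e l.+1.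
Proof.
rewrite block_basis_e gamma_sum; apply: eq_bigr => l _.
by rewrite gammaZ gamma_basis_e.
Qed.

Lemma gamma_block_f a b k :
  gamma (block_mx a 0 0 b *m basis_f F k) = \sum_l b l k *: f l.+1.
Proof.
rewrite block_basis_f gamma_sum; apply: eq_bigr => l _.
by rewrite gammaZ gamma_basis_f.
Qed.

Lemma sum_elem_mx (i j k : 'I_n) (z : F) (x : 'I_n -> S) :
  \sum_l elem_mx i j z l k *: x l = x k + (z * (k == j)%:R) *: x i.
Proof.
under eq_bigr => l _ do rewrite !mxE scalerDl.
rewrite big_split /=; congr (_ + _).
  rewrite (bigD1 k) //= eqxx scale1r big1 ?addr0 // => l /negbTE ->.
  by rewrite scale0r.
rewrite (bigD1 i) //= eqxx /= big1 ?addr0 // => l /negbTE ->.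
by rewrite mulr0 scale0r.
Qed.

(** With a third index [k], put c = e_k + f_k; it squares to 1 and anticommutes with x = e_i and y =
    f_j. Then (zx + c)(zx + c + y)(-c)(-c + y) = 1 + z xy, and all four factors are vectors with
    quadratic form 1. *)
Lemma spin_root_elt (i j : 'I_n) (z : F) : (2 < n)%N -> i != j -> spin (root_elt n i.+1 j.+1 z).
Proof.
move=> n2 ij.
have [k [ki kj]] : exists k : 'I_n, k != i /\ k != j.
  have n0 : (0 < n)%N by lia.
  have n1 : (1 < n)%N by lia.
  pose o0 := Ordinal n0; pose o1 := Ordinal n1; pose o2 := Ordinal n2.
  have ex (o : 'I_n) : (o != i) && (o != j) -> exists k : 'I_n, k != i /\ k != j.
    by move=> /andP[? ?]; exists o.
  case: (boolP ((o0 != i) && (o0 != j))) => [/ex //|h0].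
  case: (boolP ((o1 != i) && (o1 != j))) => [/ex //|h1].
  apply: (ex o2); move: ij h0 h1; rewrite -!val_eqE /=; lia.
pose x := e i.+1; pose y := f j.+1; pose c := e k.+1 + f k.+1.
have cc : c *m c = 1%:M.
  rewrite /c mulmxDl !mulmxDr e_op_sqr f_op_sqr add0r addr0 ef_opE eqxx.
  by rewrite subrK.
have xc : x *m c = - (c *m x).
  rewrite /c /x mulmxDr mulmxDl e_opC ef_opE eq_sym (negbTE ki).
  by rewrite (_ : 0%:R%:M = 0) ?raddf0 // sub0r opprD.
have yc : y *m c = - (c *m y).
  rewrite /c /y mulmxDr mulmxDl fe_opE (negbTE kj) f_opC.
  by rewrite (_ : 0%:R%:M = 0) ?raddf0 // sub0r opprD.
have xy : x *m y = - (y *m x).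
  rewrite /x /y ef_opE (negbTE ij).
  by rewrite (_ : 0%:R%:M = 0) ?raddf0 // sub0r.
have xx : x *m x = 0 by exact: e_op_sqr.
have yy : y *m y = 0 by exact: f_op_sqr.
pose vc := basis_e F k + basis_f F k.
have gvc : gamma vc = c by rewrite gammaD gamma_basis_e gamma_basis_f.
have gx : gamma (basis_e F i) = x by exact: gamma_basis_e.
have gy : gamma (basis_f F j) = y by exact: gamma_basis_f.
have rE : root_elt n i.+1 j.+1 z = 1%:M + z *: (x *m y) by [].
clearbody x y c vc.
pose u1 := z *: basis_e F i + vc; pose u2 := u1 + basis_f F j.
pose u3 := - vc; pose u4 := u3 + basis_f F j.
have g1 : gamma u1 = z *: x + c by rewrite gammaD gammaZ gvc gx.
have g2 : gamma u2 = z *: x + c + y by rewrite gammaD g1 gy.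
have g3 : gamma u3 = - c by rewrite /u3 -scaleN1r gammaZ gvc scaleN1r.
have g4 : gamma u4 = - c + y by rewrite gammaD g3 gy.
have s1 : (z *: x + c) *m (z *: x + c) = 1%:M.
  rewrite mulmxDl !mulmxDr cc -!scalemxAl -!scalemxAr xx !scaler0 add0r xc.
  by rewrite scalerN addrA addNr add0r.
have xcy : (z *: x + c) *m y = - (y *m (z *: x + c)).
  by rewrite mulmxDl mulmxDr -scalemxAl -scalemxAr xy yc scalerN opprD opprK.
have q1 : quad u1 == 1 by apply: quad_eq1; rewrite g1.
have sq (A B : S) : A *m A = 1%:M -> A *m B = - (B *m A) -> B *m B = 0 ->
    (A + B) *m (A + B) = 1%:M.
  by move=> AA AB BB; rewrite mulmxDl !mulmxDr AA AB BB addr0 subrK.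
have cc' : - c *m - c = 1%:M by rewrite mulNmx mulmxN opprK cc.
have q2 : quad u2 == 1 by apply: quad_eq1; rewrite g2; apply: sq.
have q3 : quad u3 == 1 by apply: quad_eq1; rewrite g3.
have q4 : quad u4 == 1.
  by apply: quad_eq1; rewrite g4; apply: sq; rewrite // mulNmx mulmxN opprK yc.
suff -> : root_elt n i.+1 j.+1 z = (gamma u1 *m gamma u2) *m (gamma u3 *m gamma u4).
  by apply: spin_mul; apply: spin_pair.
have cyc : c *m y *m (c *m y) = 0.
  by rewrite mulmxA -[c *m y *m c]mulmxA yc mulmxN mulNmx mulmxA cc mul1mx yy oppr0.
have xyc : x *m y *m (c *m y) = 0.
  by rewrite mulmxA -[x *m y *m c]mulmxA yc mulmxN mulNmx -!mulmxA yy !mulmx0 oppr0.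
rewrite g1 g2 g3 g4 [X in X *m _]mulmxDr s1 [X in _ *m X]mulmxDr cc' mulNmx.
rewrite mulmxDl mul1mx mulmxBr mulmx1 [_ *m y]mulmxDl -scalemxAl.
rewrite mulmxDl -scalemxAl xyc cyc scaler0 addr0 subr0 rE.
  by rewrite [_ *: _ + _]addrC addrA subrK.
Qed.

Lemma lies_over_root_elt (i j : 'I_n) (z : F) : (2 < n)%N -> i != j ->
  lies_over (root_elt n i.+1 j.+1 z) (elem_mx i j z).
Proof.
move=> n2 ij; split; first exact: spin_root_elt.
exists (elem_mx j i (- z)); apply: intertwines_basis.
- move=> k; rewrite gamma_block_e sum_elem_mx /root_elt.
  rewrite mulmxDl mul1mx mulmxDr mulmx1 mulmxDl -addrA; congr (_ + _).
  rewrite -!scalemxAl -!scalemxAr -mulmxA fe_opE mulmxBr !mulmxA e_op_sqr mul0mx.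
  rewrite !scaler0 addr0 mul_mx_scalar scalerBr scalerA; congr (_ + _).
  by rewrite e_opC mulNmx scalerN opprK.
- move=> k; rewrite gamma_block_f sum_elem_mx /root_elt.
  rewrite mulmxDl mul1mx mulmxDr mulmx1 mulmxDl -addrA; congr (_ + _).
  have L : e i.+1 *m f j.+1 *m f k.+1
      = f k.+1 *m (e i.+1 *m f j.+1) - (k == i)%:R *: f j.+1.
    by rewrite -mulmxA f_opC mulmxN !mulmxA ef_opE mulmxBl mul_scalar_mx opprB eq_sym.
  have R : f j.+1 *m (e i.+1 *m f j.+1) = 0.
    rewrite mulmxA fe_opE (negbTE ij) (_ : 0%:R%:M = 0 :> S) ?raddf0 // sub0r.
    by rewrite mulNmx -mulmxA f_op_sqr mulmx0 oppr0.
  rewrite -!scalemxAl -!scalemxAr L R !scaler0 addr0.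
  by rewrite scalerBr scalerA [LHS]addrC mulNr scaleNr.
Qed.

Definition torus_row (k : nat) (z : F) : 'rV[F]_n :=
  \row_x (if x == k :> nat then z else 1).

Lemma sum_diag_mx (d : 'rV[F]_n) k (x : 'I_n -> S) :
  \sum_l diag_mx d l k *: x l = d 0 k *: x k.
Proof.
rewrite (bigD1 k) //= big1 ?addr0 => [|l /negbTE lk]; rewrite mxE ?eqxx //.
by rewrite lk mulr0n scale0r.
Qed.

Lemma torus_intertwines (k : 'I_n) (z : F) : z != 0 -> forall v,
  torus_elt n k.+1 z *m gamma v =
  gamma (block_mx (diag_mx (torus_row k z)) 0 0 (diag_mx (torus_row k z^-1)) *m v)
    *m torus_elt n k.+1 z.
Proof.
move=> z0; apply: intertwines_basis => l.
all: rewrite ?gamma_block_e ?gamma_block_f sum_diag_mx !mxE val_eqE /torus_elt.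
- have [->|lk] := eqVneq l k.
    rewrite mulmxDl mulmxDr -!scalemxAl -!scalemxAr -!mulmxA e_op_sqr mulmx0 addr0.
    by rewrite ![e k.+1 *m (e k.+1 *m _)]mulmxA e_op_sqr mul0mx !scaler0 add0r.
  rewrite scale1r mulmxDl mulmxDr -!scalemxAl -!scalemxAr; congr (_ *: _ + _).
    rewrite -mulmxA fe_opE (negbTE lk) (_ : 0%:R%:M = 0 :> S) ?raddf0 // sub0r.
    by rewrite mulmxN [e k.+1 *m (e l.+1 *m _)]mulmxA [e k.+1 *m e l.+1]e_opC mulNmx opprK -mulmxA.
  rewrite -mulmxA [e k.+1 *m e l.+1]e_opC mulmxN [f k.+1 *m (e l.+1 *m _)]mulmxA fe_opE (negbTE lk).
  by rewrite (_ : 0%:R%:M = 0 :> S) ?raddf0 // sub0r mulNmx opprK -mulmxA.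
- have [->|lk] := eqVneq l k.
    rewrite mulmxDl mulmxDr -!scalemxAl -!scalemxAr -!mulmxA f_op_sqr mulmx0 scaler0 add0r.
    rewrite ![f k.+1 *m (f k.+1 *m _)]mulmxA f_op_sqr mul0mx scaler0 addr0 scalerA mulVf //.
    by rewrite scale1r.
  rewrite scale1r mulmxDl mulmxDr -!scalemxAl -!scalemxAr; congr (_ *: _ + _).
    rewrite -mulmxA [f k.+1 *m f l.+1]f_opC mulmxN [e k.+1 *m (f l.+1 *m _)]mulmxA
      ef_opE eq_sym (negbTE lk).
    by rewrite (_ : 0%:R%:M = 0 :> S) ?raddf0 // sub0r mulNmx opprK -mulmxA.
  rewrite -mulmxA ef_opE eq_sym (negbTE lk) (_ : 0%:R%:M = 0 :> S) ?raddf0 // sub0r.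
  by rewrite mulmxN [f k.+1 *m (f l.+1 *m _)]mulmxA [f k.+1 *m f l.+1]f_opC mulNmx opprK -mulmxA.
Qed.

Lemma intertwines_mul g h (A B : 'M[F]_(n + n)) :
  (forall v, g *m gamma v = gamma (A *m v) *m g) ->
  (forall v, h *m gamma v = gamma (B *m v) *m h) ->
  forall v, (g *m h) *m gamma v = gamma ((A *m B) *m v) *m (g *m h).
Proof. by move=> gA hB v; rewrite -mulmxA hB mulmxA gA -!mulmxA. Qed.

(** The element is the product of the vectors z e_k + z^-1 f_k and e_k + f_k; the square reflects
    the double cover of the orthogonal group. *)
Lemma spin_torus_pair (k : 'I_n) (z : F) : z != 0 -> spin (z^-1 *: torus_elt n k.+1 (z ^+ 2)).
Proof.
move=> z0; pose u := z *: basis_e F k + z^-1 *: basis_f F k.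
pose v := basis_e F k + basis_f F k.
have gu : gamma u = z *: e k.+1 + z^-1 *: f k.+1.
  by rewrite gammaD !gammaZ gamma_basis_e gamma_basis_f.
have gv : gamma v = e k.+1 + f k.+1 by rewrite gammaD gamma_basis_e gamma_basis_f.
have ef : e k.+1 *m f k.+1 = 1%:M - f k.+1 *m e k.+1 by rewrite ef_opE eqxx.
have -> : z^-1 *: torus_elt n k.+1 (z ^+ 2) = gamma u *m gamma v.
  rewrite gu gv mulmxDl !mulmxDr -!scalemxAl e_op_sqr f_op_sqr !scaler0 add0r addr0.
  by rewrite /torus_elt scalerDr scalerA expr2 mulKf.
apply: spin_pair; apply: quad_eq1.
  rewrite gu mulmxDl !mulmxDr -!scalemxAl -!scalemxAr e_op_sqr f_op_sqr !scaler0 add0r addr0.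
  by rewrite !scalerA mulfV // mulVf // !scale1r ef subrK.
by rewrite gv mulmxDl !mulmxDr e_op_sqr f_op_sqr add0r addr0 ef subrK.
Qed.

Definition coroot_row (k : nat) (z : F) : 'rV[F]_n :=
  if (k.+1 < n)%N then \row_x (torus_row k z 0 x * torus_row k.+1 z^-1 0 x)
  else \row_x (torus_row n.-2 z 0 x * torus_row k z 0 x).

Lemma lies_over_scale_mul (g h : S) (c : F) (d1 d2 d1' d2' : 'rV[F]_n) :
  (forall v, g *m gamma v = gamma (block_mx (diag_mx d1) 0 0 (diag_mx d2) *m v) *m g) ->
  (forall v, h *m gamma v = gamma (block_mx (diag_mx d1') 0 0 (diag_mx d2') *m v) *m h) ->
  spin (c *: (g *m h)) ->
  lies_over (c *: (g *m h)) (diag_mx (\row_x (d1 0 x * d1' 0 x))).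
Proof.
move=> ga hb sgh; split=> //; exists (diag_mx (\row_x (d2 0 x * d2' 0 x))) => v.
have := intertwines_mul ga hb v.
rewrite mulmx_block !(mul0mx, mulmx0, addr0, add0r) !mulmx_diag => E.
by rewrite -scalemxAl E -scalemxAr.
Qed.

(** Both torus factors are normalized by a square root s of [z]. The scalars s^-1 and s cancel for
    the roots eps_k - eps_(k+1), and for the last root they combine to the factor z^-1 in
    [coroot]. *)
Lemma lies_over_coroot (k : 'I_n) (z : F) : (1 < n)%N -> z != 0 ->
  lies_over (coroot n k.+1 z) (diag_mx (coroot_row k z)).
Proof.
move=> n1 z0; pose s := sqrtC z.
have s2 : s ^+ 2 = z by exact: sqrtCK.
have s0 : s != 0 by apply: contraNneq z0 => s0; rewrite -s2 s0 expr0n.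
rewrite /coroot /coroot_row; case: ltnP => kn.
  pose k1 := Ordinal kn; rewrite -[_ *m _]scale1r.
  apply: lies_over_scale_mul (torus_intertwines _ z0) (@torus_intertwines k1 _ _) _.
    by rewrite invr_eq0.
  have -> : 1 *: (torus_elt n k.+1 z *m torus_elt n k1.+1 z^-1) =
     (s^-1 *: torus_elt n k.+1 (s ^+ 2)) *m (s^-1^-1 *: torus_elt n k1.+1 (s^-1 ^+ 2)).
    by rewrite -scalemxAl -scalemxAr scalerA invrK mulVf // exprVn s2.
  by apply: spin_mul; apply: spin_torus_pair; rewrite ?invr_eq0.
have kE : k.+1 = n by have := ltn_ord k; lia.
have k'n : (n.-2 < n)%N by lia.
pose k' := Ordinal k'n.
have -> : n.-1 = k'.+1 by rewrite /=; lia.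
have -> : torus_elt n n z = torus_elt n k.+1 z by rewrite kE.
apply: lies_over_scale_mul (@torus_intertwines k' _ z0) (torus_intertwines _ z0) _.
have -> : z^-1 *: (torus_elt n k'.+1 z *m torus_elt n k.+1 z) =
     (s^-1 *: torus_elt n k'.+1 (s ^+ 2)) *m (s^-1 *: torus_elt n k.+1 (s ^+ 2)).
  by rewrite -scalemxAl -scalemxAr scalerA -invfM -expr2 s2.
by apply: spin_mul; apply: spin_torus_pair.
Qed.

End LeviElements.

(** * From stable subspaces to modules, weights and the final statements *)

Section LeviModules.
Variables (F : numClosedFieldType) (n : nat).
Notation t := n./2.
Implicit Types (p q : sym_tangent F n) (e : 'I_t -> nat) (U W : sym_tangent F n -> Prop).

(** The coroots generate the diagonal torus of GL_n: the last two, at s and s^-1 with s a square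
    root of [z], multiply to the matrix with single entry [z] in the last place, and the other
    places follow by descending recursion. *)
Lemma torus_gen (Q : 'M[F]_n -> Prop) : (1 < n)%N ->
    (forall a b, Q a -> Q b -> Q (a *m b)) ->
    (forall (k : 'I_n) (z : F), z != 0 -> Q (diag_mx (coroot_row n k z))) ->
  forall d : 'rV[F]_n, (forall x, d 0 x != 0) -> Q (diag_mx d).
Proof.
move=> n1 QM Qc.
have single m k (z : F) : (k + m = n.-1)%N -> z != 0 -> Q (diag_mx (torus_row n k z)).
  elim: m k z => [|m IHm] k z km z0.
    rewrite addn0 in km; pose s := sqrtC z.
    have s2 : s ^+ 2 = z by exact: sqrtCK.
    have s0 : s != 0 by apply: contraNneq z0 => s0; rewrite -s2 s0 expr0n.
    have kn : (k < n)%N by lia.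
    have k'n : (n.-2 < n)%N by lia.
    have := QM _ _ (Qc (Ordinal kn) s s0) (Qc (Ordinal k'n) s^-1 _).
    rewrite invr_eq0 => /(_ s0); rewrite mulmx_diag; congr (Q (diag_mx _)).
    apply/rowP => x; rewrite /coroot_row !mxE /=.
    have -> : (k.+1 < n)%N = false by lia.
    have -> : (n.-2.+1 < n)%N by lia.
    have -> : n.-2.+1 = k by lia.
    rewrite !mxE invrK; case: (eqVneq (x : nat) k) => xk.
      have -> : (x == n.-2 :> nat) = false by lia.
      by rewrite !mul1r -expr2 s2.
    by rewrite !mulr1; case: eqP => _; rewrite ?mulfV ?mulr1.
  have kn : (k < n)%N by lia.
  have := QM _ _ (Qc (Ordinal kn) z z0) (IHm k.+1 z _ z0).
  rewrite mulmx_diag => H; have {}H := H ltac:(lia); move: H; congr (Q (diag_mx _)).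
  apply/rowP => x; rewrite /coroot_row !mxE /=.
  have -> : (k.+1 < n)%N by lia.
  rewrite !mxE; case: (eqVneq (x : nat) k.+1) => [->|_]; last by rewrite !mulr1.
  by rewrite gtn_eqF // mul1r mulVf.
move=> d d0.
have part m : (m <= n)%N -> Q (diag_mx (\row_x (if (x < m)%N then d 0 x else 1))).
  elim: m => [|m IHm] mn.
    have := single n.-1 0%N 1 (add0n _) (oner_neq0 F); congr (Q (diag_mx _)).
    by apply/rowP => x; rewrite !mxE ltn0; case: ifP.
  have := QM _ _ (IHm (ltnW mn)) (single (n.-1 - m)%N m (d 0 (Ordinal mn)) _ (d0 _)).
  move=> H; have {}H := H ltac:(lia); move: H; rewrite mulmx_diag; congr (Q (diag_mx _)).
  apply/rowP => x; rewrite !mxE; case: (ltngtP x m) => xm.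
  - by rewrite mulr1 ltnS ltnW.
  - by rewrite mulr1 ltnS leqNgt xm.
  - by rewrite mul1r ltnS xm leqnn; congr (d 0 _); apply: val_inj.
have := part n (leqnn n); congr (Q (diag_mx _)).
by apply/rowP => x; rewrite mxE ltn_ord.
Qed.

Lemma elem_mxK (i j : 'I_n) (z : F) : i != j -> elem_mx i j z *m elem_mx i j (- z) = 1%:M.
Proof.
move=> ij; rewrite /elem_mx mulmxDr mulmx1 mulmxDl mul1mx -scalemxAl -scalemxAr.
by rewrite mul_delta_mx_0 1?eq_sym // !scaler0 addr0 scaleNr addrK.
Qed.

(** Triangular factorization reduces a generic matrix to these generators; every other matrix is
    reached as the value at 0 of a polynomial curve staying in [U]. *)
Lemma rho_stable_gen U : subspace U ->
    (forall (i j : 'I_n) (z : F) p, i != j -> U p -> U (rho (elem_mx i j z) p)) ->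
    (forall d : 'rV[F]_n, (forall x, d 0 x != 0) -> forall p, U p -> U (rho (diag_mx d) p)) ->
  rho_stable U.
Proof.
move=> sU Ue Ud; split=> // g p Up; move: g p Up.
apply: (mx_density_ind (P := fun g => forall p, U p -> U (rho g p))).
- move=> g i j z ij H p Up; have ne : i != j by apply: contraTneq ij => ->; rewrite ltnn.
  rewrite -[g]mulmx1 -(elem_mxK z ne) mulmxA -rho_mul.
  by apply: H; apply: Ue.
- move=> g i j z ij H p Up; have ne : j != i by apply: contraTneq ij => ->; rewrite ltnn.
  rewrite -[g]mul1mx -(elem_mxK (- z) ne) opprK -mulmxA -rho_mul.
  by apply: Ue => //; apply: H.
- move=> g k H p Up; apply: (rho_stable_curve sU) => s s0; exact: H.
- exact: Ud.
Qed.

Hypothesis n_gt2 : (2 < n)%N.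
Let n_gt1 : (1 < n)%N := ltnW n_gt2.

Lemma sym_act_coroot (k : 'I_n) (z : F) p : z != 0 ->
  sym_act (coroot n k.+1 z) p = rho (diag_mx (coroot_row n k z)) p.
Proof. by move=> z0; have [_ ->] := lies_over_levi n_gt1 (lies_over_coroot k n_gt1 z0). Qed.

Lemma sym_act_root_elt (i j : 'I_n) (z : F) p : i != j ->
  sym_act (root_elt n i.+1 j.+1 z) p = rho (elem_mx i j z) p.
Proof. by move=> ij; have [_ ->] := lies_over_levi n_gt1 (lies_over_root_elt z n_gt2 ij). Qed.

(** Root subgroups and coroots belong to the Levi part and lie over elementary and diagonal
    matrices, which is enough by [rho_stable_gen]. *)
Lemma levi_submodule_rho_stable U : submodule (@levi F n) U -> rho_stable U.
Proof.
move=> [U0 Ul Ug]; apply: rho_stable_gen => [|i j z p ij Up|].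
- by split.
- rewrite -sym_act_root_elt //; apply: Ug => //.
  by have [] := lies_over_levi n_gt1 (lies_over_root_elt z n_gt2 ij).
apply: (torus_gen (Q := fun a => forall p, U p -> U (rho a p)) n_gt1).
- by move=> a b Ua Ub p Up; rewrite -rho_mul; apply: Ua; apply: Ub.
move=> k z z0 p Up; rewrite -sym_act_coroot //; apply: Ug => //.
by have [] := lies_over_levi n_gt1 (lies_over_coroot k n_gt1 z0).
Qed.

Lemma parabolic_submodule_rho_stable U : submodule (@parabolic F n) U -> rho_stable U.
Proof.
move=> [U0 Ul Ug]; apply: levi_submodule_rho_stable; split=> // g p [pg _].
exact: Ug.
Qed.

Lemma rho_stable_submodule U : rho_stable U -> submodule (@parabolic F n) U.
Proof.
move=> [[U0 Ul] Ug]; split=> // g p pg Up; rewrite sym_act_rho //; exact: Ug.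
Qed.

Lemma has_weight_torus w p : has_weight w p -> torus_eigen p.
Proof.
move=> wp; apply: (torus_gen (Q := fun a => exists c, rho a p = c *: p) n_gt1).
  move=> a b [ca Ea] [cb Eb]; exists (cb * ca).
  by rewrite -rho_mul Eb [rho _ _]linearZ /= Ea scalerA.
by move=> k z z0; exists (z ^ (w 0 k)); rewrite -sym_act_coroot // wp.
Qed.

Lemma highest_weight_vectorP w p : highest_weight_vector w p <->
  [/\ p != 0, has_weight w p & unip_inv p].
Proof.
have E (i j : 'I_n) z : (i < j)%N ->
    sym_act (root_elt n i.+1 j.+1 z) p = rho (elem_mx i j z) p.
  by move=> ij; apply: sym_act_root_elt; rewrite -val_eqE /= ltn_eqF.
split=> -[p0 wp up]; split; try exact: wp; try exact/eqP.
  by move=> i j z ij; rewrite -E //; apply: up.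
by move=> i j z ij; rewrite E //; apply: up.
Qed.

Lemma highest_weight_pf w p : highest_weight_vector w p ->
  exists e c, c != 0 /\ p = c *: pf_mon F e.
Proof.
move=> /highest_weight_vectorP[p0 wp up].
exact: (highest_weight_pf_mon up (has_weight_torus wp) p0).
Qed.

Lemma has_weight_inj w w' p : p != 0 -> has_weight w p -> has_weight w' p -> w = w'.
Proof.
move=> p0 wp wp'; apply/rowP => k; have z0 : (2%:R : F) != 0 by rewrite pnatr_eq0.
have := wp k _ z0; rewrite (wp' k _ z0) => /eqP.
rewrite -subr_eq0 -scalerBl scaler_eq0 (negbTE p0) orbF subr_eq0 => /eqP H.
move: H; rewrite -(ratr_nat F 2) -!fmorphXz => /fmorph_inj H.
by apply/esym; apply: (@ieexprIz rat 2%:R).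
Qed.

Lemma torus_row_prod (k m : nat) (z : F) : (k < n)%N ->
  \prod_(x < n | (x < m)%N) torus_row n k z 0 x = if (k < m)%N then z else 1.
Proof.
move=> kn; case: ifP => km.
  rewrite (bigD1 (Ordinal kn)) //= mxE eqxx big1 ?mulr1 // => x /andP[_ xk].
  by rewrite mxE; move: xk; rewrite -val_eqE /= => /negbTE ->.
rewrite big1 // => x xm; rewrite mxE; case: eqP => // xk.
by move: xm; rewrite xk km.
Qed.

(** Put m = 2(l+1). The weight eps_1 + ... + eps_m pairs to 1 with the coroot of eps_j - eps_(j+1)
    exactly when j = m, and with the last coroot it pairs to the number of indices among n-1 and n
    that are at most m: 0, 1 or 2. The last two values occur for l+1 = t, with [n] odd and even
    respectively. *)
Lemma rho_coroot_pf_poly (k : 'I_n) (z : F) (l : 'I_t) : z != 0 ->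
  rho (diag_mx (coroot_row n k z)) (pf_poly F l)
    = z ^ (gen_weight n l.+1 0 k) *: pf_poly F l.
Proof.
move=> z0; rewrite rho_pf_poly_diag; congr (_ *: _).
have ln := ltn_ord l; have kn := ltn_ord k.
rewrite /coroot_row; case: ltnP => k1.
  under eq_bigr => x _ do rewrite mxE.
  rewrite big_split /= !torus_row_prod //.
  have -> : gen_weight n l.+1 0 k = (k.+1 == l.+1.*2)%:R.
    rewrite /gen_weight; case: ltnP => lt; first by rewrite mxE.
    have kn' : (k.+1 == n) = false by lia.
    case: (boolP (odd n)) => on; last first.
      by rewrite mulmxnE !mxE kn' mul0rn [_ == _](_ : _ = false) //; lia.
    by rewrite !mxE kn' addr0; congr ((_ : bool)%:R); lia.
  have [E|E] := eqVneq k.+1 l.+1.*2.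
    have -> : (k < l.+1.*2)%N by lia.
    have -> : (k.+1 < l.+1.*2)%N = false by lia.
    by rewrite mulr1 expr1z.
  rewrite expr0z; have [kl|kl] := boolP (k < l.+1.*2)%N.
    have -> : (k.+1 < l.+1.*2)%N by lia.
    by rewrite mulfV.
  have -> : (k.+1 < l.+1.*2)%N = false by lia.
  by rewrite mulr1.
under eq_bigr => x _ do rewrite mxE.
rewrite big_split /= !torus_row_prod //; last by lia.
rewrite /gen_weight; case: (ltnP l.+1 t) => lt.
  rewrite mxE; have -> : (k.+1 == l.+1.*2) = false by lia.
  have -> : (n.-2 < l.+1.*2)%N = false by lia.
  have -> : (k < l.+1.*2)%N = false by lia.
  by rewrite expr0z mulr1.
have -> : (n.-2 < l.+1.*2)%N by lia.
rewrite /=; case: (boolP (odd n)) => on.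
  rewrite !mxE; have -> : (k.+1 == n.-1) = false by lia.
  have -> : (k.+1 == n) by lia.
  have -> : (k < l.+1.*2)%N = false by lia.
  by rewrite add0r expr1z mulr1.
rewrite mulmxnE mxE; have -> : (k.+1 == n) by lia.
have -> : (k < l.+1.*2)%N by lia.
by rewrite -expr2.
Qed.

Lemma has_weight_pf_mon e :
  has_weight (\sum_(l < t) gen_weight n l.+1 *+ e l) (pf_mon F e).
Proof.
move=> k z z0; rewrite sym_act_coroot // /pf_mon rmorph_prod /=.
under eq_bigr => l _ do rewrite rmorphXn /= rho_coroot_pf_poly // exprZn.
rewrite scaler_prod; congr (_ *: _); rewrite summxE.
have zD : {morph (fun m : int => z ^ m) : a b / a + b >-> a * b}.
  by move=> a b; rewrite expfzDr.
rewrite (big_morph (fun m : int => z ^ m) zD (expr0z z)); apply: eq_bigr => l _.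
by rewrite mulmxnE exprnP exprz_exp -[_ *+ e l]mulr_natr natz.
Qed.

Lemma highest_weight_vector_pf_mon e :
  highest_weight_vector (\sum_(l < t) gen_weight n l.+1 *+ e l) (pf_mon F e).
Proof.
apply/highest_weight_vectorP; split.
- exact: pf_mon_neq0.
- exact: has_weight_pf_mon.
- exact: unip_inv_pf_mon.
Qed.

Lemma pf_mon_delta (l : 'I_t) : pf_mon F (fun k => (k == l) : nat) = pf_poly F l.
Proof.
rewrite /pf_mon (bigD1 l) //= eqxx big1 ?mulr1 ?expr1 // => k /negbTE ->.
by rewrite expr0.
Qed.

Lemma highest_weight_vector_pf_poly (l : 'I_t) :
  highest_weight_vector (gen_weight n l.+1) (pf_poly F l).
Proof.
rewrite -pf_mon_delta; have := highest_weight_vector_pf_mon (fun k => (k == l) : nat).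
congr highest_weight_vector; rewrite (bigD1 l) //= eqxx mulr1n big1 ?addr0 // => k /negbTE ->.
by rewrite mulr0n.
Qed.

Lemma is_irr_hw_cyclic_module e :
  is_irr_hw (\sum_(l < t) gen_weight n l.+1 *+ e l) (cyclic_module (F := F) e).
Proof.
have sW := rho_stable_cyclic F e; split; last first.
  by exists (pf_mon F e); split; [|exact: highest_weight_vector_pf_mon].
split; first exact: rho_stable_submodule.
  by exists (pf_mon F e); split=> //; apply/eqP; apply: pf_mon_neq0.
move=> U sU UW [p [Up /eqP p0]] q Wq.
exact: (cyclic_module_irreducible (parabolic_submodule_rho_stable sU) UW Up p0 Wq).
Qed.

(** The isomorphism sends a Pfaffian monomial of [U] to a highest weight vector of the same weight,
    hence to a multiple of the same monomial. So [U] and [W] share a nonzero vector, and by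
    irreducibility both equal their intersection. *)
Lemma levi_multiplicity_free : multiplicity_free F n.
Proof.
move=> U W [sU [p [Up p0]] mU] [sW _ mW] [phi [phiL phiW phiI _ phiG]].
have stU := levi_submodule_rho_stable sU; have stW := levi_submodule_rho_stable sW.
have [e Ue] := rho_stable_pf_mon stU Up (introN eqP p0).
have [U0 Ul Ug] := sU; have [W0 Wl Wg] := sW.
have phi0 : phi 0 = 0.
  by have := phiL (-1) 0 0 U0 U0; rewrite scaleN1r oppr0 addr0 scaleN1r addNr.
have phiZ a q : U q -> phi (a *: q) = a *: phi q.
  by move=> Uq; have := phiL a q 0 Uq U0; rewrite phi0 !addr0.
set P := pf_mon F e.
have fP0 : phi P != 0.
  apply: contra_neq (pf_mon_neq0 F e) => fP; apply: phiI => //.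
  by rewrite fP phi0.
have uf : unip_inv (phi P).
  move=> i j z ij; have ne : i != j by rewrite -val_eqE /= ltn_eqF.
  have [lv _] := lies_over_levi n_gt1 (lies_over_root_elt z n_gt2 ne).
  by rewrite -sym_act_root_elt // -phiG // sym_act_root_elt // unip_inv_pf_mon.
have wf : forall d : 'rV[F]_n, (forall x, d 0 x != 0) -> exists c,
    rho (diag_mx d) (phi P) = c *: phi P /\ rho (diag_mx d) P = c *: P.
  apply: (torus_gen (Q := fun a => exists c, rho a (phi P) = c *: phi P
    /\ rho a P = c *: P) n_gt1) => [a b [ca [Ea Ea']] [cb [Eb Eb']]|k z z0].
    exists (cb * ca); rewrite -!rho_mul Eb Eb' ![rho _ (_ *: _)]linearZ /= Ea Ea'.
    by rewrite !scalerA.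
  exists (z ^ ((\sum_(l < t) gen_weight n l.+1 *+ e l) 0 k)).
  have wP := has_weight_pf_mon e k z0.
  have [lv _] := lies_over_levi n_gt1 (lies_over_coroot k n_gt1 z0).
  by rewrite -!sym_act_coroot // wP -phiG // wP phiZ.
have E := unip_inv_unique uf (unip_inv_pf_mon e) wf.
have WP : W P.
  have c0 : ev (phi P) (std_skew F n) != 0.
    apply: contra_neq fP0 => c0; move/eqP: E; rewrite c0 scale0r scaler_eq0.
    by rewrite (negbTE (ev_pf_mon_std _ _)) => /eqP.
  rewrite -[P]scale1r -(mulVf c0) -scalerA -E scalerA.
  by apply: (subspaceZ stW.1); apply: phiW.
pose V q := U q /\ W q.
have sV : submodule (@levi F n) V.
  split=> [|a q r [? ?] [? ?]|g q lg [? ?]]; first by split.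
    by split; [exact: Ul | exact: Wl].
  by split; [exact: Ug | exact: Wg].
have nV : exists q, V q /\ q <> 0.
  by exists P; split=> //; apply/eqP; exact: pf_mon_neq0.
move=> q; split=> [Uq|Wq].
  by have [] := mU V sV (fun r => @proj1 _ _) nV q Uq.
by have [] := mW V sV (fun r => @proj2 _ _) nV q Wq.
Qed.

Lemma msize_homog (d : nat) p : p != 0 -> p \is d.-homog -> (msize p).-1 = d.
Proof.
by move=> p0 /dhomogP hp; rewrite -(mlead_deg p0) /=; apply: hp; exact: mlead_supp.
Qed.

(** A highest weight vector is a scalar multiple of a Pfaffian monomial, and such a monomial is
    irreducible only when it is a single Pfaffian, whose degree is its index. *)
Lemma fundamental_hwP (w : 'rV[int]_n) (d : nat) : fundamental_hw F w d <->
  exists k : nat, [/\ (1 <= k <= t)%N, w = gen_weight n k & d = k].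
Proof.
split=> [[h [hw ih hd]]|[k [/andP[k0 kt] -> ->]]]; last first.
  have [l <-] : exists l : 'I_t, l.+1 = k.
    have lt : (k.-1 < t)%N by lia.
    by exists (Ordinal lt); rewrite /= prednK.
  have hP := highest_weight_vector_pf_poly l; have [P0 _ _] := hP.
  exists (pf_poly F l); split; [exact: hP | exact: pf_poly_irreducible |].
  by apply: msize_homog; [exact/eqP | exact: pf_poly_homog].
have [e [c [c0 hE]]] := highest_weight_pf hw.
have cu : (c%:MP : sym_tangent F n) \is a GRing.unit.
  by apply/unitrPr; exists (c^-1)%:MP; rewrite -mpolyCM divff // mpolyC1.
have [l el] : exists l, e l != 0%N.
  apply: contrapT => ne; case: ih => _ /negP; case.
  rewrite hE pf_mon_eq1 => [|l]; first by rewrite -mul_mpolyC mulr1.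
  by apply/eqP/negPn/negP => el; apply: ne; exists l.
(* One factor of index [l] is split off; irreducibility makes the remaining factor a unit, which
   forces all its exponents to vanish. *)
pose e' k := (e k - (k == l))%N.
have eE : pf_mon F e = pf_poly F l * pf_mon F e'.
  rewrite -pf_mon_delta -big_split /=; apply: eq_bigr => k _; rewrite -exprD.
  by congr (_ ^+ _); rewrite /e'; case: eqP => [->|_]; lia.
have [_ nu irr] := ih.
have hab : h = pf_poly F l * (c *: pf_mon F e') by rewrite hE eE scalerAr.
case: (irr _ _ hab); first by have [_ /negP] := pf_poly_irreducible F l.
rewrite -mul_mpolyC unitrM cu /= => ue'.
have e'0 k : e' k = 0%N.
  apply/eqP/negPn/negP => ek; have [_ /negP Pu _] := pf_poly_irreducible F k; apply: Pu.
  move: ue'; rewrite /pf_mon (bigD1 k) //= unitrM => /andP[+ _].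
  by rewrite unitrX_pos // lt0n.
have hP : h = c *: pf_poly F l by rewrite hE eE pf_mon_eq1 // mulr1.
have P0 : pf_poly F l != 0 by rewrite -pf_mon_delta pf_mon_neq0.
exists l.+1; split; first by rewrite /= ltn_ord.
  have [_ wP _] := highest_weight_vector_pf_poly l; have [_ wh _] := hw.
  apply: (has_weight_inj P0 _ wP) => k z z0.
  have := wh k z z0; rewrite hP !sym_act_coroot // [rho _ _]linearZ /= scalerA mulrC -scalerA.
  by move/(scalerI c0).
rewrite -hd hP msizeZ //; apply: msize_homog => //; exact: pf_poly_homog.
Qed.

Lemma sym_tangent_decomposition (r : nat) :
  exists W : exponents t r -> sym_tangent F n -> Prop,
    (forall i, is_irr_hw (exp_weight i) (W i))
    /\ direct_sum W (fun p => p \is r.-homog).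
Proof.
pose E (i : exponents t r) (l : 'I_t) : nat := val i l.
have Er i : (\sum_(l < t) l.+1 * E i l)%N = r by apply/eqP; exact: (valP i).
have Einj i j : E i =1 E j -> i = j.
  by move=> ij; apply: val_inj; apply/ffunP => l; apply: val_inj; exact: ij.
have Esurj e : (\sum_(l < t) l.+1 * e l)%N = r -> exists i, E i =1 e.
  (* Each exponent is at most its weighted contribution to the sum [r], so every solution fits the
     bounded encoding of [exponents]. *)
  move=> er; have le l : (e l < r.+1)%N.
    by rewrite ltnS -er (bigD1 l) //=; apply: leq_trans (leq_addr _ _); apply: leq_pmull.
  have ip : (\sum_(k < t) k.+1 * [ffun l => inord (e l) : 'I_r.+1] k == r)%N.
    apply/eqP; rewrite -[RHS]er; apply: eq_bigr => k _; by rewrite ffunE inordK.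
  exists (exist _ [ffun l => inord (e l)] ip : exponents t r) => l.
  by rewrite /E /= ffunE inordK.
exists (fun i => cyclic_module (F := F) (E i)); split.
  by move=> i; apply: is_irr_hw_cyclic_module.
split=> [i p Wp|p hp]; first by rewrite -(Er i); apply: cyclic_module_homog.
have [x [Wx px]] := sum_cyclic_module Er Esurj hp.
exists x; split=> // y [Wy py]; apply: (sum_cyclic_module_inj Einj Wx Wy).
by rewrite -px.
Qed.

End LeviModules.

Theorem mainTheorem11 (R : realType) (n : nat) (n_ge4 : (4 <= n)%N) :
  (forall r : nat,
     exists W : exponents n./2 r -> sym_tangent R[i] n -> Prop,
       (forall i, is_irr_hw (exp_weight i) (W i))
       /\ direct_sum W (fun p => p \is r.-homog))
  /\ multiplicity_free R[i] n
  /\ (forall (w : 'rV[int]_n) (d : nat),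
        fundamental_hw R[i] w d <->
        exists k : nat, [/\ (1 <= k <= n./2)%N, w = gen_weight n k & d = k]).
Proof.
have n2 : (2 < n)%N by apply: leq_trans n_ge4.
split; first exact: sym_tangent_decomposition.
split; [exact: levi_multiplicity_free | exact: fundamental_hwP].
Qed.
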